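(* Let $n\ge1$. Assume that $K:[0,\pi]\to[0,\infty)$ is decreasing, i.e. $K(x)\ge K(y)$ if $x\le y$, and that there exists $\delta>0$ such that $$K(x)>K(y)\quad\text{whenever}\quad 0\le x<y\le\delta .$$ Let $\rho:S^n\to[0,\infty)$ be a (real-)analytic function for which the equality $$\int_{S^n\times S^n}\rho(x)\rho(y)K(d(x,y))\,dx\,dy=\int_{S^n\times S^n}\rho^\ast(x)\rho^\ast(y)K(d(x,y))\,dx\,dy$$ holds. Then there exists a rotation $T:S^n\to S^n$ such that $\rho=\rho^\ast\circ T$.
   Context: $S^n=\{x\in\mathbb R^{n+1}:|x|=1\}$ with its surface measure, and $d:S^n\times S^n\to[0,\pi]$ is the geodesic distance. Let $\overrightarrow{n}=(1,0,\dots,0)\in S^n$. For measurable $f:S^n\to[0,\infty)$, the symmetric decreasing rearrangement $f^\ast:S^n\to[0,\infty)$ is the (unique up to null sets) measurable function that depends only on $d(\cdot,\overrightarrow{n})$, is non-increasing in $d(\cdot,\overrightarrow{n})$, and such that $\{f>t\}$ and $\{f^\ast>t\}$ have the same measure for all $t>0$. Analyticity on $S^n$ is understood with respect to the standard real-analytic structure (e.g. given by two antipodal stereographic projections). *)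

(* Defs.v *)
From HB Require Import structures.
From mathcomp Require Import all_boot all_order all_algebra.
From mathcomp Require Import all_classical all_reals all_analysis measurable_realfun.
From mathcomp Require Import ring.

Set Implicit Arguments.
Unset Strict Implicit.
Unset Printing Implicit Defensive.
Import Order.TTheory GRing.Theory Num.Theory.
Import numFieldNormedType.Exports.
Local Open Scope classical_set_scope.
Local Open Scope ring_scope.

(* The norm of the library on row vectors is the sup norm, hence [enorm]. *)
Section euclidean.
Context {R : realType} {m : nat}.
Implicit Types x y : 'rV[R]_m.

Definition dotv x y : R := \sum_(i < m) x ord0 i * y ord0 i.
Definition enorm x : R := Num.sqrt (dotv x x).

Lemma dotvZl a x y : dotv (a *: x) y = a * dotv x y.
Proof. by rewrite /dotv mulr_sumr; apply: eq_bigr => i _; rewrite mxE mulrA. Qed.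

Lemma dotvC x y : dotv x y = dotv y x.
Proof. by apply: eq_bigr => i _; rewrite mulrC. Qed.

Lemma dotvv_ge0 x : 0 <= dotv x x.
Proof. by apply: sumr_ge0 => i _; rewrite -expr2 sqr_ge0. Qed.

Lemma enorm_ge0 x : 0 <= enorm x.
Proof. exact: sqrtr_ge0. Qed.

Lemma sqr_enorm x : enorm x ^+ 2 = dotv x x.
Proof. by rewrite sqr_sqrtr ?dotvv_ge0. Qed.

Lemma enormZ a x : enorm (a *: x) = `|a| * enorm x.
Proof.
by rewrite /enorm dotvZl dotvC dotvZl mulrA -expr2 sqrtrM ?sqr_ge0// sqrtr_sqr.
Qed.

Lemma enorm_coord x i : `|x ord0 i| <= enorm x.
Proof.
rewrite -sqrtr_sqr ler_sqrt ?dotvv_ge0// /dotv (bigD1 i)//= -expr2 lerDl.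
by apply: sumr_ge0 => j _; rewrite -expr2 sqr_ge0.
Qed.

End euclidean.

Record sphere (R : realType) (n : nat) := Sphere {
  spval :> 'rV[R]_n.+1 ;
  spvalP : enorm spval == 1 }.

HB.instance Definition _ R n := [isSub for @spval R n].
HB.instance Definition _ R n := [Choice of sphere R n by <:].

Section north.
Context {R : realType} {n : nat}.

Let enorm_delta : enorm (delta_mx ord0 ord0 : 'rV[R]_n.+1) == 1.
Proof.
rewrite /enorm /dotv big_ord_recl big1 ?addr0.
  by rewrite !mxE !eqxx mulr1 sqrtr1.
by move=> i _; rewrite !mxE /= mulr0.
Qed.

Definition north : sphere R n := Sphere enorm_delta.

End north.

HB.instance Definition _ R n := isPointed.Build (sphere R n) north.

Definition gdist {R : realType} {n : nat} (x y : sphere R n) : R :=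
  acos (dotv x y).

Notation euclid R m := (m.-tuple (measurableTypeR R)).

Section lebesgue_euclid.
Context {R : realType}.

Section step.
Context {n : nat}.

Definition consE (p : measurableTypeR R * euclid R n) : euclid R n.+1 :=
  [tuple of p.1 :: p.2].

Lemma measurable_consE : measurable_fun setT consE.
Proof. by apply: measurable_cons. Qed.

Lemma behead_consE p : [tuple of behead (consE p)] = p.2.
Proof. exact/val_inj. Qed.

Variable mu : {sigma_finite_measure set (euclid R n) -> \bar R}.

Definition lebesgue_step : set (euclid R n.+1) -> \bar R :=
  pushforward (@lebesgue_measure R \x mu)%E consE.

Let mstep A : measurable A -> measurable (consE @^-1` A).
Proof. by move=> mA; rewrite -[X in measurable X]setTI; exact: measurable_consE. Qed.

Let lebesgue_step0 : lebesgue_step set0 = 0%E.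
Proof. by rewrite /lebesgue_step /pushforward preimage_set0 measure0. Qed.

Let lebesgue_step_ge0 A : (0 <= lebesgue_step A)%E.
Proof. by rewrite /lebesgue_step /pushforward; exact: measure_ge0. Qed.

Let lebesgue_step_sigma_additive : semi_sigma_additive lebesgue_step.
Proof.
move=> F mF tF mUF; rewrite /lebesgue_step /pushforward preimage_bigcup.
apply: measure_semi_sigma_additive.
- by move=> k; exact: mstep.
- apply/trivIsetP => /= i j _ _ ij; rewrite -preimage_setI.
  by move/trivIsetP : tF => /(_ _ _ _ _ ij) ->//; rewrite preimage_set0.
- by rewrite -preimage_bigcup; exact: mstep.
Qed.

HB.instance Definition _ := isMeasure.Build _ _ _ lebesgue_step
  lebesgue_step0 lebesgue_step_ge0 lebesgue_step_sigma_additive.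

Lemma lebesgue_step_box (A : set (measurableTypeR R)) (B : set (euclid R n)) :
  measurable A -> measurable B ->
  lebesgue_step [set t | A (thead t) /\ B [tuple of behead t]] =
  (lebesgue_measure A * mu B)%E.
Proof.
move=> mA mB; rewrite -product_measure1E// /lebesgue_step /pushforward.
by congr product_measure1; apply/seteqP; split => p /=; rewrite behead_consE.
Qed.

Lemma measurable_box (A : set (measurableTypeR R)) (B : set (euclid R n)) :
  measurable A -> measurable B ->
  measurable [set t : euclid R n.+1 | A (thead t) /\ B [tuple of behead t]].
Proof.
move=> mA mB; apply: measurableI.
- have := @measurable_tnth _ (measurableTypeR R) n.+1 ord0.
  by move=> /(_ measurableT A mA); rewrite setTI.
- have := @measurable_behead _ (measurableTypeR R) n.
  by move=> /(_ measurableT B mB); rewrite setTI.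
Qed.

Let lebesgue_step_sigma_finite : sigma_finite setT lebesgue_step.
Proof.
have /sigma_finiteP[F [TF ndF Foo]] := sigma_finiteT (@lebesgue_measure R).
have /sigma_finiteP[G [TG ndG Goo]] := sigma_finiteT mu.
exists (fun k => [set t | F k (thead t) /\ G k [tuple of behead t]]).
  apply/esym; rewrite -subTset => t _.
  have : [set: measurableTypeR R] (thead t) by [].
  have : [set: euclid R n] [tuple of behead t] by [].
  rewrite TF TG => -[j _ Gj] [i _ Fi]; exists (maxn i j) => //; split.
  - by move: (thead t) Fi; exact/subsetPset/ndF/leq_maxl.
  - by move: [tuple of behead t] Gj; exact/subsetPset/ndG/leq_maxr.
move=> k; have [? ?] := Foo k; have [? ?] := Goo k; split.
  exact: measurable_box.
by rewrite lebesgue_step_box// lte_mul_pinfty// ge0_fin_numE.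
Qed.

HB.instance Definition _ := Measure_isSigmaFinite.Build _ _ _ lebesgue_step
  lebesgue_step_sigma_finite.

End step.

Fixpoint lebesgue_euclid (m : nat) :
    {sigma_finite_measure set (euclid R m) -> \bar R} :=
  match m with
  | 0 => dirac ([tuple] : euclid R 0)
  | k.+1 => lebesgue_step (lebesgue_euclid k)
  end.

End lebesgue_euclid.

Definition coords {R : realType} {n : nat} (x : sphere R n) : euclid R n.+1 :=
  [tuple (x ord0 i : measurableTypeR R) | i < n.+1].

(* On R^(n+1) the product sigma-algebra is the Borel one, so its trace on the
   sphere is the Borel sigma-algebra of the sphere. *)
HB.instance Definition _ R n := Measurable.copy (sphere R n)
  (g_sigma_algebra_preimageType (@coords R n)).

Definition vec {R : realType} {m : nat} (t : euclid R m) : 'rV[R]_m :=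
  \row_i tnth t i.

Section surface_measure.
Context {R : realType} {n : nat}.
Implicit Types t : euclid R n.+1.

(* x |-> x / |x|; the value at 0 is irrelevant *)
Definition radial t : sphere R n :=
  insubd north ((enorm (vec t))^-1 *: vec t).

Definition punctured_ball : set (euclid R n.+1) :=
  [set t | 0 < enorm (vec t) <= 1].

Lemma radialE t : spval (radial t) =
  if enorm (vec t) == 0 then spval north else (enorm (vec t))^-1 *: vec t.
Proof.
rewrite /radial val_insubd enormZ ger0_norm ?invr_ge0 ?enorm_ge0//.
have [->|t0] := eqVneq (enorm (vec t)) 0; last by rewrite mulVf// eqxx.
by rewrite mulr0 eq_sym oner_eq0.
Qed.

Lemma measurable_enorm_vec : measurable_fun setT (fun t => enorm (vec t)).
Proof.
apply: measurableT_comp.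
  apply: continuous_measurable_fun; exact: sqrt_continuous.
apply: measurable_sum => i; under eq_fun do rewrite mxE.
by apply: measurable_funM; exact: measurable_tnth.
Qed.

Lemma measurable_punctured_ball : measurable punctured_ball.
Proof.
rewrite (_ : punctured_ball = (fun t => enorm (vec t)) @^-1` `]0, 1]).
  by rewrite -[X in measurable X]setTI; exact: measurable_enorm_vec.
by apply/seteqP; split => t; rewrite /punctured_ball /= in_itv.
Qed.

Lemma measurable_radial : measurable_fun setT radial.
Proof.
move=> _ A [B mB <-]; rewrite !setTI -comp_preimage.
rewrite -[X in measurable X]setTI.
suff : measurable_fun setT (coords \o radial) by apply.
apply/measurable_fun_tnthP => i.
rewrite (_ : _ \o _ = fun t => if enorm (vec t) == 0
  then (@north R n : 'rV__) ord0 i else (enorm (vec t))^-1 * tnth t i); last first.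
  apply/funext => t /=; rewrite tnth_mktuple radialE.
  by case: ifP => // _; rewrite !mxE.
apply: measurable_fun_ifT => //=.
- apply: (measurable_fun_eqr measurable_enorm_vec); exact: measurable_cst.
- apply: measurable_funM; last exact: measurable_tnth.
  rewrite (_ : (fun=> _) = @powR R ^~ (-1) \o (fun t => enorm (vec t))).
    exact: measurableT_comp (measurable_powR _) measurable_enorm_vec.
  by apply/funext => t /=; rewrite powR_inv1// enorm_ge0.
Qed.

(* n+1 times the volume of the cone {r x | x in A, 0 < r <= 1} *)
Definition surface_measure (A : set (sphere R n)) : \bar R :=
  (n.+1%:R%:E * lebesgue_euclid n.+1 (radial @^-1` A `&` punctured_ball))%E.

Lemma lebesgue_punctured_ball_lty :
  (lebesgue_euclid n.+1 punctured_ball < +oo)%E.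
Proof.
have [C [mC Coo sC]] : exists C : set (euclid R n.+1), [/\ measurable C,
    (lebesgue_euclid n.+1 C < +oo)%E &
    forall t, (forall i, `|tnth t i| <= 1) -> C t].
  elim: n.+1 => [|m [C [mC Coo sC]]].
    exists setT; split=> //=; by rewrite diracT ltry.
  exists [set t | `[-1, 1]%classic (thead t) /\ C [tuple of behead t]]; split.
  - exact: (measurable_box (measurable_itv _)).
  - have E := lebesgue_step_box (lebesgue_euclid m) (measurable_itv `[-1, 1]) mC.
    apply: (eq_ind_r (fun z => (z < +oo)%E) _ E).
    rewrite lte_mul_pinfty//.
    by rewrite lebesgue_measure_itv/=; case: ifP.
  - move=> t tle1; split; first by rewrite /= in_itv/= -ler_norml; exact: tle1.
    by apply: sC => i; rewrite tnth_behead; exact: tle1.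
apply: le_lt_trans Coo; apply: le_measure; rewrite ?inE//.
  exact: measurable_punctured_ball.
move=> t /andP[_ t1]; apply: sC => i.
by have := enorm_coord (vec t) i; rewrite mxE => /le_trans; apply.
Qed.

Let cone_measure := mscale (n.+1%:R)%:nng
  (measure_function_pushforward__canonical__measure_function_Measure
    (mrestr (lebesgue_euclid n.+1) measurable_punctured_ball)
    measurable_radial).

Let surface_measure0 : surface_measure set0 = 0%E.
Proof. exact: (measure0 cone_measure). Qed.

Let surface_measure_ge0 A : (0 <= surface_measure A)%E.
Proof. exact: (measure_ge0 cone_measure). Qed.

Let surface_measure_sigma_additive : semi_sigma_additive surface_measure.
Proof. exact: (@measure_semi_sigma_additive _ _ _ cone_measure). Qed.

HB.instance Definition _ := isMeasure.Build _ _ _ surface_measure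
  surface_measure0 surface_measure_ge0 surface_measure_sigma_additive.

Let fin_num_surface_measure : fin_num_fun surface_measure.
Proof.
move=> A mA; rewrite /surface_measure fin_numM// ge0_fin_numE//.
apply: le_lt_trans lebesgue_punctured_ball_lty.
have mB := measurable_punctured_ball.
have mI : measurable (radial @^-1` A `&` punctured_ball).
  apply: measurableI => //.
  by rewrite -[X in measurable X]setTI; exact: measurable_radial.
by apply: le_measure; rewrite ?inE//; exact: subIsetr.
Qed.

HB.instance Definition _ := Measure_isFinite.Build _ _ _ surface_measure
  fin_num_surface_measure.

End surface_measure.

Section stereographic.
Context {R : realType} {n : nat}.

Definition stereo_vec (b : bool) (y : 'rV[R]_n) : 'rV[R]_n.+1 :=
  \row_i if unlift ord0 i is Some j
         then 2 * y ord0 j / (enorm y ^+ 2 + 1)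
         else (-1) ^+ b * (enorm y ^+ 2 - 1) / (enorm y ^+ 2 + 1).

Let enorm_stereo_vec b y : enorm (stereo_vec b y) == 1.
Proof.
have d0 : enorm y ^+ 2 + 1 != 0 by rewrite lt0r_neq0// ltr_wpDl// sqr_ge0.
rewrite -(@eqrXn2 _ 2)// ?enorm_ge0// expr1n sqr_enorm /dotv big_ord_recl.
rewrite !mxE unlift_none; under eq_bigr do rewrite !mxE liftK.
rewrite (eq_bigr (fun i => (4 / (enorm y ^+ 2 + 1) ^+ 2) *
  (y ord0 i * y ord0 i))); last by move=> i _; field.
rewrite -mulr_sumr -/(dotv y y) -sqr_enorm.
have : (-1) ^+ b * (-1) ^+ b = 1 :> R by rewrite -expr2 sqrr_sign.
set s := (-1) ^+ b; set e := enorm y in d0 * => s2; apply/eqP.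
transitivity (s * s * (e ^+ 2 - 1) ^+ 2 / (e ^+ 2 + 1) ^+ 2 +
  4 / (e ^+ 2 + 1) ^+ 2 * e ^+ 2); first by field.
by rewrite s2; field.
Qed.

(* Inverse of the stereographic projection onto the equatorial hyperplane, from
   the pole north (b = false) or from its antipode (b = true) *)
Definition stereo_inv b y : sphere R n := Sphere (enorm_stereo_vec b y).

End stereographic.

(* g is the sum of an absolutely convergent power series near a; by absolute
   convergence the order in which the terms are summed (here over the boxes
   {0, ..., N-1}^m) is irrelevant. *)
Definition real_analytic_at {R : realType} {m : nat} (g : 'rV[R]_m -> R)
    (a : 'rV[R]_m) : Prop :=
  exists (c : {ffun 'I_m -> nat} -> R) (r : R), 0 < r /\
    forall y, enorm (y - a) < r ->
      let term (k : {ffun 'I_m -> nat}) :=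
        c k * \prod_(i < m) (y ord0 i - a ord0 i) ^+ k i in
      summable setT (fun k => (term k)%:E) /\
      \sum_(k : {ffun 'I_m -> 'I_N}) term [ffun i => k i : nat] @[N --> \oo]
        --> g y.

Definition sphere_analytic {R : realType} {n : nat} (f : sphere R n -> R) :=
  forall b y, real_analytic_at (f \o stereo_inv b) y.

(* The second clause also forces fs to depend on the distance to north only. *)
Definition symm_decr_rearrangement {R : realType} {n : nat}
    (f fs : sphere R n -> R) : Prop :=
  [/\ measurable_fun setT fs,
      forall x, 0 <= fs x,
      forall x y, gdist x north <= gdist y north -> fs y <= fs x &
      forall t, 0 < t -> surface_measure [set x | t < f x] =
                         surface_measure [set x | t < fs x]].

Definition rotation {R : realType} {n : nat} (T : sphere R n -> sphere R n) :=
  exists A : 'M[R]_n.+1, [/\ A *m A^T = 1%:M, \det A = 1 &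
    forall x : sphere R n, T x = x *m A :> 'rV[R]_n.+1].

(* Main.v *)
Require Import Defs.
From mathcomp Require Import all_boot all_order all_algebra.
From mathcomp Require Import all_classical all_reals all_analysis.
From mathcomp Require Import measurable_realfun zify ring lra.

(** Write [srefl v] for the reflection in the hyperplane orthogonal to [v], and
    [D_v x = f x - f (srefl v x)]. The polarization of [f] in direction [v]
    exchanges, where necessary, the values of [f] at mirror points, so that the
    larger one lies on the side [0 <= x . v]. It does not change the measures of
    superlevel sets. Summed over the four pairs of mirror images of [(x, y)], the
    integrand of the energy increases by a product of two nonnegative factors:
    the gain of the rearrangement inequality for the two pairs of values, which
    is positive exactly if [D_v x * D_v y < 0], and the difference of the kernel
    at [x . y] and at [x . srefl v y] ([orbit_interaction_polar]). So polarization
    does not decrease the energy, and if it does not increase the energy of a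
    continuous [f] either, then [0 <= D_v x * D_v y] for all [x] and [y] on the
    positive side whose distance is in the range where the kernel is strictly
    decreasing ([energy_polar_eq]).

    If each [D_v] has a constant sign on the positive side of [v], then [f] is a
    nondecreasing function of the inner product with its centre of mass
    ([symmetric_about_centre_of_mass]), and such a function agrees almost
    everywhere with the composition of its rearrangement and a rotation
    ([axial_rearrangement]).

    The first use of these facts is the inequality between the energies of [f] and
    of its rearrangement ([energy_le_rearrangement]). The functions with the
    bounds, the moduli of continuity and the distribution of [f] form a set that
    is compact for pointwise convergence and closed under polarization. For a
    kernel that is strictly decreasing everywhere, a function of maximal energy in
    this set has differences [D_v] of constant sign, so it has the energy of the
    rearrangement.

    The second use is the theorem. The polarizations of [rho] have the same
    rearrangement as [rho], so under the assumed equality they do not have a larger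
    energy, and [0 <= D_v x * D_v y] for nearby [x] and [y]. By analyticity, [D_v]
    either vanishes identically or vanishes on no cap
    ([analytic_reflection_continuation]). In the second case a chain of points
    where [D_v] is not zero transports its sign over the half-sphere
    ([sign_propagation]).

    Unique continuation is proved on curves. Any two points of the sphere are
    joined by a rational curve [t |-> P t / q t]. Along it, the partial sums of
    power series in a stereographic chart become rational functions of degree
    [O(N)] with an error that is geometric in [N]. A polynomial of degree [O(N)]
    that is small on an interval is larger on the adjacent interval by at most a
    factor [a ^ N]; close to the centre of expansion the error beats this factor,
    so the zeros of an analytic function propagate along the curve. *)

Set Implicit Arguments.
Unset Strict Implicit.
Unset Printing Implicit Defensive.
Import Order.TTheory GRing.Theory Num.Theory.
Import numFieldNormedType.Exports.
Local Open Scope classical_set_scope.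
Local Open Scope ring_scope.

(** * Reflections and the geometry of the sphere *)

Section dot_product.
Context {R : realType} {m : nat}.
Implicit Types (x y z v : 'rV[R]_m) (A : 'M[R]_m).

Lemma dotv_mulmx x y : dotv x y = (x *m y^T) ord0 ord0.
Proof. by rewrite mxE; apply: eq_bigr => i _; rewrite mxE. Qed.

Lemma dotvDl x y z : dotv (x + y) z = dotv x z + dotv y z.
Proof. by rewrite !dotv_mulmx mulmxDl mxE. Qed.

Lemma dotvDr x y z : dotv x (y + z) = dotv x y + dotv x z.
Proof. by rewrite dotvC dotvDl !(dotvC x). Qed.

Lemma dotvZr a x y : dotv x (a *: y) = a * dotv x y.
Proof. by rewrite dotvC dotvZl dotvC. Qed.

Lemma dotvNl x y : dotv (- x) y = - dotv x y.
Proof. by rewrite -scaleN1r dotvZl mulN1r. Qed.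

Lemma dotvNr x y : dotv x (- y) = - dotv x y.
Proof. by rewrite dotvC dotvNl dotvC. Qed.

Definition dotvE := (dotvDl, dotvDr, dotvNl, dotvNr, @dotvZl R m, dotvZr).

Lemma dotv0 x : dotv x 0 = 0.
Proof. by rewrite -(scale0r x) dotvZr mul0r. Qed.

Lemma dotv_delta x i : dotv x (delta_mx ord0 i) = x ord0 i.
Proof.
rewrite /dotv (bigD1 i)//= big1 ?addr0 => [|j ji].
  by rewrite mxE !eqxx mulr1.
by rewrite mxE (negbTE ji) andbF mulr0.
Qed.

Lemma dotvv_eq0 x : (dotv x x == 0) = (x == 0).
Proof.
apply/idP/eqP => [|->]; last by rewrite dotv0.
rewrite psumr_eq0 => [|i _]; last by rewrite -expr2 sqr_ge0.
move=> /allP h; apply/rowP => i; rewrite mxE; apply/eqP.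
by have := h i (mem_index_enum _); rewrite mulf_eq0 orbb.
Qed.

Lemma dotvv_gt0 x : (0 < dotv x x) = (x != 0).
Proof. by rewrite lt0r dotvv_eq0 dotvv_ge0 andbT. Qed.

Lemma dotv_enorm_le x y : dotv x y <= enorm x * enorm y.
Proof.
have [->|y0] := eqVneq y 0; first by rewrite dotv0 mulr_ge0 ?enorm_ge0.
have yy : 0 < dotv y y by rewrite dotvv_gt0.
have [xy|xy] := leP (dotv x y) 0.
  by rewrite (le_trans xy)// mulr_ge0 ?enorm_ge0.
rewrite -(@ler_pXn2r _ 2)// ?nnegrE ?mulr_ge0 ?enorm_ge0 ?(ltW xy)//.
rewrite exprMn !sqr_enorm.
have := dotvv_ge0 (dotv y y *: x - dotv x y *: y).
rewrite !dotvE (dotvC y x).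
set a := dotv x x; set b := dotv y y in yy *; set c := dotv x y.
rewrite (_ : _ + _ = b * (a * b - c ^+ 2)); last by ring.
by rewrite pmulr_rge0// subr_ge0.
Qed.

Lemma ler_enormD x y : enorm (x + y) <= enorm x + enorm y.
Proof.
rewrite -(@ler_pXn2r _ 2)// ?nnegrE ?addr_ge0 ?enorm_ge0//.
rewrite sqrrD !sqr_enorm !dotvE (dotvC y x).
have := dotv_enorm_le x y; lra.
Qed.

Lemma enormN x : enorm (- x) = enorm x.
Proof. by rewrite /enorm dotvNl dotvNr opprK. Qed.

Lemma enorm_distC x y : enorm (x - y) = enorm (y - x).
Proof. by rewrite -enormN opprB. Qed.

Lemma enorm_eq0 x : (enorm x == 0) = (x == 0).
Proof. by rewrite -(sqrf_eq0 (enorm x)) sqr_enorm dotvv_eq0. Qed.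

Lemma enorm_gt0 x : (0 < enorm x) = (x != 0).
Proof. by rewrite lt0r enorm_eq0 enorm_ge0 andbT. Qed.

Definition orthomx A := A *m A^T = 1%:M.

Lemma orthogonal_mul A B : orthomx A -> orthomx B -> orthomx (A *m B).
Proof.
by rewrite /orthomx => hA hB; rewrite trmx_mul mulmxA -(mulmxA A) hB mulmx1.
Qed.

Lemma dotv_orthogonal A x y : orthomx A -> dotv (x *m A) (y *m A) = dotv x y.
Proof.
by move=> hA; rewrite !dotv_mulmx trmx_mul mulmxA -(mulmxA x) hA mulmx1.
Qed.

Lemma enorm_orthogonal A x : orthomx A -> enorm (x *m A) = enorm x.
Proof. by move=> hA; rewrite /enorm dotv_orthogonal. Qed.

Lemma det_orthogonal A : orthomx A -> \det A = 1 \/ \det A = -1.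
Proof.
move=> /(congr1 determinant); rewrite det_mulmx det_tr det1 -expr2 => /eqP.
by rewrite sqrf_eq1 => /orP[]/eqP; [left|right].
Qed.

(** The reflection in the hyperplane orthogonal to [v]; for [v = 0] the quotient
    is 0, and this is the identity. *)
Definition reflmx v : 'M[R]_m := 1%:M - (2 / dotv v v) *: (v^T *m v).

Lemma mul_reflmx x v : x *m reflmx v = x - (2 * dotv x v / dotv v v) *: v.
Proof.
rewrite mulmxBr mulmx1 -scalemxAr mulmxA; congr (_ - _).
rewrite (_ : x *m v^T = (dotv x v)%:M); last first.
  by apply/matrixP => i j; rewrite !ord1 dotv_mulmx [RHS]mxE eqxx.
by rewrite mul_scalar_mx scalerA mulrAC.
Qed.

Lemma trmx_reflmx v : (reflmx v)^T = reflmx v.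
Proof.
by rewrite /reflmx linearB /= linearZ /= trmx_mul trmxK trmx1.
Qed.

Lemma mul_reflmxK x v : x *m reflmx v *m reflmx v = x.
Proof.
have [->|v0] := eqVneq v 0; first by rewrite !mul_reflmx !dotv0 !scaler0 !subr0.
rewrite !mul_reflmx !dotvE.
have : dotv v v != 0 by rewrite dotvv_eq0.
move: (dotv x v) (dotv v v) => a b b0.
rewrite -addrA -opprD -scalerDl [X in X *: v](_ : _ = 0).
  by rewrite scale0r subr0.
by field.
Qed.

Lemma orthogonal_reflmx v : orthomx (reflmx v).
Proof.
rewrite /orthomx trmx_reflmx; apply/row_matrixP => i.
by rewrite !rowE mulmxA mul_reflmxK mulmx1.
Qed.

Lemma dotv_reflmx_dir x v : dotv (x *m reflmx v) v = - dotv x v.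
Proof.
have [->|v0] := eqVneq v 0; first by rewrite !dotv0 oppr0.
rewrite mul_reflmx !dotvE; have : dotv v v != 0 by rewrite dotvv_eq0.
by move: (dotv x v) (dotv v v) => a b b0; field.
Qed.

Lemma dotv_reflmxC x y v : dotv (x *m reflmx v) y = dotv x (y *m reflmx v).
Proof. by rewrite -{1}(mul_reflmxK y v) (dotv_orthogonal _ _ (orthogonal_reflmx v)). Qed.

Lemma dotv_reflmx x y v :
  dotv x (y *m reflmx v) = dotv x y - 2 * dotv x v * dotv y v / dotv v v.
Proof.
by rewrite mul_reflmx dotvDr dotvNr dotvZr; congr (_ - _); ring.
Qed.

End dot_product.

Section sphere_geometry.
Context {R : realType} {n : nat}.
Implicit Types (x y z : sphere R n) (v : 'rV[R]_n.+1) (A : 'M[R]_n.+1).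

Lemma enorm_sphere x : enorm x = 1.
Proof. exact/eqP/spvalP. Qed.

Lemma dotv_sphere x : dotv x x = 1.
Proof. by rewrite -sqr_enorm enorm_sphere expr1n. Qed.

Lemma dotv_sphere_le1 x y : dotv x y <= 1.
Proof. by rewrite (le_trans (dotv_enorm_le _ _))// !enorm_sphere mulr1. Qed.

Lemma dotv_sphere_geN1 x y : -1 <= dotv x y.
Proof.
rewrite lerNl -dotvNl (le_trans (dotv_enorm_le _ _))// enormN.
by rewrite !enorm_sphere mulr1.
Qed.

Lemma sphere_inj x y : x = y :> 'rV[R]_n.+1 -> x = y.
Proof. exact: val_inj. Qed.

Lemma sqr_chord x y : enorm (spval x - spval y) ^+ 2 = 2 - 2 * dotv x y.
Proof. by rewrite sqr_enorm !dotvE !dotv_sphere (dotvC y x); ring. Qed.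

Lemma dotv_sphere1 x y : dotv x y = 1 -> x = y.
Proof.
move=> xy; apply: sphere_inj; apply/eqP; rewrite -subr_eq0 -enorm_eq0.
by rewrite -sqrf_eq0 sqr_chord xy mulr1 subrr eqxx.
Qed.

(** For an orthogonal [A] the product lies on the sphere, and the default [x] is
    not reached. *)
Definition mact A x : sphere R n := insubd x (spval x *m A).

Lemma val_mact A x : orthomx A -> mact A x = x *m A :> 'rV[R]_n.+1.
Proof.
by move=> hA; rewrite /mact val_insubd enorm_orthogonal// enorm_sphere eqxx.
Qed.

Definition srefl v := mact (reflmx v).

Lemma val_srefl v x : srefl v x = x *m reflmx v :> 'rV[R]_n.+1.
Proof. exact: val_mact (orthogonal_reflmx v). Qed.

Lemma sreflK v : involutive (srefl v).
Proof. by move=> x; apply: sphere_inj; rewrite !val_srefl mul_reflmxK. Qed.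

Lemma dotv_srefl_dir v x : dotv (srefl v x) v = - dotv x v.
Proof. by rewrite val_srefl dotv_reflmx_dir. Qed.

Lemma dotv_sreflC v x y : dotv (srefl v x) y = dotv x (srefl v y).
Proof. by rewrite !val_srefl dotv_reflmxC. Qed.

Lemma dotv_srefl2 v x y : dotv (srefl v x) (srefl v y) = dotv x y.
Proof. by rewrite dotv_sreflC sreflK. Qed.

(** On one side of the mirror, a point is nearer to another one than to the mirror
    image of the latter. All properties of polarization rest on this. *)
Lemma dotv_srefl_le v x y : 0 <= dotv x v -> 0 <= dotv y v ->
  dotv x (srefl v y) <= dotv x y.
Proof.
move=> xv yv; rewrite val_srefl dotv_reflmx gerBl.
by rewrite !mulr_ge0// invr_ge0 dotvv_ge0.
Qed.

Lemma dotv_srefl_lt v x y : 0 < dotv x v -> 0 < dotv y v ->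
  dotv x (srefl v y) < dotv x y.
Proof.
move=> xv yv; have v0 : v != 0 by apply: contraTneq xv => ->; rewrite dotv0 ltxx.
rewrite val_srefl dotv_reflmx gtrBl.
by rewrite !mulr_gt0// invr_gt0 dotvv_gt0.
Qed.

Lemma srefl_id v x : dotv x v = 0 -> srefl v x = x.
Proof.
move=> xv; apply: sphere_inj.
by rewrite val_srefl mul_reflmx xv mulr0 mul0r scale0r subr0.
Qed.

(** The mirror exchanging two points of the sphere is their bisecting hyperplane;
    reflections therefore act transitively. *)
Lemma srefl_swap x y : srefl (spval x - spval y) x = y.
Proof.
apply: sphere_inj; rewrite val_srefl mul_reflmx.
have [/eqP xy|xy] := eqVneq (spval x - spval y) 0.
  by rewrite subr_eq0 in xy; rewrite (eqP xy) subrr scaler0 subr0.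
have := xy; rewrite -dotvv_eq0 !dotvE !dotv_sphere (dotvC y x).
move: (dotv x y) => a a0; rewrite (_ : _ / _ = 1) ?scale1r ?subKr//.
by field; rewrite -{1}(opprK a) in a0 *; apply: contraNneq a0 => <-; apply/eqP; ring.
Qed.

End sphere_geometry.

(** * Invariance of Lebesgue measure under orthogonal maps *)

Section tuples.
Context {R : realType}.

Definition tup m (v : 'rV[R]_m) : euclid R m :=
  [tuple (v ord0 i : measurableTypeR R) | i < m].

Lemma vec_tup m (v : 'rV[R]_m) : vec (tup v) = v.
Proof. by apply/rowP => i; rewrite mxE tnth_mktuple. Qed.

Lemma tup_vec m (t : euclid R m) : tup (vec t) = t.
Proof. by apply: eq_from_tnth => i; rewrite tnth_mktuple mxE. Qed.

Lemma measurable_tup d (T : measurableType d) m (g : T -> 'rV[R]_m) :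
  (forall i, measurable_fun setT (fun z => g z ord0 i)) ->
  measurable_fun setT (fun z => tup (g z)).
Proof.
move=> mg; apply/measurable_fun_tnthP => i.
rewrite (_ : _ \o _ = fun z => g z ord0 i); first exact: mg.
by apply/funext => z /=; rewrite tnth_mktuple.
Qed.

Lemma measurable_vec m (i : 'I_m) :
  measurable_fun setT (fun t : euclid R m => vec t ord0 i).
Proof. by under eq_fun do rewrite mxE; exact: measurable_tnth. Qed.

Lemma measurable_vecD m (a : 'rV[R]_m) :
  measurable_fun setT (fun t : euclid R m => tup (vec t + a)).
Proof.
apply: measurable_tup => i; under eq_fun do rewrite mxE.
by apply: measurable_funD => //; exact: measurable_vec.
Qed.

Lemma measurable_rowM d (T : measurableType d) m (g : T -> 'rV[R]_m) (A : 'M[R]_m) :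
  (forall i, measurable_fun setT (fun z => g z ord0 i)) ->
  forall i, measurable_fun setT (fun z => (g z *m A) ord0 i).
Proof.
move=> mg i; under eq_fun do rewrite mxE.
by apply: measurable_sum => j; apply: measurable_funM.
Qed.

End tuples.

Section translation_invariance.
Context {R : realType}.
Local Open Scope ereal_scope.

Lemma lebesgue_integral_translation1 (f : R -> \bar R) (a : R) :
  measurable_fun [set: measurableTypeR R] f -> (forall x, 0 <= f x) ->
  \int[@lebesgue_measure R]_x f (x + a)%R = \int[@lebesgue_measure R]_x f x.
Proof.
move=> mf f0.
pose s (x : measurableTypeR R) : measurableTypeR R := (x + a)%R.
have ms : measurable_fun setT s by exact: measurable_funD.
have E : \int[pushforward lebesgue_measure s]_x f x = \int[lebesgue_measure]_x f x.
  apply: eq_measure_integral => A mA _; apply/esym.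
  have := @lebesgue_measure_unique R
    (measure_function_pushforward__canonical__measure_function_Measure
       (@lebesgue_measure R) ms).
  apply => // _ [[u v] _ <-] /=.
  rewrite /pushforward (_ : s @^-1` _ = `](u - a)%R, (v - a)%R]%classic); last first.
    by apply/seteqP; split => x /=; rewrite /s !in_itv/= ltrBlDr lerBrDr.
  rewrite !lebesgue_measure_itv/= !lte_fin ltrD2r.
  by case: ifP => // _; rewrite -!EFinB; congr (_%:E); rewrite opprB addrA subrK.
by rewrite -E ge0_integral_pushforward.
Qed.

(** Unfolding the product measure, so that translation invariance reduces to the
    line by induction on the dimension. *)
Lemma lebesgue_euclid_succ m (f : euclid R m.+1 -> \bar R) :
  measurable_fun setT f -> (forall x, 0 <= f x) ->
  \int[lebesgue_euclid m.+1]_t f t =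
  \int[lebesgue_euclid m]_t \int[lebesgue_measure]_x f (consE (x, t)).
Proof.
move=> mf f0.
rewrite [LHS](_ : _ =
  \int[pushforward (@lebesgue_measure R \x lebesgue_euclid m) (@consE R m)]_t f t)//.
rewrite ge0_integral_pushforward//; last exact: measurable_consE.
rewrite preimage_setT fubini_tonelli2//.
by apply: measurableT_comp mf _; exact: measurable_consE.
by move=> z; exact: f0.
Qed.

Lemma lebesgue_euclid_translation m (f : euclid R m -> \bar R) (a : 'rV[R]_m) :
  measurable_fun setT f -> (forall x, 0 <= f x) ->
  \int[lebesgue_euclid m]_t f (tup (vec t + a)%R) = \int[lebesgue_euclid m]_t f t.
Proof.
elim: m => [|m IH] in f a * => mf f0.
  by apply: eq_integral => t _; rewrite (tuple0 t) (tuple0 (tup _)).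
rewrite (lebesgue_euclid_succ (measurableT_comp mf (measurable_vecD a)) (fun=> f0 _)).
rewrite (lebesgue_euclid_succ mf f0).
pose a' : 'rV[R]_m := (\row_i a ord0 (lift ord0 i))%R.
have mfc : measurable_fun setT (f \o @consE R m).
  exact: measurableT_comp mf measurable_consE.
rewrite -(IH (fun t => \int[lebesgue_measure]_x f (consE (x, t))) a'); first last.
- by move=> t; apply: integral_ge0.
- by apply: (@measurable_fun_fubini_tonelli_G _ _ _ _ R (@lebesgue_measure R) _ mfc) => z; exact: f0.
apply: eq_integral => t _.
rewrite -[RHS](lebesgue_integral_translation1 (a ord0 ord0)); first last.
- by [].
- by apply: (measurableT_comp mfc); exact: measurable_pair2.
apply: eq_integral => x _; congr (f _).
apply: eq_from_tnth => i; rewrite tnth_mktuple !mxE.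
case: (unliftP ord0 i) => [j|] ->.
  by rewrite /consE !tnthS/= tnth_mktuple !mxE.
by rewrite /consE !tnth0.
Qed.

End translation_invariance.

Section orthogonal_invariance.
Context {R : realType} {n : nat}.
Local Open Scope ereal_scope.
Local Notation m := n.+1.
Local Notation lam := (@lebesgue_euclid R m).

Lemma lebesgue_euclid_cube m' (c : 'rV[R]_m') (s : R) : (0 < s)%R ->
  exists C : set (euclid R m'), [/\ measurable C, 0 < lebesgue_euclid m' C &
    forall t, C t -> forall i, (`|vec t ord0 i - c ord0 i| <= s)%R].
Proof.
move=> s0; elim: m' c => [|k IH] c.
  by exists setT; split=> [//||t _ []//]; rewrite /= diracT.
have [C [mC C0 sC]] := IH (\row_i c ord0 (lift ord0 i))%R.
pose I := `[(c ord0 ord0 - s)%R, (c ord0 ord0 + s)%R]%classic : set (measurableTypeR R).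
exists [set t | I (thead t) /\ C [tuple of behead t]]; split.
- by apply: measurable_box => //; exact: measurable_itv.
- have E := lebesgue_step_box (lebesgue_euclid k) (measurable_itv `[(c ord0 ord0 - s)%R, (c ord0 ord0 + s)%R]) mC.
  apply: (eq_ind_r (fun z => 0 < z) _ E).
  rewrite mule_gt0// lebesgue_measure_itv/= lte_fin.
  have -> : (c ord0 ord0 - s < c ord0 ord0 + s)%R by lra.
  by rewrite lte_fin; lra.
- move=> t [It /sC Ct] i; case: (unliftP ord0 i) => [j|] ->.
    rewrite (_ : lift ord0 j = inord j.+1); last first.
      by apply/val_inj; rewrite /= inordK// ltnS ltn_ord.
    by have := Ct j; rewrite !mxE -tnth_behead (_ : lift ord0 j = inord j.+1)//; apply/val_inj; rewrite /= inordK// ltnS ltn_ord.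
  by move: It; rewrite /I /= in_itv/= mxE ler_distl.
Qed.

Lemma punctured_ball_orthogonal A (t : euclid R m) : orthomx A ->
  punctured_ball (tup (vec t *m A)) = punctured_ball t.
Proof. by move=> hA; rewrite /punctured_ball /= vec_tup enorm_orthogonal. Qed.

Lemma enorm_le_sup m' (x : 'rV[R]_m') (s : R) :
  (forall i, `|x ord0 i| <= s)%R -> (enorm x <= m'%:R * s)%R.
Proof.
case: m' => [|k] in x * => xs.
  by rewrite /enorm /dotv big_ord0 sqrtr0 mul0r.
have s0 : (0 <= s)%R by rewrite (le_trans _ (xs ord0)).
rewrite -(@ler_pXn2r _ 2)// ?nnegrE ?mulr_ge0 ?enorm_ge0// sqr_enorm /dotv.
apply: (@le_trans _ _ (\sum_(i < k.+1) s ^+ 2)%R).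
  apply: ler_sum => i _; rewrite -expr2 -[leLHS]real_normK ?num_real//.
  by rewrite ler_pXn2r ?nnegrE.
rewrite sumr_const card_ord exprMn -[X in (X <= _)%R]mulr_natl ler_wpM2r ?sqr_ge0//.
by rewrite -natrX ler_nat expnS expn1 leq_pmulr.
Qed.

Lemma lebesgue_euclid_ball_gt0 (v : 'rV[R]_m) (r : R) (B : set (euclid R m)) :
  (0 < r)%R -> measurable B -> (forall t, (enorm (vec t - v) < r)%R -> B t) ->
  0 < lam B.
Proof.
move=> r0 mB rB.
have s0 : (0 < r / (2 * m%:R))%R by rewrite divr_gt0// mulr_gt0.
have [C [mC C0 sC]] := lebesgue_euclid_cube v s0.
apply: (lt_le_trans C0); apply: le_measure; rewrite ?inE// => t /sC tv.
apply: rB; apply: (@le_lt_trans _ _ (m%:R * (r / (2 * m%:R)))%R).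
  by apply: enorm_le_sup => i; have := tv i; rewrite !mxE.
rewrite (_ : _ * _ = r / 2)%R; last by field; rewrite gt_eqF.
by rewrite ltr_pdivrMr// ltr_pMr// ltr1n.
Qed.

Lemma lebesgue_punctured_ball_gt0 : 0 < lam punctured_ball.
Proof.
apply: (@lebesgue_euclid_ball_gt0 (2^-1 *: spval (@north R n))%R (4^-1)%R) => //.
  exact: measurable_punctured_ball.
move=> t; set w := (_ *: _)%R => tw.
have wE : enorm w = 2^-1%R by rewrite /w enormZ enorm_sphere mulr1 ger0_norm.
have h1 := ler_enormD (vec t - w) w; have h2 := ler_enormD (w - vec t) (vec t).
rewrite subrK wE in h1; rewrite subrK wE enorm_distC in h2.
by apply/andP; split; lra.
Qed.

(** The uniqueness argument for translation-invariant measures. With [g] the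
    indicator of the punctured unit ball, [g (y)] and [g (y - x *m A)] can be
    exchanged under the double integral of [f (x *m A) * g y] by translating [x]
    and [y] in turn, and [g] is invariant under [A]. *)
Lemma lebesgue_euclid_orthogonal (A : 'M[R]_m) (f : euclid R m -> \bar R) :
  orthomx A -> measurable_fun setT f -> (forall x, 0 <= f x) ->
  \int[lam]_t f (tup (vec t *m A)) = \int[lam]_t f t.
Proof.
move=> hA mf f0.
pose g (t : euclid R m) : \bar R := (\1_(@punctured_ball R n) t)%:E.
have mg : measurable_fun setT g.
  apply/measurable_EFinP; exact: measurable_indic measurable_punctured_ball.
have g0 t : 0 <= g t by rewrite lee_fin.
have Vg : \int[lam]_t g t = lam (@punctured_ball R n).
  by rewrite integral_indic ?setIT//; exact: measurable_punctured_ball.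
have m1 (B : 'M[R]_m) i :
    measurable_fun setT (fun z : euclid R m * euclid R m => (vec z.1 *m B) ord0 i).
  by apply: measurable_rowM => j; exact: measurableT_comp (measurable_vec j) measurable_fst.
have m2 (B : 'M[R]_m) i :
    measurable_fun setT (fun z : euclid R m * euclid R m => (vec z.2 *m B) ord0 i).
  by apply: measurable_rowM => j; exact: measurableT_comp (measurable_vec j) measurable_snd.
have mgf : measurable_fun setT (fun t => f (tup (vec t *m A))).
  apply: measurableT_comp mf _.
  by apply: measurable_tup; apply: measurable_rowM => i; exact: measurable_vec.
have mF (B C : 'M[R]_m) : measurable_fun setT (fun z : euclid R m * euclid R m =>
    f (tup (vec z.1 *m B + vec z.2 *m C)%R)).
  apply: measurableT_comp mf _; apply: measurable_tup => i.
  by under eq_fun do rewrite mxE; exact: measurable_funD (m1 _ _) (m2 _ _).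
have mG (B C : 'M[R]_m) : measurable_fun setT (fun z : euclid R m * euclid R m =>
    g (tup (vec z.1 *m B + vec z.2 *m C)%R)).
  apply: measurableT_comp mg _; apply: measurable_tup => i.
  by under eq_fun do rewrite mxE; exact: measurable_funD (m1 _ _) (m2 _ _).
have gE s t : enorm (vec s) = enorm (vec t) -> g s = g t.
  by move=> st; rewrite /g !indicE; congr ((_%:R)%:E); congr nat_of_bool;
    apply/idP/idP; rewrite !inE /punctured_ball /= st.
pose H (B C B' C' : 'M[R]_m) (z : euclid R m * euclid R m) :=
  f (tup (vec z.1 *m B + vec z.2 *m C)%R) * g (tup (vec z.1 *m B' + vec z.2 *m C')%R).
have mH B C B' C' : measurable_fun setT (H B C B' C').
  exact: emeasurable_funM (mF _ _) (mG _ _).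
have H0 B C B' C' z : 0 <= H B C B' C' z by rewrite mule_ge0.
have tonelli B C B' C' := fubini_tonelli (H B C B' C') (mH B C B' C') (H0 B C B' C') : 
  \int[lam]_x \int[lam]_y H B C B' C' (x, y) = \int[lam]_y \int[lam]_x H B C B' C' (x, y).
pose V := fine (lam (@punctured_ball R n)).
have VE : lam (@punctured_ball R n) = V%:E.
  by rewrite fineK// ge0_fin_numE//; exact: lebesgue_punctured_ball_lty.
have V0 : (0 < V)%R by rewrite -lte_fin -VE; exact: lebesgue_punctured_ball_gt0.
have e0 (s t : euclid R m) : tup (vec s *m 0 + vec t *m 1%:M)%R = t.
  by rewrite mulmx0 add0r mulmx1 tup_vec.
have Zl (c : \bar R) (h : euclid R m -> \bar R) : 0 <= c ->
    measurable_fun setT h -> (forall x, 0 <= h x) ->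
    \int[lam]_x (c * h x) = c * \int[lam]_x h x.
  by move=> c0 mh h0; exact: (ge0_integralZl _ measurableT mh (fun x _ => h0 x) c0).
suff : (\int[lam]_t f (tup (vec t *m A)%R)) * V%:E = (\int[lam]_t f t) * V%:E.
  move=> /(congr1 (fun z => z * V^-1%:E)).
  by rewrite -!muleA -EFinM mulfV ?gt_eqF// !mule1.
(* [H B C B' C'] is [f (x *m B + y *m C) * g (x *m B' + y *m C')]; both sides
   are multiplied by the integral [V] of [g]. *)
transitivity (\int[lam]_x \int[lam]_y H A 0%R 0%R 1%:M (x, y)).
  rewrite muleC -Zl//; last by rewrite lee_fin ltW.
  apply: eq_integral => x _; rewrite /H /= -VE -Vg muleC.
  rewrite -(Zl _ _ (f0 _) mg g0); apply: eq_integral => y _.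
  by rewrite e0 mulmx0 addr0.
(* translation of [x] by [y *m A^T] *)
rewrite tonelli; transitivity (\int[lam]_y \int[lam]_x H A 1%:M 0%R 1%:M (x, y)).
  apply: eq_integral => y _.
  rewrite -[LHS](lebesgue_euclid_translation (vec y *m A^T)); first last.
  - by move=> x; exact: H0.
  - by apply: (measurableT_comp (mH _ _ _ _)); exact: measurable_pair2.
  apply: eq_integral => x _; rewrite /H /= !vec_tup mulmxDl -mulmxA (mulmx1C hA) !mulmx0 addr0.
  by [].
(* translation of [y] by [- x *m A] *)
rewrite -tonelli; transitivity (\int[lam]_x \int[lam]_y H 0%R 1%:M (- A)%R 1%:M (x, y)).
  apply: eq_integral => x _.
  rewrite -[LHS](lebesgue_euclid_translation (- (vec x *m A))%R); first last.
  - by move=> y; exact: H0.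
  - by apply: (measurableT_comp (mH _ _ _ _)); exact: pair1_measurable.
  apply: eq_integral => y _; rewrite /H /= !vec_tup mulmxDl !mulmx1 !mulmx0 add0r.
  by rewrite addrCA subrr addr0 add0r mulmxN addrC.
rewrite tonelli muleC -Zl//; last by rewrite lee_fin ltW.
apply: eq_integral => y _; rewrite /H /= -VE -Vg muleC.
transitivity (\int[lam]_x (f y * g (tup (vec x + - (vec y *m A^T))%R))).
  apply: eq_integral => x _; rewrite e0; congr (_ * _); apply: gE.
  rewrite !vec_tup mulmx1 -[RHS](enorm_orthogonal _ hA) mulmxBl -mulmxA (mulmx1C hA) mulmx1.
  by rewrite mulmxN addrC enorm_distC.
rewrite Zl; [|exact: f0|exact: measurableT_comp mg (measurable_vecD _)|by move=> x; exact: g0].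
by congr (_ * _); exact: lebesgue_euclid_translation.
Qed.

End orthogonal_invariance.

(** * Invariance and positivity of the surface measure *)

Section surface_measure_theory.
Context {R : realType} {n : nat}.
Local Notation S := (sphere R n).
Local Notation mu := (@surface_measure R n).

Lemma measurable_coord (i : 'I_n.+1) :
  measurable_fun setT (fun x : S => spval x ord0 i : R).
Proof.
have mc : measurable_fun setT (@coords R n).
  by move=> _ B mB; rewrite setTI; exists B => //; rewrite setTI.
rewrite (_ : (fun _ => _) = (tnth (T:=measurableTypeR R) ^~ i) \o @coords R n).
  by apply: measurableT_comp mc; exact: measurable_tnth.
by apply/funext => x /=; rewrite tnth_mktuple.
Qed.

Lemma measurable_to_sphere d (T : measurableType d) (g : T -> S) :
  (forall i, measurable_fun setT (fun z => spval (g z) ord0 i : R)) ->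
  measurable_fun setT g.
Proof.
move=> mg _ A [B mB <-]; rewrite !setTI -comp_preimage.
rewrite -[X in measurable X]setTI.
suff : measurable_fun setT (coords \o g) by apply.
apply/measurable_fun_tnthP => i.
rewrite (_ : _ \o _ = fun z => spval (g z) ord0 i); first exact: mg.
by apply/funext => z /=; rewrite tnth_mktuple.
Qed.

Lemma measurable_mact (A : 'M[R]_n.+1) : orthomx A -> measurable_fun setT (@mact R n A).
Proof.
move=> hA; apply: measurable_to_sphere => i.
under eq_fun do rewrite val_mact//.
by apply: measurable_rowM => j; exact: measurable_coord.
Qed.

Lemma measurable_dotv d (T : measurableType d) (g h : T -> 'rV[R]_n.+1) :
  (forall i, measurable_fun setT (fun z => g z ord0 i)) ->
  (forall i, measurable_fun setT (fun z => h z ord0 i)) ->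
  measurable_fun setT (fun z => dotv (g z) (h z)).
Proof.
by move=> mg mh; apply: measurable_sum => i; exact: measurable_funM.
Qed.

Lemma measurable_dotv_sphere (v : 'rV[R]_n.+1) :
  measurable_fun setT (fun x : S => dotv x v).
Proof. by apply: measurable_dotv => i //; exact: measurable_coord. Qed.

(** The cone over a subset of the sphere is rotated with it, so that invariance of
    the surface measure follows from that of the volume. *)
Lemma radial_mact A t : orthomx A -> punctured_ball t ->
  mact A (radial t : S) = radial (tup (vec t *m A)).
Proof.
move=> hA /andP[t0 _]; apply: sphere_inj.
by rewrite val_mact// !radialE vec_tup enorm_orthogonal// gt_eqF// scalemxAl.
Qed.

Lemma surface_measure_mact (A : 'M[R]_n.+1) (B : set S) : orthomx A -> measurable B ->
  mu (mact A @^-1` B) = mu B.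
Proof.
move=> hA mB; rewrite /surface_measure; congr (_ * _)%E.
have mC : measurable (radial @^-1` B `&` @punctured_ball R n).
  apply: measurableI; last exact: measurable_punctured_ball.
  by rewrite -[X in measurable X]setTI; exact: measurable_radial.
set C := _ `&` _ in mC *.
have mI : measurable_fun setT (EFin \o (\1_C : euclid R n.+1 -> R)).
  by apply/measurable_EFinP; exact: measurable_indic.
have I0 t : (0 <= (EFin \o (\1_C : euclid R n.+1 -> R)) t)%E by rewrite lee_fin.
have mA : measurable_fun setT (fun t : euclid R n.+1 => tup (vec t *m A)).
  by apply: measurable_tup; apply: measurable_rowM => i; exact: measurable_vec.
have CE t : C (tup (vec t *m A)) = (radial @^-1` (mact A @^-1` B) `&` @punctured_ball R n) t.
  rewrite /C /= punctured_ball_orthogonal//; apply/propext.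
  by split=> -[tB tp]; split=> //; move: tB; rewrite radial_mact.
have -> : radial @^-1` (mact A @^-1` B) `&` @punctured_ball R n =
    (fun t => tup (vec t *m A)) @^-1` C by apply/seteqP; split => t; rewrite /= CE.
have mAC : measurable ((fun t => tup (vec t *m A)) @^-1` C).
  by rewrite -[X in measurable X]setTI; exact: mA.
have := lebesgue_euclid_orthogonal hA mI I0.
by rewrite (integral_indic _ measurableT mC) (integral_indic _ measurableT mAC) !setIT.
Qed.

Lemma integral_mact (A : 'M[R]_n.+1) (f : S -> \bar R) : orthomx A ->
  measurable_fun setT f -> (forall x, 0 <= f x)%E ->
  (\int[mu]_x f (mact A x) = \int[mu]_x f x)%E.
Proof.
move=> hA mf f0; have mA := measurable_mact hA.
rewrite -[LHS](ge0_integral_pushforward mA mu measurableT mf) => [|x _]; last exact: f0.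
by apply: eq_measure_integral => B mB _; exact: surface_measure_mact.
Qed.

Lemma integral2_mact (A B : 'M[R]_n.+1) (f : S * S -> \bar R) : orthomx A -> orthomx B ->
  measurable_fun setT f -> (forall x, 0 <= f x)%E ->
  (\int[mu \x mu]_z f (mact A z.1, mact B z.2) = \int[mu \x mu]_z f z)%E.
Proof.
move=> hA hB mf f0; have mA := measurable_mact hA; have mB := measurable_mact hB.
have mAB : measurable_fun setT (fun z : S * S => (mact A z.1, mact B z.2)).
  by apply/measurable_fun_pairP; split; [exact: measurableT_comp mA measurable_fst|
    exact: measurableT_comp mB measurable_snd].
rewrite (fubini_tonelli1 (fun z => f (mact A z.1, mact B z.2))) ; first last.
- by move=> z; exact: f0.
- exact: measurableT_comp mf mAB.
rewrite (fubini_tonelli1 f mf f0) -[RHS](integral_mact hA); first last.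
- by move=> x; apply: integral_ge0 => y _; exact: f0.
- exact: measurable_fun_fubini_tonelli_F.
apply: eq_integral => x _.
rewrite /fubini_F /=.
apply: (integral_mact hB (f := fun y => f (mact A x, y))).
- by apply: (measurableT_comp mf); exact: pair1_measurable.
- by move=> y; exact: f0.
Qed.

(** The cone over a cap contains a Euclidean ball around half of its centre. *)
Lemma surface_measure_cap_gt0 (x : S) (r : R) (B : set S) : r < 1 ->
  measurable B -> (forall y : S, r < dotv x y -> B y) -> (0 < mu B)%E.
Proof.
move=> r1 mB rB; wlog rN1 : r r1 rB / -1 <= r.
  move=> W; have [|rN1] := leP (-1) r; first exact: W.
  apply: (W (-1)); rewrite ?ltrN11 ?lexx// => y y1.
  by apply: rB; exact: lt_trans y1.
rewrite /surface_measure mule_gt0//.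
have s0 : 0 < (1 - r) / 8 by lra.
apply: (@lebesgue_euclid_ball_gt0 _ _ (2^-1 *: spval x) _ _ s0).
  apply: measurableI; last exact: measurable_punctured_ball.
  by rewrite -[X in measurable X]setTI; exact: measurable_radial.
move=> t; set w := (_ *: _) => tw.
have wE : enorm w = 2^-1 by rewrite /w enormZ enorm_sphere mulr1 ger0_norm.
have h1 := ler_enormD (vec t - w) w; have h2 := ler_enormD (w - vec t) (vec t).
rewrite subrK wE in h1; rewrite subrK wE enorm_distC in h2.
have t0 : 0 < enorm (vec t) by lra.
split; last by apply/andP; split; lra.
apply: rB; rewrite radialE gt_eqF// dotvZr -(ltr_pM2l t0) mulVKf ?gt_eqF//.
have : dotv x (w - vec t) <= enorm (vec t - w).
  by rewrite -enorm_distC (le_trans (dotv_enorm_le _ _))// enorm_sphere mul1r.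
rewrite dotvDr dotvNr {1}/w dotvZr dotv_sphere.
by nra.
Qed.

End surface_measure_theory.

(** * Continuous functions on the sphere *)

Section sphere_topology.
Context {R : realType} {n : nat}.
Local Notation S := (sphere R n).
Local Notation mu := (@surface_measure R n).
Implicit Types (x y z : S) (f : S -> R) (V : set S).

(** The topology of the sphere is expressed by caps [c < x . y], since the inner
    product is the only quantity that occurs in the kernel and in reflections. *)
Definition sphere_open V :=
  forall x, V x -> exists c, c < 1 /\ forall y, c < dotv x y -> V y.

Definition scont f := forall x e, 0 < e ->
  exists c, c < 1 /\ forall y, c < dotv x y -> `|f x - f y| < e.

(** From [|x - z|^2 <= 2 |x - y|^2 + 2 |y - z|^2] and [|x - y|^2 = 2 - 2 x . y]. *)
Lemma cap_triangle (c : R) x y z :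
  1 - (1 - c) / 4 < dotv x y -> 1 - (1 - c) / 4 < dotv y z -> c < dotv x z.
Proof.
move=> xy yz.
have := dotvv_ge0 ((spval x - spval y) - (spval y - spval z)).
rewrite !dotvE !dotv_sphere (dotvC y x) (dotvC z y) (dotvC z x).
lra.
Qed.

Lemma measurable_cap (v : 'rV[R]_n.+1) (c : R) : measurable [set x : S | c < dotv x v].
Proof.
rewrite (_ : mkset _ = (fun x : S => dotv x v) @^-1` `]c, +oo[).
  by rewrite -[X in measurable X]setTI; exact: measurable_dotv_sphere.
by apply/seteqP; split => x /=; rewrite in_itv/= andbT.
Qed.

(** An open set is the union of the countably many caps that it contains, whose
    axis and height are rational; the axis need not be a unit vector. *)
Lemma measurable_sphere_open V : sphere_open V -> measurable V.
Proof.
move=> oV.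
pose q (u : n.+1.-tuple rat) : 'rV[R]_n.+1 := \row_i ratr (tnth u i).
pose cap (u : n.+1.-tuple rat * rat) := [set x : S | ratr u.2 < dotv x (q u.1)].
pose F u := [set x | cap u `<=` V /\ cap u x].
have -> : V = \bigcup_u F u.
  apply/seteqP; split=> x; last by move=> [u _ [uV ux]]; exact: uV.
  move=> /oV[c [c1 cV]].
  pose e := (1 - c) / 4; have e0 : 0 < e by rewrite divr_gt0// subr_gt0.
  have en0 : 0 < e / n.+1%:R by rewrite divr_gt0.
  have [w wx] : exists w : 'I_n.+1 -> rat, forall i,
      `|ratr (w i) - spval x ord0 i| <= e / n.+1%:R.
    suff /boolp.choice[w] : forall i, exists w : rat, `|ratr w - spval x ord0 i| <= e / n.+1%:R.
      by exists w.
    move=> i.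
    have /rat_in_itvoo[w] : spval x ord0 i < spval x ord0 i + e / n.+1%:R by rewrite ltrDl.
    rewrite in_itv/= => /andP[w1 w2]; exists w.
    by rewrite ler_distl (ltW w2) andbT (le_trans _ (ltW w1))// gerBl ltW.
  have /rat_in_itvoo[s] : c + e < 1 - e by rewrite /e; lra.
  rewrite in_itv/= => /andP[s1 s2].
  pose u := [tuple w i | i < n.+1].
  have xu : enorm (q u - spval x) <= e.
    rewrite (le_trans (enorm_le_sup (s := e / n.+1%:R) _))//.
      by move=> i; rewrite !mxE tnth_mktuple.
    by rewrite mulrCA divff ?mulr1// pnatr_eq0.
  have close y : `|dotv y (q u) - dotv y x| <= e.
    rewrite -dotvNr -dotvDr ler_norml lerNl -dotvNl.
    by rewrite !(le_trans (dotv_enorm_le _ _))// ?enormN enorm_sphere mul1r.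
  exists (u, s) => //; split => [y|] /=; rewrite /cap /=.
    by move=> sy; apply: cV; rewrite dotvC; have := close y; rewrite ler_distl; lra.
  by have := close x; rewrite dotv_sphere ler_distl; lra.
apply: countable_bigcupT_measurable => [|u]; first exact: countableP.
have [uV|uV] := pselect (cap u `<=` V).
  rewrite (_ : F u = cap u); first exact: measurable_cap.
  by apply/seteqP; split=> [x []|x].
by rewrite (_ : F u = set0)//; apply/seteqP; split=> [x []|x].
Qed.

Lemma scont_open f (t : R) : scont f -> sphere_open [set x | t < f x].
Proof.
move=> cf x /= tx; have [|c [c1 cx]] := cf x (f x - t); first by rewrite subr_gt0.
by exists c; split=> // y /cx; rewrite ltr_distl; lra.
Qed.

Lemma scont_measurable f : scont f -> measurable_fun setT f.
Proof.
move=> cf; apply: (measurability _ (RGenOInfty.measurableE R)).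
move=> _ [_ [t ->] <-]; rewrite setTI.
rewrite (_ : _ @^-1` _ = [set x | t < f x]).
  exact/measurable_sphere_open/scont_open.
by apply/seteqP; split => x /=; rewrite in_itv/= andbT.
Qed.

Lemma continuous_dotv (v : 'rV[R]_n.+1) : continuous (dotv v).
Proof.
apply: continuous_big; first exact: add_continuous.
move=> i _ w; have H := @coord_continuous R 1 n.+1 ord0 i w.
exact: cvgM (cvg_cst _) H.
Qed.

Lemma compact_sphere : compact [set v : 'rV[R]_n.+1 | dotv v v = 1].
Proof.
have cube : compact [set v : 'rV[R]_n.+1 | forall i, v ord0 i \in `[(- 1), 1]].
  apply: (@rV_compact R n.+1 (fun=> `[(- 1), 1]%classic)) => _; exact: segment_compact.
apply: subclosed_compact cube _ => [|v /= v1 i].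
  have c2 : continuous (fun v : 'rV[R]_n.+1 => dotv v v).
    apply: continuous_big; first exact: add_continuous.
    move=> i _ w; have H := @coord_continuous R 1 n.+1 ord0 i w.
    exact: (cvgM H H).
  have := @preimage_closed _ _ (fun v : 'rV[R]_n.+1 => dotv v v) [set x | x = 1].
  by apply => [x _|]; [exact: c2|exact: closed_eq].
by rewrite in_itv/= -ler_norml -[leRHS]sqrtr1 -v1; exact: enorm_coord.
Qed.

(** Compactness of the sphere, in the form in which it is used: a property that
    holds eventually, uniformly on a cap around each point, holds eventually on
    the whole sphere. *)
Lemma sphere_near (I : Type) (F : set_system I) {FF : Filter F} (P : I -> S -> Prop) :
  (forall x, exists c, c < 1 /\ \forall i \near F, forall y, c < dotv x y -> P i y) ->
  \forall i \near F, forall y, P i y.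
Proof.
move=> FP.
have /(_ _ F (fun i v => forall y : S, spval y = v -> P i y) FF) := (iffLR (compact_near_coveringP _)) compact_sphere.
have H (v : 'rV[R]_n.+1) : dotv v v = 1 ->
    \near v & F, forall y : S, spval y = v -> P F y.
  move=> v1; have ev : enorm v == 1 by rewrite /enorm v1 sqrtr1.
  have [c [c1 cP]] := FP (Sphere ev).
  exists ([set w | c < dotv v w], [set i | forall y, c < dotv (Sphere ev) y -> P i y]).
    split=> //=; have := @continuous_dotv v v => /(_ [set z | c < z]); apply.
    by rewrite v1; exact: lt_nbhsr.
  by move=> [w i] /= [vw cPi] y yw; apply: cPi; rewrite /= yw.
move=> /(_ H); apply: filterS => i /= Pi y; apply: (Pi (spval y)) => //=.
exact: dotv_sphere.
Qed.

Lemma scont_bounded f : scont f -> exists M, forall x, `|f x| <= M.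
Proof.
move=> cf; have : \forall M \near +oo, forall x, `|f x| <= M.
  apply: sphere_near => x; have [c [c1 cx]] := cf x 1 ltr01.
  exists c; split=> //; near=> M => y /cx xy; rewrite (@le_trans _ _ (`|f x| + 1))//.
  have := ler_normB (f x) (f x - f y); rewrite opprB addrC subrK => /le_trans; apply.
  by rewrite lerD2l ltW.
by move=> /filter_ex.
Unshelve. all: by end_near. Qed.

Lemma scont_unif f e : scont f -> 0 < e ->
  exists c, c < 1 /\ forall x y, c < dotv x y -> `|f x - f y| <= e.
Proof.
move=> cf e0; have : \forall c \near 1^'-, forall x y, c < dotv x y -> `|f x - f y| <= e.
  apply: sphere_near => x; have [|c [c1 cx]] := cf x (e / 2); first by rewrite divr_gt0.
  exists (1 - (1 - c) / 4); split; first by lra.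
  near=> d => y xy z yz.
  have fy : `|f x - f y| < e / 2 by apply: cx; lra.
  have fz : `|f x - f z| < e / 2.
    apply: cx; apply: (cap_triangle xy); apply: lt_trans yz.
    by near: d; apply: nbhs_left_gt; lra.
  have -> : f y - f z = (f x - f z) - (f x - f y) by ring.
  by rewrite (le_trans (ler_normB _ _))//; lra.
move=> H; have [d [d1 dP]] : exists d, d < 1 /\ forall x y, d < dotv x y -> `|f x - f y| <= e.
  near (1 : R)^'- => d; exists d; split; first by near: d; exact: nbhs_left_lt.
  by near: d.
by exists d.
Unshelve. all: by end_near. Qed.

Lemma ae_mu_cap (P : set S) : {ae mu, forall x, P x} ->
  forall x c, c < 1 -> exists y, c < dotv x y /\ P y.
Proof.
move=> [B [mB B0 PB]] x c c1; apply: contrapT => nP.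
have : (0 < mu B)%E; last by rewrite B0 ltxx.
apply: (surface_measure_cap_gt0 (x := x) c1 mB) => y xy; apply: PB => /= Py.
by apply: nP; exists y.
Qed.

Lemma ae_mu2_cap (P : set (S * S)) : {ae (mu \x mu)%E, forall w, P w} ->
  forall x y c, c < 1 -> exists w : S * S, [/\ c < dotv x w.1, c < dotv y w.2 & P w].
Proof.
move=> [B [mB B0 PB]] x y c c1; apply: contrapT => nP.
pose C v := [set z : S | c < dotv z (spval v)].
have C0 (v : S) : (0 < mu (C v))%E.
  apply: (surface_measure_cap_gt0 (x := v) c1); first exact: measurable_cap.
  by move=> z; rewrite /C /= dotvC.
have : ((mu \x mu) (C x `*` C y) <= (mu \x mu) B)%E.
  apply: le_measure; rewrite ?inE//; first by apply: measurableX; exact: measurable_cap.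
  move=> w [/= w1 w2]; apply: PB => /= Pw; apply: nP; exists w.
  by rewrite dotvC (dotvC y).
rewrite B0 product_measure1E; [|exact: measurable_cap|exact: measurable_cap].
by move=> /(lt_le_trans (mule_gt0 (C0 x) (C0 y))); rewrite ltxx.
Qed.

Lemma scont_integral0 f : scont f -> (forall x, 0 <= f x) ->
  (\int[mu]_x (f x)%:E = 0)%E -> forall x, f x = 0.
Proof.
move=> cf f0 If x; apply/eqP; rewrite eq_le f0 andbT leNgt; apply/negP => fx.
have : ae_eq mu setT (EFin \o f) (cst 0%E).
  apply/(ae_eq_integral_abs mu measurableT).
    by apply/measurable_EFinP; exact: scont_measurable.
  by rewrite -[RHS]If; apply: eq_integral => y _ /=; rewrite ger0_norm.
move=> /(@ae_mu_cap (fun y => setT y -> (f y)%:E = 0%E)) H.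
have [c [c1 cx]] := cf x _ fx.
have [y [/cx xy]] := H x _ c1; move=> /(_ I) [fy].
by move: xy; rewrite fy subr0 ger0_norm ?ltxx// ltW.
Qed.

End sphere_topology.

Section sphere_continuity.
Context {R : realType} {n : nat}.
Local Notation S := (sphere R n).
Implicit Types (x y : S) (f g : S -> R) (v : 'rV[R]_n.+1).

Lemma dotv_near (e : R) : 0 < e -> exists c, c < 1 /\
  forall x y, c < dotv x y -> forall v, `|dotv x v - dotv y v| <= e * enorm v.
Proof.
move=> e0; exists (1 - e ^+ 2 / 2); split; first by rewrite gtrBl divr_gt0// exprn_gt0.
move=> x y xy v; have ve := enorm_ge0 v.
have xye : enorm (spval x - spval y) <= e.
  rewrite -(@ler_pXn2r _ 2)// ?nnegrE ?enorm_ge0 ?(ltW e0)// sqr_chord; lra.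
rewrite -dotvNl -dotvDl ler_norml lerNl -dotvNl.
rewrite !(le_trans (dotv_enorm_le _ _))//; last by rewrite enormN ler_wpM2r.
by rewrite ler_wpM2r.
Qed.

Lemma scont_dotv v : scont (fun x => dotv x v).
Proof.
move=> x e e0; have v0 := enorm_ge0 v.
have e'0 : 0 < e / (enorm v + 1) by rewrite divr_gt0// ltr_wpDl.
have [c [c1 cP]] := dotv_near e'0; exists c; split=> // y /cP /(_ v) /le_lt_trans; apply.
by rewrite mulrAC ltr_pdivrMr ?ltr_wpDl// ltr_pM2l// ltrDl.
Qed.

Lemma scontB f g : scont f -> scont g -> scont (fun x => f x - g x).
Proof.
move=> cf cg x e e0; have e20 : 0 < e / 2 by rewrite divr_gt0.
have [c [c1 cP]] := cf x _ e20; have [d [d1 dP]] := cg x _ e20.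
exists (Num.max c d); split; first by rewrite gt_max c1.
move=> y; rewrite gt_max => /andP[/cP h1 /dP h2].
have -> : f x - g x - (f y - g y) = (f x - f y) - (g x - g y) by ring.
by rewrite (le_lt_trans (ler_normB _ _))//; lra.
Qed.

Lemma scontM f g : scont f -> scont g -> scont (fun x => f x * g x).
Proof.
move=> cf cg x e e0.
have [M Mf] := scont_bounded cf.
have M0 : 0 <= M by rewrite (le_trans _ (Mf x)).
have d0 : 0 < e / 2 / (M + 1) by rewrite !divr_gt0// ltr_wpDl.
have d'0 : 0 < e / 2 / (`|g x| + 1) by rewrite !divr_gt0// ltr_wpDl.
have [c [c1 cP]] := cf x _ d'0; have [d [d1 dP]] := cg x _ d0.
exists (Num.max c d); split; first by rewrite gt_max c1.
move=> y; rewrite gt_max => /andP[/cP h1 /dP h2].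
have -> : f x * g x - f y * g y = (f x - f y) * g x + f y * (g x - g y) by ring.
rewrite (le_lt_trans (ler_normD _ _))// !normrM [ltRHS](splitr e) ltr_leD//.
  apply: (@le_lt_trans _ _ (e / 2 / (`|g x| + 1) * `|g x|)).
    by rewrite ler_wpM2r// ltW.
  by rewrite mulrAC ltr_pdivrMr ?ltr_wpDl// ltr_pM2l ?divr_gt0// ltrDl.
apply: (@le_trans _ _ (M * (e / 2 / (M + 1)))); first by rewrite ler_pM// ltW.
by rewrite mulrCA ger_pMr ?divr_gt0// ler_pdivrMr ?ltr_wpDl// mul1r lerDl.
Qed.

Lemma scont_srefl v f : scont f -> scont (f \o srefl v).
Proof.
move=> cf x e e0; have [c [c1 cP]] := cf (srefl v x) _ e0; exists c; split=> // y xy.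
by apply: cP; rewrite dotv_srefl2.
Qed.

(** A modulus of continuity, as a relation between the size of a cap and the
    oscillation; it determines a closed condition on [f]. *)
Definition modulus f (c e : R) := forall x y, c < dotv x y -> `|f x - f y| <= e.

Lemma scontP f : scont f <-> forall e, 0 < e -> exists c, c < 1 /\ modulus f c e.
Proof.
split=> [cf e e0|H x e e0]; first exact: scont_unif.
have [|c [c1 cP]] := H (e / 2); first by rewrite divr_gt0.
exists c; split=> // y /cP /le_lt_trans; apply; lra.
Qed.

Lemma scont_near_gt f x (a : R) : scont f -> a < f x ->
  exists c, c < 1 /\ forall y, c < dotv x y -> a < f y.
Proof. by move=> cf; move: x; exact: scont_open. Qed.

End sphere_continuity.

(** * Polarization *)

Section polarization.
Context {R : realType} {n : nat}.
Local Notation S := (sphere R n).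
Local Notation mu := (@surface_measure R n).
Implicit Types (x y : S) (f : S -> R) (v : 'rV[R]_n.+1).

(** The larger of the values at two mirror points is placed on the side of [v]. *)
Definition polar v f x :=
  if 0 <= dotv x v then Num.max (f x) (f (srefl v x))
  else Num.min (f x) (f (srefl v x)).

Lemma polarE v f x : 0 <= dotv x v ->
  polar v f x = Num.max (f x) (f (srefl v x)).
Proof. by rewrite /polar => ->. Qed.

Lemma polar_srefl v f x : 0 <= dotv x v ->
  polar v f (srefl v x) = Num.min (f x) (f (srefl v x)).
Proof.
move=> x0; rewrite /polar dotv_srefl_dir oppr_ge0 sreflK.
case: leP => h; last by rewrite minC.
by rewrite srefl_id ?maxxx ?minxx//; apply/eqP; rewrite eq_le h.
Qed.

Lemma srefl_cases v x : 0 <= dotv x v \/ exists2 y, x = srefl v y & 0 <= dotv y v.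
Proof.
have [|xv] := leP 0 (dotv x v); first by left.
by right; exists (srefl v x); rewrite ?sreflK// dotv_srefl_dir oppr_ge0 ltW.
Qed.

Lemma polar_ge0 v f : (forall x, 0 <= f x) -> forall x, 0 <= polar v f x.
Proof. by move=> f0 x; rewrite /polar; case: ifP; rewrite ?le_max ?le_min !f0. Qed.

Lemma polar_le v f M : (forall x, f x <= M) -> forall x, polar v f x <= M.
Proof. by move=> f0 x; rewrite /polar; case: ifP; rewrite ?ge_max ?ge_min !f0. Qed.

Lemma measurable_srefl v : measurable_fun setT (@srefl R n v).
Proof. exact: measurable_mact (orthogonal_reflmx v). Qed.

Lemma measurable_polar v f : measurable_fun setT f -> measurable_fun setT (polar v f).
Proof.
move=> mf; have mfs := measurableT_comp mf (measurable_srefl v).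
apply: measurable_fun_ifT; [|exact: measurable_maxr|exact: measurable_minr].
by apply: measurable_fun_ler; [exact: measurable_cst|exact: measurable_dotv_sphere].
Qed.

(** For [x] and [y] on opposite sides of the mirror, the distance of [x] to the
    mirror image of [y] is even smaller, so that all four differences between values
    at [x], [y] and their images that matter are bounded by [e]. *)
Lemma polar_modulus v f c e : modulus f c e -> modulus (polar v f) c e.
Proof.
move=> H x y; have [x0|[x' -> x0]] := srefl_cases v x;
  have [y0|[y' -> y0]] := srefl_cases v y; move=> xy.
- rewrite !polarE//; have h1 := H _ _ xy.
  have h2 : `|f (srefl v x) - f (srefl v y)| <= e by apply: H; rewrite dotv_srefl2.
  move: h1 h2; rewrite !ler_distl.
  by case: (leP (f x) (f (srefl v x))); case: (leP (f y) (f (srefl v y))); lra.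
- have xy' := lt_le_trans xy (dotv_srefl_le x0 y0).
  have h1 := H _ _ xy; have h2 := H _ _ xy'.
  have h3 : `|f (srefl v x) - f y'| <= e by apply: H; rewrite dotv_sreflC.
  have h4 : `|f (srefl v x) - f (srefl v y')| <= e by apply: H; rewrite dotv_srefl2.
  rewrite polarE// polar_srefl//; move: h1 h2 h3 h4; rewrite !ler_distl.
  by case: (leP (f x) (f (srefl v x))); case: (leP (f y') (f (srefl v y'))); lra.
- rewrite dotv_sreflC in xy; have xy' := lt_le_trans xy (dotv_srefl_le x0 y0).
  have h1 := H _ _ xy; have h2 := H _ _ xy'.
  have h3 : `|f (srefl v x') - f y| <= e by apply: H; rewrite dotv_sreflC.
  have h4 : `|f (srefl v x') - f (srefl v y)| <= e by apply: H; rewrite dotv_srefl2.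
  rewrite polar_srefl// polarE//; move: h1 h2 h3 h4; rewrite !ler_distl.
  by case: (leP (f x') (f (srefl v x'))); case: (leP (f y) (f (srefl v y))); lra.
- have h2 := H _ _ xy; rewrite dotv_srefl2 in xy; have h1 := H _ _ xy.
  rewrite !polar_srefl//; move: h1 h2; rewrite !ler_distl.
  by case: (leP (f x') (f (srefl v x'))); case: (leP (f y') (f (srefl v y'))); lra.
Qed.

Lemma scont_polar v f : scont f -> scont (polar v f).
Proof.
by move=> /scontP H; apply/scontP => e /H[c [c1 m]]; exists c; split=> //; exact: polar_modulus.
Qed.

Lemma measurable_superlevel f (t : R) : measurable_fun setT f ->
  measurable [set x | t < f x].
Proof.
move=> mf; rewrite (_ : mkset _ = f @^-1` `]t, +oo[).
  by rewrite -[X in measurable X]setTI; exact: mf.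
by apply/seteqP; split=> x /=; rewrite in_itv/= andbT.
Qed.

(** A pair of mirror points meets both superlevel sets in the same number of
    points; integrating this number counts each set twice. *)
Lemma polar_equimeasurable v f t : measurable_fun setT f ->
  mu [set x | t < polar v f x] = mu [set x | t < f x].
Proof.
move=> mf; have mpf := measurable_polar v mf.
pose A (g : S -> R) := [set x | t < g x].
have AE g z : (z \in A g) = (t < g z) by apply/idP/idP; rewrite inE.
have key g : measurable_fun setT g ->
    (\int[mu]_x ((\1_(A g) x)%:E + (\1_(A g) (srefl v x))%:E) = mu (A g) + mu (A g))%E.
  move=> mg; have mt := measurable_superlevel t mg.
  have m1 : measurable_fun setT (fun x : S => (\1_(A g) x : R)%:E).
    by apply/measurable_EFinP; exact: measurable_indic.
  rewrite ge0_integralD//; last exact: measurableT_comp m1 (measurable_srefl v).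
  have := @integral_mact _ _ _ (fun x : S => (\1_(A g) x : R)%:E) (orthogonal_reflmx v) m1.
  rewrite -/(srefl v) => ->; last by [].
  by rewrite integral_indic// setIT.
have E : (mu (A (polar v f)) + mu (A (polar v f)) = mu (A f) + mu (A f))%E.
  rewrite -!key//; apply: eq_integral => x _; rewrite -!EFinD; congr (_%:E).
  rewrite !indicE !AE.
  have [x0|[y -> x0]] := srefl_cases v x; rewrite ?sreflK polar_srefl// polarE// lt_max lt_min;
    by case: (t < f _); case: (t < f _); rewrite /= ?addr0 ?add0r.
have fin B : measurable B -> mu B \is a fin_num by move=> mB; exact: fin_num_measure.
move: E; rewrite -(fineK (fin _ (measurable_superlevel t mf))).
rewrite -(fineK (fin _ (measurable_superlevel t mpf))) -!EFinD => -[E].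
by congr (_%:E); lra.
Qed.

End polarization.

(** * Energy of a polarized function *)

Section rearrangement_inequality.
Context {R : realType}.
Implicit Types a b : R.

Lemma rearrangement_le a a' b b' :
  a * b + a' * b' <= Num.max a a' * Num.max b b' + Num.min a a' * Num.min b b'.
Proof. by case: (leP a a') => h1; case: (leP b b') => h2; nra. Qed.

Lemma rearrangement_lt a a' b b' : (a - a') * (b - b') < 0 ->
  a * b + a' * b' < Num.max a a' * Num.max b b' + Num.min a a' * Num.min b b'.
Proof. by case: (leP a a') => h1; case: (leP b b') => h2; nra. Qed.

End rearrangement_inequality.

Section energy.
Context {R : realType} {n : nat}.
Local Notation S := (sphere R n).
Local Notation mu := (@surface_measure R n).
Implicit Types (x y : S) (f : S -> R) (v : 'rV[R]_n.+1).

Variable kap : R -> R.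
Hypothesis kap_homo : {homo kap : s t / s <= t}.
Hypothesis kap_ge0 : forall s, 0 <= kap s.

Definition interaction f (z : S * S) : R := f z.1 * f z.2 * kap (dotv z.1 z.2).

Definition energy f : \bar R := (\int[mu \x mu]_z (interaction f z)%:E)%E.

Lemma measurable_interaction f : measurable_fun setT f ->
  measurable_fun setT (interaction f).
Proof.
move=> mf; apply: measurable_funM.
  by apply: measurable_funM; [exact: measurableT_comp mf measurable_fst|
    exact: measurableT_comp mf measurable_snd].
apply: (@measurableT_comp _ _ _ _ _ _ kap) => //; first exact: nondecreasing_measurable.
apply: measurable_dotv => i.
  exact: measurableT_comp (measurable_coord i) measurable_fst.
exact: measurableT_comp (measurable_coord i) measurable_snd.
Qed.

Lemma interaction_ge0 f z : (forall x, 0 <= f x) -> 0 <= interaction f z.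
Proof. by move=> f0; rewrite /interaction !mulr_ge0. Qed.

(** The sum of the interactions over the orbit of [(x, y)] under the reflection
    acting separately on the two variables. *)
Definition orbit_interaction v f (z : S * S) : R :=
  interaction f z + interaction f (srefl v z.1, srefl v z.2) +
  (interaction f (srefl v z.1, z.2) + interaction f (z.1, srefl v z.2)).

Lemma srefl0 x : srefl 0 x = x. Proof. by rewrite srefl_id// dotv0. Qed.

Lemma measurable_srefl_pair v w :
  measurable_fun setT (fun z : S * S => (srefl v z.1, srefl w z.2)).
Proof.
by apply/measurable_fun_pairP; split; [exact: measurableT_comp (measurable_srefl v) measurable_fst|
  exact: measurableT_comp (measurable_srefl w) measurable_snd].
Qed.

Lemma measurable_orbit_interaction v f : measurable_fun setT f ->
  measurable_fun setT (orbit_interaction v f).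
Proof.
move=> /measurable_interaction mi.
have ms a b : measurable_fun setT (fun z : S * S => interaction f (srefl a z.1, srefl b z.2)).
  exact: measurableT_comp mi (measurable_srefl_pair a b).
have s0 : srefl 0 = id :> (S -> S) by apply/funext => x; exact: srefl0.
have m1 := ms v 0; have m2 := ms 0 v; rewrite s0 in m1 m2.
by apply: measurable_funD; [apply: measurable_funD|apply: measurable_funD] => //; exact: ms.
Qed.

Lemma integral_orbit_interaction v f : measurable_fun setT f -> (forall x, 0 <= f x) ->
  (\int[mu \x mu]_z (orbit_interaction v f z)%:E =
   energy f + energy f + (energy f + energy f))%E.
Proof.
move=> mf f0; have mi := measurable_interaction mf.
have i0 z : (0 <= (interaction f z)%:E)%E by rewrite lee_fin interaction_ge0.
have ms a b : measurable_fun setT (fun z : S * S => (interaction f (srefl a z.1, srefl b z.2))%:E).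
  by apply/measurable_EFinP; exact: measurableT_comp mi (measurable_srefl_pair a b).
have E a b : (\int[mu \x mu]_z (interaction f (srefl a z.1, srefl b z.2))%:E = energy f)%E.
  exact: (integral2_mact (orthogonal_reflmx a) (orthogonal_reflmx b)
    ((measurable_EFinP _ _).2 mi) i0).
have s0 : srefl 0 = id :> (S -> S) by apply/funext => x; exact: srefl0.
have m1 := ms v 0; have m2 := ms 0 v; have m3 := ms 0 0; have m4 := ms v v.
have E1 := E v 0; have E2 := E 0 v; have E3 := E 0 0.
rewrite s0 /= in m1 m2 m3 E1 E2 E3.
under eq_integral do rewrite !EFinD.
have m5 : measurable_fun setT (fun z : S * S => (interaction f z)%:E).
  exact/measurable_EFinP.
rewrite ge0_integralD//; first last.
- exact: emeasurable_funD.
- by move=> z _; rewrite adde_ge0.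
- exact: emeasurable_funD.
- by move=> z _; rewrite adde_ge0.
rewrite (ge0_integralD _ measurableT (fun z _ => i0 z) m5 (fun z _ => i0 _) m4).
rewrite (ge0_integralD _ measurableT (fun z _ => i0 _) m1 (fun z _ => i0 _) m2).
by rewrite E1 E2 E.
Qed.

Lemma orbit_interaction_srefl1 v f x y :
  orbit_interaction v f (srefl v x, y) = orbit_interaction v f (x, y).
Proof. by rewrite /orbit_interaction /= !sreflK; ring. Qed.

Lemma orbit_interaction_srefl2 v f x y :
  orbit_interaction v f (x, srefl v y) = orbit_interaction v f (x, y).
Proof. by rewrite /orbit_interaction /= !sreflK; ring. Qed.

(** On a pair of points in the half-space, polarization replaces the values of
    [f] on each pair of mirror points by their maximum and minimum. It moves
    weight from the pairs at the distance of [(x, srefl v y)] to the pairs at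
    the smaller distance of [(x, y)]. *)
Lemma orbit_interaction_polar v f x y : 0 <= dotv x v -> 0 <= dotv y v ->
  let gain := Num.max (f x) (f (srefl v x)) * Num.max (f y) (f (srefl v y)) +
    Num.min (f x) (f (srefl v x)) * Num.min (f y) (f (srefl v y)) -
    (f x * f y + f (srefl v x) * f (srefl v y)) in
  orbit_interaction v (polar v f) (x, y) - orbit_interaction v f (x, y) =
  gain * (kap (dotv x y) - kap (dotv x (srefl v y))).
Proof.
move=> x0 y0; rewrite /orbit_interaction /interaction /=.
rewrite !polar_srefl// !polarE// dotv_srefl2 dotv_sreflC.
move: (kap _) (kap _) => k k'.
by case: (leP (f x)); case: (leP (f y)) => _ _ /=; ring.
Qed.

Lemma orbit_interaction_le v f z :
  orbit_interaction v f z <= orbit_interaction v (polar v f) z.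
Proof.
case: z => x y.
have [x0|[x' -> x0]] := srefl_cases v x; have [y0|[y' -> y0]] := srefl_cases v y;
  rewrite ?orbit_interaction_srefl1 ?orbit_interaction_srefl2 -subr_ge0
    orbit_interaction_polar//; apply: mulr_ge0;
  by rewrite ?subr_ge0 ?kap_homo ?dotv_srefl_le// rearrangement_le.
Qed.

Lemma orbit_interaction_lt v f x y : 0 <= dotv x v -> 0 <= dotv y v ->
  kap (dotv x (srefl v y)) < kap (dotv x y) ->
  (f x - f (srefl v x)) * (f y - f (srefl v y)) < 0 ->
  orbit_interaction v f (x, y) < orbit_interaction v (polar v f) (x, y).
Proof.
move=> x0 y0 k0 D0; rewrite -subr_gt0 orbit_interaction_polar//.
by apply: mulr_gt0; rewrite subr_gt0// rearrangement_lt.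
Qed.

Lemma energy_fin f M : measurable_fun setT f -> (forall x, 0 <= f x) ->
  (forall x, f x <= M) -> energy f \is a fin_num.
Proof.
move=> mf f0 fM; rewrite ge0_fin_numE; last first.
  by apply: integral_ge0 => z _; rewrite lee_fin interaction_ge0.
have M0 : 0 <= M := le_trans (f0 north) (fM north).
apply: (@le_lt_trans _ _ (\int[mu \x mu]_z (M * M * kap 1)%:E)%E).
  apply: ge0_le_integral => //.
  - by move=> z _; rewrite lee_fin interaction_ge0.
  - by apply/measurable_EFinP; exact: measurable_interaction.
  - move=> z _; rewrite lee_fin /interaction.
    by rewrite !ler_pM ?mulr_ge0 ?f0 ?fM ?kap_ge0 ?kap_homo ?dotv_sphere_le1.
rewrite integral_cst// lte_mul_pinfty ?lee_fin ?mulr_ge0//.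
have E : (mu \x mu)%E (setT `*` setT) = (mu setT * mu setT)%E.
  by rewrite product_measure1E.
rewrite setXTT in E; apply: (eq_ind_r (fun t => (t < +oo)%E) _ E).
have F : mu setT \is a fin_num by exact: fin_num_measure.
by rewrite -(fineK F) -EFinM ltry.
Qed.

Lemma energy_polar_le v f M : measurable_fun setT f -> (forall x, 0 <= f x) ->
  (forall x, f x <= M) -> (energy f <= energy (polar v f))%E.
Proof.
move=> mf f0 fM; have mp := measurable_polar v mf; have p0 := polar_ge0 v f0.
have fin1 := energy_fin mf f0 fM; have fin2 := energy_fin mp p0 (polar_le v fM).
have : (\int[mu \x mu]_z (orbit_interaction v f z)%:E <=
        \int[mu \x mu]_z (orbit_interaction v (polar v f) z)%:E)%E.
  apply: ge0_le_integral => //.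
  - by move=> z _; rewrite lee_fin /orbit_interaction !addr_ge0 ?interaction_ge0.
  - by apply/measurable_EFinP; exact: measurable_orbit_interaction.
  - by apply/measurable_EFinP; exact: measurable_orbit_interaction.
  - by move=> z _; rewrite lee_fin orbit_interaction_le.
rewrite !integral_orbit_interaction// -(fineK fin1) -(fineK fin2) -!EFinD !lee_fin.
lra.
Qed.

(** A pair [(x, y)] with [D_v x * D_v y < 0] would have a neighbourhood of pairs
    with a strict gain, of positive measure. If [x . srefl v y] is smaller than [c],
    the kernel at [c] separates its values. *)
Lemma energy_polar_eq v f M (c : R) : scont f -> (forall x, 0 <= f x) ->
  (forall x, f x <= M) -> -1 <= c ->
  (forall s t, c <= s -> s < t -> t <= 1 -> kap s < kap t) ->
  (energy (polar v f) <= energy f)%E ->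
  forall x y, 0 < dotv x v -> 0 < dotv y v -> c < dotv x y ->
  0 <= (f x - f (srefl v x)) * (f y - f (srefl v y)).
Proof.
move=> cf f0 fM c1 kap_strict Ele x y x0 y0 xy.
rewrite leNgt; apply/negP => D0.
have mf := scont_measurable cf.
have mp := measurable_polar v mf; have p0 := polar_ge0 v f0.
have fin1 := energy_fin mf f0 fM; have fin2 := energy_fin mp p0 (polar_le v fM).
have E : energy (polar v f) = energy f.
  by apply/eqP; rewrite eq_le Ele (energy_polar_le v mf f0 fM).
pose d z := orbit_interaction v (polar v f) z - orbit_interaction v f z.
have mo := measurable_orbit_interaction v mf.
have md : measurable_fun setT d.
  by apply: measurable_funB => //; exact: measurable_orbit_interaction.
have d0 z : 0 <= d z by rewrite subr_ge0 orbit_interaction_le.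
have Id : (\int[mu \x mu]_z (d z)%:E = 0)%E.
  have : (\int[mu \x mu]_z (orbit_interaction v f z)%:E + \int[mu \x mu]_z (d z)%:E =
      \int[mu \x mu]_z (orbit_interaction v f z)%:E)%E.
    rewrite -ge0_integralD//; last first.
    - exact/measurable_EFinP.
    - by move=> z _; rewrite lee_fin.
    - exact/measurable_EFinP.
    - by move=> z _; rewrite lee_fin /orbit_interaction !addr_ge0 ?interaction_ge0.
    transitivity (\int[mu \x mu]_z (orbit_interaction v (polar v f) z)%:E)%E;
      last by rewrite !integral_orbit_interaction// E.
    by apply: eq_integral => z _; rewrite -EFinD /d addrC subrK.
  rewrite integral_orbit_interaction// -(fineK fin1) -!EFinD.
  by case: (integral _ _ _) => [r||]//; rewrite -EFinD => -[Er]; congr (_%:E); lra.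
have /(@ae_mu2_cap _ _ (fun z => setT z -> (d z)%:E = 0%E)) H :
    ae_eq (mu \x mu)%E setT (EFin \o d) (cst 0%E).
  apply/(ae_eq_integral_abs _ measurableT); first exact/measurable_EFinP.
  by rewrite -[RHS]Id; apply: eq_integral => z _ /=; rewrite ger0_norm.
pose D x := f x - f (srefl v x).
have cD : scont D by apply: scontB => //; exact: scont_srefl.
have nearD u : D u != 0 -> exists c, c < 1 /\ forall w : S, c < dotv u w -> 0 < D w * D u.
  move=> Du; apply: (scont_near_gt (f := fun w : S => D w * D u)).
    by apply: scontM => // w e e0; exists 0; split=> // ? _; rewrite subrr normr0.
  by rewrite -expr2 exprn_even_gt0.
have D0' : D x * D y < 0 by [].
have /nearD[c2 [c21 c2P]] : D x != 0 by apply: contraTneq D0' => ->; rewrite mul0r ltxx.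
have /nearD[c3 [c31 c3P]] : D y != 0 by apply: contraTneq D0' => ->; rewrite mulr0 ltxx.
have [c4 [c41 c4P]] := scont_near_gt (scont_dotv v) x0.
have [c5 [c51 c5P]] := scont_near_gt (scont_dotv v) y0.
have [|c6 [c61 c6P]] := @dotv_near R n ((dotv x y - c) / 3).
  by rewrite divr_gt0// subr_gt0.
have := H x y (Num.max c2 (Num.max c3 (Num.max c4 (Num.max c5 c6)))).
rewrite !gt_max c21 c31 c41 c51 c61 => /(_ erefl)[[z1 z2] []] /=.
rewrite !gt_max => /and5P[/c2P D1 _ /c4P z1v _ xz1] /and5P[_ /c3P D2 _ /c5P z2v yz2].
move=> /(_ I) [] /eqP; rewrite subr_eq0 gt_eqF//; apply: orbit_interaction_lt.
- exact: ltW.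
- exact: ltW.
- have z12 : c < dotv z1 z2.
    have := c6P _ _ xz1 z2; have := c6P _ _ yz2 x.
    by rewrite !enorm_sphere !mulr1 !ler_distl (dotvC y x) (dotvC z2 x); lra.
  have slt := dotv_srefl_lt z1v z2v.
  have [cs|cs] := leP c (dotv z1 (srefl v z2)).
    by apply: kap_strict => //; exact: dotv_sphere_le1.
  apply: (@le_lt_trans _ _ (kap c)); first by rewrite kap_homo// ltW.
  by apply: kap_strict => //; exact: dotv_sphere_le1.
- rewrite -/(D z1) -/(D z2).
  have : 0 < (D z1 * D z2) * (D x * D y) by rewrite mulrACA mulr_gt0.
  by rewrite nmulr_lgt0.
Qed.

End energy.

(** * Symmetry about the centre of mass *)

Section axis_of_symmetry.
Context {R : realType} {n : nat}.
Local Notation S := (sphere R n).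
Local Notation mu := (@surface_measure R n).
Implicit Types (x y : S) (f g : S -> R) (v : 'rV[R]_n.+1).

Lemma scont_integrable g : scont g -> mu.-integrable setT (EFin \o g).
Proof.
move=> cg; have [M gM] := scont_bounded cg.
apply: measurable_bounded_integrable => //; last 2 first.
- exact: scont_measurable.
- exists M; split; first exact: num_real.
  by move=> K MK x _ /=; rewrite (le_trans (gM x))// ltW.
by rewrite -ge0_fin_numE//; exact: fin_num_measure.
Qed.

Lemma Rintegral_srefl v g : scont g ->
  \int[mu]_x g (srefl v x) = \int[mu]_x g x.
Proof.
move=> cg; rewrite /Rintegral; congr fine.
have /measurable_EFinP mg := scont_measurable cg.
have E h : measurable_fun setT h -> (forall x, 0 <= h x)%E ->
    (\int[mu]_x h (srefl v x) = \int[mu]_x h x)%E.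
  exact: integral_mact (orthogonal_reflmx v).
rewrite [LHS]integralE [RHS]integralE; congr (_ - _)%E.
  rewrite -[RHS](E _ (measurable_funepos mg) (funepos_ge0 _)).
  by apply: eq_integral => x _; rewrite !funeposE.
rewrite -[RHS](E _ (measurable_funeneg mg) (funeneg_ge0 _)).
by apply: eq_integral => x _; rewrite !funenegE.
Qed.

Lemma scont_cst (a : R) : scont (fun _ : S => a).
Proof. by move=> x e e0; exists 0; split=> // y _; rewrite subrr normr0. Qed.

Lemma scontD f g : scont f -> scont g -> scont (fun x => f x + g x).
Proof.
move=> cf cg; rewrite (_ : (fun _ => _) = fun x => f x - (0 - g x)).
  by apply: scontB => //; apply: scontB => //; exact: scont_cst.
by apply/funext => x; rewrite sub0r opprK.
Qed.

Lemma scont_sum I (s : seq I) (h : I -> S -> R) : (forall i, scont (h i)) ->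
  scont (fun x => \sum_(i <- s) h i x).
Proof.
move=> ch; elim: s => [|i s IH].
  by under eq_fun do rewrite big_nil; exact: scont_cst.
by under eq_fun do rewrite big_cons; exact: scontD.
Qed.

Lemma Rintegral_sum I (s : seq I) (h : I -> S -> R) : (forall i, scont (h i)) ->
  \int[mu]_x (\sum_(i <- s) h i x) = \sum_(i <- s) \int[mu]_x h i x.
Proof.
move=> ch; elim: s => [|i s IH].
  by rewrite big_nil; under eq_Rintegral do rewrite big_nil; rewrite Rintegral_cst// mul0r.
rewrite big_cons -IH -RintegralD//; last 2 first.
- exact: scont_integrable.
- by apply: scont_integrable; exact: scont_sum.
by apply: eq_Rintegral => x _; rewrite big_cons.
Qed.

Lemma scont_Rintegral0 f : scont f -> (forall x, 0 <= f x) ->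
  \int[mu]_x f x <= 0 -> forall x, f x = 0.
Proof.
move=> cf f0 I0; apply: scont_integral0 => //.
have fin : (\int[mu]_x (f x)%:E)%E \is a fin_num.
  exact: integrable_fin_num (scont_integrable cf).
have : (0 <= \int[mu]_x (f x)%:E)%E by apply: integral_ge0 => x _; rewrite lee_fin.
rewrite -(fineK fin) lee_fin => I1; congr (_%:E).
by apply/eqP; rewrite eq_le I1 andbT.
Qed.

Definition centre_of_mass f : 'rV[R]_n.+1 := \row_i \int[mu]_x (spval x ord0 i * f x).

Lemma dotv_centre_of_mass f v : scont f ->
  dotv (centre_of_mass f) v = \int[mu]_x (dotv x v * f x).
Proof.
move=> cf; have cc i : scont (fun x => spval x ord0 i * f x).
  apply: scontM => //; under eq_fun do rewrite -(dotv_delta (spval _)).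
  exact: scont_dotv.
transitivity (\int[mu]_x (\sum_i v ord0 i * (spval x ord0 i * f x))).
  rewrite Rintegral_sum => [|i]; last by apply: scontM => //; exact: scont_cst.
  apply: eq_bigr => i _; rewrite mxE mulrC RintegralZl//; exact: scont_integrable.
apply: eq_Rintegral => x _; rewrite /dotv mulr_suml.
by apply: eq_bigr => i _; rewrite mulrCA mulrA.
Qed.

(** Each reflection compares [f] with its mirror image in one direction only.
    The direction is read off the centre of mass: [2 v . m] is the integral of
    [x . v] against [f x - f (srefl v x)], which has the sign of the comparison,
    and vanishes only if [f] is symmetric. *)
Lemma symmetric_about_centre_of_mass f : scont f ->
  (forall v, (forall x, 0 <= dotv x v -> f (srefl v x) <= f x) \/
             (forall x, 0 <= dotv x v -> f x <= f (srefl v x))) ->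
  forall x y, dotv y (centre_of_mass f) <= dotv x (centre_of_mass f) -> f y <= f x.
Proof.
move=> cf H x y yx.
pose v := spval x - spval y.
have vm : 0 <= dotv (centre_of_mass f) v.
  by rewrite dotvC /v dotvDl dotvNl subr_ge0.
have xv : 0 <= dotv x v.
  by rewrite /v dotvDr dotvNr dotv_sphere subr_ge0 dotv_sphere_le1.
suff : f (srefl v x) <= f x by rewrite srefl_swap.
have [|{}H] := H v; first exact.
pose D (z : S) := f (srefl v z) - f z.
have cfv := scont_srefl v cf; have cd := scont_dotv v.
have ch : scont (fun z => dotv z v * f z) by apply: scontM => //; exact: scont_dotv.
have chv : scont (fun z => dotv z v * f (srefl v z)).
  by apply: scontM => //; exact: scont_dotv.
have D0 (z : S) : 0 <= dotv z v * D z.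
  have [z0|[w -> w0]] := srefl_cases v z.
    by rewrite mulr_ge0// subr_ge0 H.
  by rewrite dotv_srefl_dir /D sreflK mulNr -mulrN opprB mulr_ge0// subr_ge0 H.
have cD : scont (fun z => dotv z v * D z).
  by apply: scontM; [exact: scont_dotv|exact: scontB].
have I0 : \int[mu]_z (dotv z v * D z) <= 0.
  have -> : \int[mu]_z (dotv z v * D z) =
      \int[mu]_z (dotv z v * f (srefl v z)) - \int[mu]_z (dotv z v * f z).
    rewrite -RintegralB//; [|exact: scont_integrable|exact: scont_integrable].
    by apply: eq_Rintegral => z _; rewrite mulrBr.
  rewrite -(Rintegral_srefl v chv).
  under eq_Rintegral do rewrite sreflK dotv_srefl_dir -[- _]mulN1r -mulrA.
  rewrite RintegralZl//; last exact: scont_integrable.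
  rewrite -dotv_centre_of_mass//; lra.
have /eqP := scont_Rintegral0 cD D0 I0 x.
rewrite mulf_eq0 => /orP[/eqP /srefl_id -> //|].
by rewrite subr_eq0 => /eqP ->.
Qed.

End axis_of_symmetry.

(** * Rearrangement of a function with an axis of symmetry *)

Section rearrangement_of_axial_function.
Context {R : realType} {n : nat}.
Local Notation S := (sphere R n).
Local Notation mu := (@surface_measure R n).
Implicit Types (x y : S) (f g : S -> R) (v : 'rV[R]_n.+1).

Lemma le_acos (s t : R) : -1 <= s -> t <= 1 -> s <= t -> acos t <= acos s.
Proof.
move=> s1 t1 st; rewrite leNgt; apply/negP => ast.
have hs : -1 <= s <= 1 by rewrite s1 (le_trans st).
have ht : -1 <= t <= 1 by rewrite t1 (le_trans s1).
have its : acos s \in `[0, pi] by rewrite in_itv/= acos_ge0// acos_lepi.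
have itt : acos t \in `[0, pi] by rewrite in_itv/= acos_ge0// acos_lepi.
by move: ast; rewrite -(ltr_cos its itt) !acosK ?in_itv//= ltNge st.
Qed.

Lemma gdist_le x y (p : S) : dotv y p <= dotv x p -> gdist x p <= gdist y p.
Proof. by move=> h; apply: le_acos => //; [exact: dotv_sphere_geN1|exact: dotv_sphere_le1]. Qed.

(** A reflection exchanges [p] and north; if necessary, the sign of one coordinate
    orthogonal to north is changed, which makes the determinant 1. *)
Lemma exists_rotation_to_north (p : S) : (1 <= n)%N ->
  exists A : 'M[R]_n.+1, [/\ orthomx A, \det A = 1 &
    forall x, dotv (mact A x) (@north R n) = dotv x p].
Proof.
case: n p => // k p _; set N := @north R k.+1.
pose B := reflmx (spval p - spval N); have hB : orthomx B := orthogonal_reflmx _.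
have pB : spval p *m B = N by rewrite -val_srefl srefl_swap.
have BN (x : sphere R k.+1) : dotv (spval x *m B) N = dotv x p by rewrite -pB dotv_orthogonal.
have [dB|dB] := det_orthogonal hB.
  by exists B; split=> // x; rewrite val_mact.
pose d : 'rV[R]_k.+2 := \row_i (if i == lift ord0 ord0 then -1 else 1).
pose F := diag_mx d.
have hF : orthomx F.
  rewrite /orthomx tr_diag_mx mulmx_diag; apply/matrixP => i j; rewrite !mxE.
  by case: eqP => _; rewrite ?mulNr ?mul1r ?opprK.
exists (B *m F); split; first exact: orthogonal_mul.
  rewrite det_mulmx dB det_diag (bigD1 (lift ord0 ord0))//= big1 ?mulr1 ?mxE ?eqxx ?mulrNN ?mulr1//.
  by move=> i /negbTE ni; rewrite mxE ni.
move=> x; rewrite val_mact; last exact: orthogonal_mul.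
rewrite mulmxA -BN dotvC [RHS]dotvC.
have NF : spval N *m F = spval N.
  rewrite /F mul_mx_diag; apply/rowP => j; rewrite !mxE.
  by case: (j =P lift ord0 ord0) => [->|_]; rewrite ?mulr1//= mul0r.
by rewrite -{1}NF dotv_orthogonal.
Qed.

Lemma nested_measure_eq (A B : set S) : measurable A -> measurable B ->
  mu A = mu B -> A `<=` B \/ B `<=` A -> mu.-negligible ((A `\` B) `|` (B `\` A)).
Proof.
wlog AB : A B / A `<=` B => [W mA mB AB [h|h]|].
- by apply: W => //; left.
- by rewrite setUC; apply: W => //; left.
move=> mA mB E _; rewrite (_ : A `\` B = set0) ?set0U; last first.
  by apply/seteqP; split=> // x [/AB].
exists (B `\` A); split=> //; first exact: measurableD.
rewrite measureD//; last by rewrite -ge0_fin_numE//; exact: fin_num_measure.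
have -> : B `&` A = A by apply/setIidPr.
by rewrite -[LHS]/(mu B - mu A)%E E subee//; exact: fin_num_measure.
Qed.

(** A nonincreasing function of the distance to [p / |p|], or a constant if [p = 0]. *)
Definition axial (p : 'rV[R]_n.+1) f := forall x y, dotv y p <= dotv x p -> f y <= f x.

(** The superlevel sets of the two functions are nested caps, so those of equal
    measure agree up to a null set; rational levels suffice to detect where the
    functions differ. *)
Lemma axial_equimeasurable_ae_eq (p : 'rV[R]_n.+1) f g :
  measurable_fun setT f -> measurable_fun setT g ->
  (forall x, 0 <= f x) -> (forall x, 0 <= g x) -> axial p f -> axial p g ->
  (forall t, 0 < t -> mu [set x | t < f x] = mu [set x | t < g x]) ->
  {ae mu, forall x, f x = g x}.
Proof.
move=> mf mg f0 g0 af ag E.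
pose N (q : rat) := if 0 < ratr q :> R then
  ([set x | ratr q < f x] `\` [set x | ratr q < g x]) `|`
  ([set x | ratr q < g x] `\` [set x | ratr q < f x]) else set0.
have N0 q : mu.-negligible (N q).
  rewrite /N; case: ifP => q0; last exact: negligible_set0.
  apply: nested_measure_eq; [exact: measurable_superlevel|exact: measurable_superlevel|exact: E|].
  have [|nfg] := pselect ([set x | ratr q < f x] `<=` [set x | ratr q < g x]); first by left.
  right => y /= gy; apply/negPn/negP; rewrite -leNgt => fy; apply: nfg => x /= fx.
  apply: (lt_le_trans gy); apply: ag; rewrite leNgt; apply/negP => /ltW /af.
  by rewrite leNgt (le_lt_trans fy fx).
pose F k := if unpickle k is Some q then N q else set0.
have : mu.-negligible (\bigcup_k F k).
  by apply: negligible_bigcup => k; rewrite /F; case: unpickle => // *; exact: negligible_set0.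
apply: negligibleS => x /= /eqP fgx.
suff [q Nq] : exists q, N q x by exists (pickle q); rewrite /F ?pickleK.
move: fgx; rewrite neq_lt => /orP[] /rat_in_itvoo[q];
  rewrite in_itv/= => /andP[q1 q2]; exists q; rewrite /N.
  rewrite (le_lt_trans (f0 x) q1); right; split; first exact: q2.
  by apply/negP; rewrite -leNgt ltW.
rewrite (le_lt_trans (g0 x) q1); left; split; first exact: q2.
by apply/negP; rewrite -leNgt ltW.
Qed.

Lemma axial_rearrangement m f fs : (1 <= n)%N -> measurable_fun setT f ->
  (forall x, 0 <= f x) -> axial m f -> symm_decr_rearrangement f fs ->
  exists A : 'M[R]_n.+1, [/\ orthomx A, \det A = 1 &
    {ae mu, forall x, f x = fs (mact A x)}].
Proof.
move=> n1 mf f0 am [mfs fs0 fsd E].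
have [p ap] : exists p : S, axial p f.
  have [m0|m0] := eqVneq m 0.
    by exists north => x y _; apply: am; rewrite m0 !dotv0.
  have em : enorm ((enorm m)^-1 *: m) == 1.
    by rewrite enormZ ger0_norm ?invr_ge0 ?enorm_ge0// mulVf// enorm_eq0.
  exists (Sphere em) => x y /=; rewrite !dotvZr => h; apply: am.
  by rewrite -(ler_pM2l (x := (enorm m)^-1))// invr_gt0 enorm_gt0.
have [A [hA dA AN]] := exists_rotation_to_north p n1.
exists A; split=> //.
have mA := measurable_mact hA.
apply: (@axial_equimeasurable_ae_eq p) => //; first exact: measurableT_comp mfs mA.
  by move=> x y xy; apply: fsd; apply: gdist_le; rewrite !AN.
move=> t t0; rewrite E// -[LHS](surface_measure_mact hA)//.
exact: measurable_superlevel.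
Qed.

Lemma ae_pair (P : S -> Prop) : {ae mu, forall x, P x} ->
  {ae (mu \x mu)%E, forall z, P z.1 /\ P z.2}.
Proof.
move=> [B [mB B0 PB]].
exists ((B `*` setT) `|` (setT `*` B)); split.
- by apply: measurableU; exact: measurableX.
- apply/eqP; rewrite eq_le measure_ge0 andbT.
  apply: (le_trans (measureU2 _ _ _)); [exact: measurableX|exact: measurableX|].
  have h1 : (mu \x mu)%E (B `*` setT) = 0%E.
    by transitivity (mu B * mu setT)%E; [exact: product_measure1E|rewrite B0 mul0e].
  have h2 : (mu \x mu)%E (setT `*` B) = 0%E.
    by transitivity (mu setT * mu B)%E; [exact: product_measure1E|rewrite B0 mule0].
  by rewrite [X in (X + _ <= _)%E]h1 [X in (_ + X <= _)%E]h2 adde0.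
- move=> z /= /not_andP[nP|nP]; [left|right]; split=> //; exact: PB.
Qed.

Variable kap : R -> R.
Hypothesis kap_homo : {homo kap : s t / s <= t}.
Hypothesis kap_ge0 : forall s, 0 <= kap s.

Lemma energy_ae_eq f g : measurable_fun setT f -> measurable_fun setT g ->
  (forall x, 0 <= f x) -> (forall x, 0 <= g x) -> {ae mu, forall x, f x = g x} ->
  energy kap f = energy kap g.
Proof.
move=> mf mg f0 g0 /ae_pair H; apply: ge0_ae_eq_integral => //.
- by apply/measurable_EFinP; exact: measurable_interaction.
- by apply/measurable_EFinP; exact: measurable_interaction.
- by move=> z _; rewrite lee_fin interaction_ge0.
- by move=> z _; rewrite lee_fin interaction_ge0.
- by apply: filterS H => z [h1 h2] _; rewrite /interaction h1 h2.
Qed.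

Lemma energy_mact A f : orthomx A -> measurable_fun setT f -> (forall x, 0 <= f x) ->
  energy kap (f \o mact A) = energy kap f.
Proof.
move=> hA mf f0; rewrite -[RHS](integral2_mact hA hA); first last.
- by move=> z; rewrite lee_fin interaction_ge0.
- by apply/measurable_EFinP; exact: measurable_interaction.
apply: eq_integral => z _; congr (_%:E).
by rewrite /interaction /= !val_mact// dotv_orthogonal.
Qed.

Lemma energy_axial m f fs : (1 <= n)%N -> measurable_fun setT f ->
  (forall x, 0 <= f x) -> axial m f -> symm_decr_rearrangement f fs ->
  energy kap f = energy kap fs.
Proof.
move=> n1 mf f0 am Hfs; have [A [hA _ H]] := axial_rearrangement n1 mf f0 am Hfs.
have [mfs fs0 _ _] := Hfs; rewrite -(energy_mact hA mfs fs0).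
exact: (energy_ae_eq mf (measurableT_comp mfs (measurable_mact hA)) f0 (fun x => fs0 _) H).
Qed.

End rearrangement_of_axial_function.

(** * Existence of an energy maximizer *)

Section maximizer.
Context {R : realType} {n : nat}.
Local Notation S := (sphere R n).
Local Notation mu := (@surface_measure R n).
Local Notation funS := {ptws S -> R}.
Implicit Types (x y : S) (v : 'rV[R]_n.+1).

Variables (f : S -> R) (M : R).
Hypothesis f_cont : scont f.
Hypothesis f_ge0 : forall x, 0 <= f x.
Hypothesis f_le : forall x, f x <= M.

(** The conditions are closed under pointwise limits and satisfied by [f] and its
    iterated polarizations. *)
Definition competitor : set funS := [set g : S -> R | [/\ forall x, 0 <= g x <= M,
  forall c e, modulus f c e -> modulus g c e &
  forall t, mu [set x | (t < g x)%R] = mu [set x | (t < f x)%R]]].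

Lemma competitor_self : competitor f.
Proof. by split=> // x; rewrite f_ge0 f_le. Qed.

Lemma competitor_scont (g : S -> R) : competitor g -> scont g.
Proof.
move=> [_ mg _]; apply/scontP => e e0.
by have [c [c1 m]] := (scontP f).1 f_cont e e0; exists c; split=> //; exact: mg.
Qed.

Lemma competitor_polar v (g : S -> R) : competitor g -> competitor (polar v g).
Proof.
move=> cg; have mg := scont_measurable (competitor_scont cg).
case: cg => [g01 gm ge]; split=> [x|c e /gm|t].
- rewrite polar_ge0 ?polar_le// => y; by case/andP: (g01 y).
- exact: polar_modulus.
- by rewrite polar_equimeasurable.
Qed.

Lemma near_eval (g : funS) x (e : R) : 0 < e -> \forall h \near g, `|g x - h x| < e.
Proof.
move=> e0; apply: (@proj_continuous S (fun=> (R : topologicalType)) x g (ball (g x) e)).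
exact: nbhsx_ballx.
Qed.

(** On functions with a common modulus of continuity, pointwise convergence is
    uniform. *)
Lemma near_uniform (g : funS) (e : R) : 0 < e ->
  (forall c e', modulus f c e' -> modulus g c e') ->
  \forall h \near g, (forall c e', modulus f c e' -> modulus h c e') ->
    forall x, `|g x - h x| <= e.
Proof.
move=> e0 mg; have e30 : 0 < e / 3 by rewrite divr_gt0.
have [c [c1 fc]] := (scontP f).1 f_cont _ e30.
have : \forall h \near g, forall x, (forall c e', modulus f c e' -> modulus h c e') ->
    `|g x - h x| <= e.
  apply: (@sphere_near R n _ (nbhs g) _ (fun (h : funS) x =>
    (forall c e', modulus f c e' -> modulus h c e') -> `|g x - h x| <= e)) => x.
  exists c; split=> //.
  have : \forall h \near g, `|g x - h x| < e / 3 by exact: near_eval.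
  apply: (@filterS _ (nbhs g) (nbhs_filter g)) => h ghx y xy mh.
  have h1 := mg _ _ fc _ _ xy; have h2 := mh _ _ fc _ _ xy.
  move: ghx h1 h2; rewrite ltr_distl !ler_distl; lra.
by apply: (@filterS _ (nbhs g) (nbhs_filter g)) => h H mh x; exact: H.
Qed.

(** Only the distribution needs the uniform closeness of [near_uniform]: it
    compares superlevel sets at levels that differ by [e], and [e] tends to 0. *)
Lemma closed_competitor : closed competitor.
Proof.
move=> g clg.
have near1 x (e : R) : 0 < e -> exists2 h : S -> R, competitor h & `|g x - h x| < e.
  by move=> e0; have [h [ch gh]] := clg _ (near_eval g x e0); exists h.
have near2 x y (e : R) : 0 < e ->
    exists2 h : S -> R, competitor h & `|g x - h x| < e /\ `|g y - h y| < e.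
  move=> e0; have := @filterI _ (nbhs g) (nbhs_filter g) _ _ (near_eval g x e0) (near_eval g y e0).
  by move=> /clg[h [ch gh]]; exists h.
have g01 x : 0 <= g x <= M.
  apply/andP; split; rewrite leNgt; apply/negP => gx.
    have [|h [/(_ x) hx _ _]] := near1 x (- g x); first by rewrite oppr_gt0.
    by move: hx; rewrite ltr_distl; lra.
  have [|h [/(_ x) hx _ _]] := near1 x (g x - M); first by rewrite subr_gt0.
  by move: hx; rewrite ltr_distl; lra.
have gm c e : modulus f c e -> modulus g c e.
  move=> fc x y xy; rewrite leNgt; apply/negP => gxy.
  have [|h [_ /(_ _ _ fc _ _ xy) hm _]] := near2 x y ((`|g x - g y| - e) / 2).
    by rewrite divr_gt0// subr_gt0.
  move=> [h1 h2].
  have : `|g x - g y| <= `|g x - h x| + `|h x - h y| + `|g y - h y|.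
    rewrite (distrC (g y)); apply: (le_trans (ler_distD (h y) _ _)).
    by rewrite lerD2r ler_distD.
  lra.
have cg : scont g.
  apply/scontP => e e0.
  by have [c [c1 m]] := (scontP f).1 f_cont e e0; exists c; split=> //; exact: gm.
split=> // t.
have mSg s := measurable_superlevel s (scont_measurable cg).
have mSf s := measurable_superlevel s (scont_measurable f_cont).
have approx (e : R) : 0 < e ->
    (mu [set x | (t + e < f x)%R] <= mu [set x | (t < g x)%R])%E /\
    (mu [set x | (t + e < g x)%R] <= mu [set x | (t < f x)%R])%E.
  move=> e0; have [h [ch gh]] := clg _ (near_uniform e0 gm).
  have {}gh := gh (let: And3 _ hm _ := ch in hm).
  have mh := measurable_superlevel _ (scont_measurable (competitor_scont ch)).
  have [_ _ hf] := ch; rewrite -!hf; split; apply: le_measure; rewrite ?inE//= => x /= tx.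
    by have := gh x; rewrite ler_distl; lra.
  by have := gh x; rewrite ler_distl; lra.
have cvg_superlevel (h : S -> R) : (forall s, measurable [set x | s < h x]) ->
    mu [set x | (t + k.+1%:R^-1 < h x)%R] @[k --> \oo] --> mu [set x | (t < h x)%R].
  move=> mh.
  have -> : [set x | t < h x] = \bigcup_k [set x | t + k.+1%:R^-1 < h x].
    apply/seteqP; split=> x /=.
      move=> tx; have /ltr_add_invr[k kP] := tx; by exists k.
    by move=> [k _ /=]; apply: lt_trans; rewrite ltrDl.
  apply: nondecreasing_cvg_mu => //; first exact: bigcup_measurable.
  move=> i j ij; apply/subsetPset => x /=; apply: le_lt_trans.
  by rewrite lerD2l lef_pV2 ?posrE// ler_nat ltnS.
apply/eqP; rewrite eq_le; apply/andP; split.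
  apply: cvge_to_le (cvg_superlevel g mSg) _; near=> k.
  by apply: (approx _ _).2; rewrite invr_gt0.
apply: cvge_to_le (cvg_superlevel f mSf) _; near=> k.
by apply: (approx _ _).1; rewrite invr_gt0.
Unshelve. all: by end_near. Qed.

Lemma compact_competitor : compact competitor.
Proof.
have H := @tychonoff S (fun=> (R : topologicalType)) (fun=> `[0, M]%classic)
  (fun=> @segment_compact R 0 M).
apply: (@subclosed_compact funS _ _ closed_competitor H).
by move=> g [g01 _ _] x /=; rewrite in_itv/=; exact: g01.
Qed.

Variable kap : R -> R.
Hypothesis kap_homo : {homo kap : s t / s <= t}.
Hypothesis kap_ge0 : forall s, 0 <= kap s.

Lemma competitor_energy_fin (g : S -> R) : competitor g -> energy kap g \is a fin_num.
Proof.
move=> cg; apply: (@energy_fin _ _ _ kap_homo kap_ge0 _ M).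
- exact/scont_measurable/competitor_scont.
- by case: cg => g01 _ _ x; case/andP: (g01 x).
- by case: cg => g01 _ _ x; case/andP: (g01 x).
Qed.

Lemma energy_near (g h : S -> R) (e : R) : competitor g -> competitor h ->
  0 <= e <= 1 -> (forall x, `|g x - h x| <= e) ->
  (energy kap h <= energy kap g +
    (e * ((2 * M + 1) * kap 1))%:E * (mu \x mu)%E setT)%E.
Proof.
move=> cg ch /andP[e0 e1] gh.
have mg := scont_measurable (competitor_scont cg).
have mh := scont_measurable (competitor_scont ch).
have g01 : forall x, 0 <= g x <= M by case: cg.
have h01 : forall x, 0 <= h x <= M by case: ch.
have M0 : 0 <= M by have /andP[] := g01 north; exact: le_trans.
have C0 : 0 <= e * ((2 * M + 1) * kap 1) by rewrite !mulr_ge0// addr_ge0// mulr_ge0.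
rewrite -integral_cst// -ge0_integralD//; first last.
- by apply/measurable_EFinP; exact: measurable_interaction.
- by move=> z _; rewrite lee_fin interaction_ge0// => x; case/andP: (g01 x).
apply: ge0_le_integral => //.
- by move=> z _; rewrite lee_fin interaction_ge0// => x; case/andP: (h01 x).
- by apply/measurable_EFinP; exact: measurable_interaction.
- apply: emeasurable_funD => //.
  by apply/measurable_EFinP; exact: measurable_interaction.
move=> z _; rewrite /= -EFinD lee_fin /interaction.
have k1 : kap (dotv z.1 z.2) <= kap 1 by rewrite kap_homo// dotv_sphere_le1.
have k0 := kap_ge0 (dotv z.1 z.2).
have /andP[a0 a1] := g01 z.1; have /andP[b0 b1] := g01 z.2.
have /andP[c0 c1] := h01 z.1; have /andP[d0 d1] := h01 z.2.
have := gh z.1; have := gh z.2; rewrite !ler_distl => /andP[p1 p2] /andP[q1 q2].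
move: (kap _) (kap 1) (g _) (g _) (h _) (h _) k1 k0 a0 a1 b0 b1 c0 c1 d0 d1 p1 p2 q1 q2.
move=> k K a b c d k1 k0 a0 a1 b0 b1 c0 c1 d0 d1 p1 p2 q1 q2.
have E1 : c * d <= a * b + e * (2 * M + 1).
  apply: (@le_trans _ _ ((a + e) * (b + e))); first by rewrite ler_pM//; lra.
  have : e * (a + b + e) <= e * (2 * M + 1) by rewrite ler_wpM2l//; lra.
  by lra.
rewrite (mulrC d) (mulrC b).
apply: (@le_trans _ _ ((a * b + e * (2 * M + 1)) * k)); first by rewrite ler_wpM2r.
rewrite mulrDl lerD2l mulrA ler_wpM2l// mulr_ge0//; lra.
Qed.

Let En (g : S -> R) := fine (energy kap g).

(** The energy is continuous on the compact set of competitors, in the form of a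
    covering argument: a bound that holds with some room at each competitor,
    eventually in the bound, eventually holds for all competitors. With the filter
    at infinity this shows that the energy is bounded, and with the filter below
    the supremum that the supremum is attained. *)
Lemma competitor_energy_near (F : set_system R) {FF : Filter F} :
  (forall g, competitor g -> exists2 e, 0 < e & \forall t \near F, En g + e <= t) ->
  \forall t \near F, forall g, competitor g -> En g <= t.
Proof.
move=> HF.
have /(_ _ F (fun t (g : funS) => En g <= t) FF) := (iffRL (near_covering_withinP _))
  ((iffLR (compact_near_coveringP _)) compact_competitor).
apply => g cg.
have [e e0 He] := HF g cg.
pose B := (2 * M + 1) * kap 1 * fine ((mu \x mu)%E setT).
have B0 : 0 <= B.
  have M0 : 0 <= M by case: cg => /(_ north)/andP[g0 gM] _ _; exact: le_trans gM.
  by rewrite !mulr_ge0// ?fine_ge0// addr_ge0// mulr_ge0.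
pose d := Num.min 1 (e / (B + 1)).
have d0 : 0 < d by rewrite lt_min ltr01 divr_gt0// ltr_wpDl.
have d1 : d <= 1 by rewrite ge_min lexx.
have dB : d * B <= e.
  apply: (@le_trans _ _ (e / (B + 1) * B)); first by rewrite ler_wpM2r// ge_min lexx orbT.
  by rewrite mulrAC ler_pdivrMr ?ltr_wpDl// ler_pM2l// lerDl.
exists ([set h : funS | (forall c e', modulus f c e' -> modulus h c e') ->
    forall x, `|g x - h x| <= d], [set t | En g + e <= t]).
  split=> //=; apply: near_uniform => //; by case: cg.
move=> [h t] /= [gh get] ch; apply: le_trans get.
have {}gh := gh (let: And3 _ hm _ := ch in hm).
have := energy_near cg ch _ gh; rewrite (ltW d0) d1 => /(_ erefl).
have fmu : (mu \x mu)%E setT \is a fin_num.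
  have E : (mu \x mu)%E (setT `*` setT) = (mu setT * mu setT)%E.
    by rewrite product_measure1E.
  rewrite setXTT in E; rewrite E fin_numM//; exact: fin_num_measure.
rewrite -(fineK (competitor_energy_fin cg)) -(fineK (competitor_energy_fin ch)) -(fineK fmu).
rewrite -EFinM -EFinD lee_fin => /le_trans; apply.
by rewrite /En lerD2l; apply: le_trans dB; rewrite /B !mulrA.
Qed.

Lemma exists_energy_maximizer : exists2 g : S -> R, competitor g &
  forall h, competitor h -> (energy kap h <= energy kap g)%E.
Proof.
pose E := [set En g | g in competitor].
have [t0 Et0] : exists t, forall g, competitor g -> En g <= t.
  have /filter_ex[t Ht] : \forall t \near +oo, forall g, competitor g -> En g <= t.
    apply: competitor_energy_near => g cg; exists 1 => //.
    exact: nbhs_pinfty_ge (num_real _).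
  by exists t.
have supE : has_sup E.
  split; first by exists (En f), f => //; exact: competitor_self.
  by exists t0 => _ [g cg <-]; exact: Et0.
apply: contrapT => nmax.
have lts g : competitor g -> En g < sup E.
  move=> cg; rewrite lt_neqAle (sup_upper_bound supE) ?andbT; last by exists g.
  apply/eqP => gE; apply: nmax; exists g => // h ch.
  rewrite -(fineK (competitor_energy_fin cg)) -(fineK (competitor_energy_fin ch)) lee_fin.
  by rewrite -!/(En _) gE; apply: (sup_upper_bound supE); exists h.
have : \forall t \near (sup E)^'-, forall g, competitor g -> En g <= t.
  apply: competitor_energy_near => g /lts gs; exists ((sup E - En g) / 2).
    by rewrite divr_gt0// subr_gt0.
  by near=> t; rewrite ltW//; near: t; apply: nbhs_left_gt; lra.
move=> H; have [t [ts Ht]] : exists t, t < sup E /\ forall g, competitor g -> En g <= t.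
  near (sup E)^'- => t; exists t; split; first by near: t; exact: nbhs_left_lt.
  by near: t.
have [_ [g cg <-]] : exists2 y, E y & t < y.
  have d0 : 0 < sup E - t by rewrite subr_gt0.
  by have [y Ey] := sup_adherent d0 supE; rewrite subKr; exists y.
by rewrite ltNge Ht.
Unshelve. all: by end_near. Qed.

End maximizer.

(** * Rearrangement does not decrease the energy *)

Section rearrangement_increases_energy.
Context {R : realType} {n : nat}.
Local Notation S := (sphere R n).
Local Notation mu := (@surface_measure R n).
Implicit Types (x y : S) (f g fs : S -> R) (v : 'rV[R]_n.+1).

Lemma one_sided_of_sign v f :
  (forall x y, 0 < dotv x v -> 0 < dotv y v ->
     0 <= (f x - f (srefl v x)) * (f y - f (srefl v y))) ->
  (forall x, 0 <= dotv x v -> f (srefl v x) <= f x) \/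
  (forall x, 0 <= dotv x v -> f x <= f (srefl v x)).
Proof.
move=> H; have [|nH] := pselect (forall x, 0 <= dotv x v -> f (srefl v x) <= f x).
  by left.
right => y y0; have [x x0 fx] : exists2 x : S, 0 <= dotv x v & f x < f (srefl v x).
  apply: contrapT => nx; apply: nH => x x0; rewrite leNgt; apply/negP => fx.
  by apply: nx; exists x.
have [y0'|y0'] := eqVneq (dotv y v) 0; first by rewrite srefl_id.
have [x0'|x0'] := eqVneq (dotv x v) 0; first by rewrite srefl_id ?ltxx in fx.
have := H x y; rewrite !lt0r x0 x0' y0 y0' => /(_ erefl erefl).
by rewrite nmulr_rge0 ?subr_lt0// subr_le0.
Qed.

Section strict_kernel.
Variable kap : R -> R.
Hypothesis kap_homo : {homo kap : s t / s <= t}.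
Hypothesis kap_ge0 : forall s, 0 <= kap s.

(** A maximizer is not improved by polarizations. For a strictly increasing
    kernel this makes it symmetric about its centre of mass. *)
Lemma exists_axial_maximizer f fs M : scont f ->
  (forall x, 0 <= f x) -> (forall x, f x <= M) -> symm_decr_rearrangement f fs ->
  (forall s t, -1 <= s -> s < t -> t <= 1 -> kap s < kap t) ->
  exists g : S -> R, [/\ scont g, forall x, 0 <= g x <= M,
    axial (centre_of_mass g) g, symm_decr_rearrangement g fs &
    (energy kap f <= energy kap g)%E].
Proof.
move=> cf f0 fM Hfs kap_strict.
have [g cg gmax] := exists_energy_maximizer cf f0 fM kap_homo kap_ge0.
have cgc := competitor_scont cf cg.
have [g01 _ gE] := cg.
have g0 x : 0 <= g x by case/andP: (g01 x).
have gM x : g x <= M by case/andP: (g01 x).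
have Hg : symm_decr_rearrangement g fs.
  by case: Hfs => mfs fs0 fsd E; split=> // t t0; rewrite gE E.
have ag : axial (centre_of_mass g) g.
  apply: symmetric_about_centre_of_mass => // v.
  apply: one_sided_of_sign => x y xv yv.
  apply: (energy_polar_eq kap_homo kap_ge0 cgc g0 gM (lexx _) kap_strict) => //.
    by apply: gmax; exact: competitor_polar.
  (* antipodal points are not on the same side of a mirror *)
  rewrite lt_neqAle dotv_sphere_geN1 andbT; apply/eqP => xy.
  have xNy : spval x + spval y = 0.
    by apply/eqP; rewrite -dotvv_eq0 !dotvE !dotv_sphere (dotvC y x) -xy; apply/eqP; ring.
  have := addr_gt0 xv yv; by rewrite -dotvDl xNy dotvC dotv0 ltxx.
by exists g; split=> //; apply: gmax; exact: competitor_self.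
Qed.

End strict_kernel.

Variable kap : R -> R.
Hypothesis kap_homo : {homo kap : s t / s <= t}.
Hypothesis kap_ge0 : forall s, 0 <= kap s.

Let lin (s : R) : R := Num.max 0 (s + 1).

Let lin_homo : {homo lin : s t / s <= t}.
Proof. by move=> s t st; rewrite /lin ge_max !le_max lexx /= lerD2r st orbT. Qed.

Let lin_ge0 s : 0 <= lin s. Proof. by rewrite le_max lexx. Qed.

Let energyD (e : R) f : 0 <= e -> measurable_fun setT f -> (forall x, 0 <= f x) ->
  energy (fun s => kap s + e * lin s) f = (energy kap f + e%:E * energy lin f)%E.
Proof.
move=> e0 mf f0.
have m1 := measurable_interaction kap_homo mf; have m2 := measurable_interaction lin_homo mf.
rewrite /energy -ge0_integralZl//; last 2 first.
- exact/measurable_EFinP.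
- by move=> z _; rewrite lee_fin interaction_ge0.
rewrite -ge0_integralD//; first last.
- by apply/measurable_EFinP; exact: measurable_funM.
- by move=> z _; rewrite lee_fin mulr_ge0// interaction_ge0.
- exact/measurable_EFinP.
- by move=> z _; rewrite lee_fin interaction_ge0.
by apply: eq_integral => z _; rewrite -EFinM -EFinD /interaction; congr (_%:E); ring.
Qed.

(** The inequality passes to limits of kernels, so that a kernel can be made
    strictly increasing by adding a small multiple of [1 + s]. A maximizer for the
    perturbed kernel is axial and has the energy of [fs]. *)
Lemma energy_le_rearrangement f fs : (1 <= n)%N -> scont f ->
  (forall x, 0 <= f x) -> symm_decr_rearrangement f fs ->
  (energy kap f <= energy kap fs)%E.
Proof.
move=> n1 cf f0 Hfs.
have mf := scont_measurable cf; have [mfs fs0 _ _] := Hfs.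
have [M fM] := scont_bounded cf.
have {}fM x : f x <= M by rewrite (le_trans (ler_norm _)).
have lin_strict s t : -1 <= s -> s < t -> t <= 1 -> lin s < lin t.
  by move=> s1 st t1; rewrite /lin !max_r ?ltrD2r//; lra.
have E (k : R -> R) g : {homo k : s t / s <= t} -> (forall s, 0 <= k s) ->
    scont g -> (forall x, 0 <= g x <= M) -> axial (centre_of_mass g) g ->
    symm_decr_rearrangement g fs -> energy k g = energy k fs /\ energy k fs \is a fin_num.
  move=> kh k0 cg g01 ag Hg; have mg := scont_measurable cg.
  have g0 x : 0 <= g x by case/andP: (g01 x).
  have gM x : g x <= M by case/andP: (g01 x).
  have Ek := energy_axial kh k0 n1 mg g0 ag Hg.
  by split=> //; rewrite -Ek; exact: (energy_fin kh k0 mg g0 gM).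
have [g1 [cg1 g101 ag1 Hg1 _]] := exists_axial_maximizer lin_homo lin_ge0 cf f0 fM Hfs lin_strict.
have fk := (E _ _ kap_homo kap_ge0 cg1 g101 ag1 Hg1).2.
have fl := (E _ _ lin_homo lin_ge0 cg1 g101 ag1 Hg1).2.
have fkf := energy_fin kap_homo kap_ge0 mf f0 fM.
have flf := energy_fin lin_homo lin_ge0 mf f0 fM.
have step e : 0 < e -> fine (energy kap f) <= fine (energy kap fs) + e * fine (energy lin fs).
  move=> e0; pose k s := kap s + e * lin s.
  have kh : {homo k : s t / s <= t}.
    by move=> s t st; rewrite lerD ?kap_homo// ler_wpM2l ?lin_homo// ltW.
  have k0 s : 0 <= k s by rewrite addr_ge0// mulr_ge0// ltW.
  have ks s t : -1 <= s -> s < t -> t <= 1 -> k s < k t.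
    move=> s1 st t1; rewrite ler_ltD ?kap_homo ?(ltW st)// ltr_pM2l//.
    exact: lin_strict.
  have [g [cg g01 ag Hg]] := exists_axial_maximizer kh k0 cf f0 fM Hfs ks.
  rewrite (E _ _ kh k0 cg g01 ag Hg).1.
  rewrite !energyD ?(ltW e0)// -(fineK fk) -(fineK fl) -(fineK fkf) -(fineK flf).
  rewrite -!EFinM -!EFinD lee_fin; apply: le_trans.
  by rewrite lerDl mulr_ge0 ?(ltW e0)// fine_ge0// integral_ge0// => z _; rewrite lee_fin interaction_ge0.
rewrite -(fineK fkf) -(fineK fk) lee_fin leNgt; apply/negP => lt.
have L0 : 0 <= fine (energy lin fs).
  by rewrite fine_ge0// integral_ge0// => z _; rewrite lee_fin interaction_ge0.
set a := fine (energy kap f) in step lt; set b := fine (energy kap fs) in step lt.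
set L := fine (energy lin fs) in step L0.
(* The perturbation then contributes less than half of the difference [a - b]. *)
have := step ((a - b) / (2 * (L + 1))).
rewrite divr_gt0 ?subr_gt0 ?mulr_gt0 ?ltr_wpDl// => /(_ erefl).
apply/negP; rewrite -ltNge -ltrBrDl.
by rewrite mulrAC ltr_pdivrMr ?mulr_gt0 ?ltr_wpDl// ltr_pM2l ?subr_gt0//; lra.
Qed.

End rearrangement_increases_energy.

(** * Unique continuation from rational approximations *)

Section polynomial_extrapolation.
Context {R : realType}.
Implicit Types (p Q W : {poly R}) (t s : R).

Definition diffp (h : R) p := p \Po ('X + h%:P) - p.

Lemma horner_diffp h p t : (diffp h p).[t] = p.[t + h] - p.[t].
Proof. by rewrite /diffp !hornerE horner_comp !hornerE. Qed.

Lemma size_expXaddC_sub (h : R) i : (size (('X + h%:P) ^+ i - 'X^i)%R <= i)%N.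
Proof.
elim: i => [|i IH]; first by rewrite subrr size_poly0.
rewrite (_ : _ - _ = ('X + h%:P) * (('X + h%:P) ^+ i - 'X^i) + h%:P * 'X^i); last first.
  by rewrite !exprS; ring.
rewrite (leq_trans (size_polyD _ _))// geq_max; apply/andP; split.
  by rewrite (leq_trans (size_polyMleq _ _))// size_XaddC /= ltnS.
rewrite (leq_trans (size_polyMleq _ _))// size_polyXn addnS /=.
by rewrite -[X in (_ <= X)%N]add1n leq_add2r size_polyC leq_b1.
Qed.

Lemma size_diffp h p : (size (diffp h p) <= (size p).-1)%N.
Proof.
rewrite /diffp comp_polyE -[X in _ - X]coefK poly_def -sumrB.
rewrite (leq_trans (size_sum _ _ _))//; apply/bigmax_leqP => i _.
rewrite -scalerBr (leq_trans (size_scale_leq _ _))//.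
by rewrite (leq_trans (size_expXaddC_sub _ _))// -ltnS (leq_trans (ltn_ord i))// leqSpred.
Qed.

(** Values at equidistant nodes beyond the first ones are obtained from
    [Q (x + h) = Q x + diffp h Q x], where the second term has a smaller degree:
    each step multiplies the bound by at most 3. *)
Lemma poly_extrapolation m d Q (x h B : R) : (size Q <= d)%N -> 0 <= B ->
  (forall i, (i < d)%N -> `|Q.[x + i%:R * h]| <= B) ->
  `|Q.[x + m%:R * h]| <= 3 ^+ m * B.
Proof.
elim: m d Q B => [|m IH] [|d] Q B.
- by rewrite leqn0 size_poly_eq0 => /eqP -> B0 _; rewrite horner0 normr0 expr0 mul1r.
- by move=> _ B0 /(_ 0%N (ltn0Sn d)); rewrite expr0 mul1r.
- by rewrite leqn0 size_poly_eq0 => /eqP -> B0 _; rewrite horner0 normr0 mulr_ge0 ?exprn_ge0.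
move=> sQ B0 HB.
have E k : Q.[x + k.+1%:R * h] = Q.[x + k%:R * h] + (diffp h Q).[x + k%:R * h].
  by rewrite horner_diffp [RHS]addrC subrK -addrA -natr1 mulrDl mul1r.
rewrite E (le_trans (ler_normD _ _))// exprS (_ : 3 * _ * B = 3 ^+ m * B + 3 ^+ m * (2 * B)); last by ring.
apply: lerD; first exact: (IH d.+1).
apply: (IH d); last 2 first.
- by rewrite mulr_ge0.
- move=> i id; rewrite horner_diffp (_ : x + _ + h = x + i.+1%:R * h); last by rewrite -natr1; ring.
  by rewrite (le_trans (ler_normB _ _))// (_ : 2 * B = B + B); [rewrite lerD ?HB// ltnW|ring].
by rewrite (leq_trans (size_diffp _ _))//; case: (size Q) sQ.
Qed.

(** [D + 1] nodes with spacing [h] fit in the interval to the left of [t0], starting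
    at [t0 - s], and [t] is the node number [2 * (D + 1)]. *)
Lemma poly_growth D Q (t0 s t B : R) : (size Q <= D.+1)%N -> 0 <= B -> 0 < s ->
  (forall u, t0 - s <= u < t0 -> `|Q.[u]| <= B) ->
  t0 <= t < t0 + s -> `|Q.[t]| <= 9 ^+ D.+1 * B.
Proof.
move=> sQ B0 s0 HB /andP[t1 t2].
pose h := (t - t0 + s) / (2 * D.+1%:R).
have D0 : 0 < D.+1%:R :> R by [].
have h0 : 0 < h by rewrite divr_gt0// ?mulr_gt0//; lra.
have hE : D.+1%:R * h = (t - t0 + s) / 2 by rewrite /h; field; rewrite gt_eqF.
have := @poly_extrapolation (2 * D.+1) D.+1 Q (t0 - s) h B sQ B0.
rewrite exprM (_ : 3 ^+ 2 = 9); last by rewrite expr2; ring.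
rewrite (_ : t0 - s + _ = t); last by rewrite natrM -mulrA hE; field.
apply=> i iD; apply: HB; apply/andP; split.
  by rewrite lerDl mulr_ge0// ltW.
have : i%:R * h <= D.+1%:R * h by rewrite ler_wpM2r ?(ltW h0)// ler_nat ltnW.
by rewrite hE; lra.
Qed.

Lemma poly_bound p (t0 : R) : exists2 M, 0 <= M & forall t, `|t - t0| <= 1 -> `|p.[t]| <= M.
Proof.
exists (\sum_(i < size p) `|p`_i| * (`|t0| + 1) ^+ i).
  by apply: sumr_ge0 => i _; rewrite mulr_ge0// exprn_ge0// addr_ge0.
move=> t tt0; rewrite horner_coef (le_trans (ler_norm_sum _ _ _))//.
apply: ler_sum => i _; rewrite normrM normrX ler_wpM2l// lerXn2r ?nnegrE ?addr_ge0//.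
by rewrite -lerBlDl (le_trans (lerB_dist _ _)).
Qed.

Lemma poly_lipschitz p (t0 : R) : exists2 M, 0 <= M &
  forall t, `|t - t0| <= 1 -> `|p.[t] - p.[t0]| <= M * `|t - t0|.
Proof.
have : root (p - p.[t0]%:P) t0 by rewrite /root !hornerE subrr.
move=> /factor_theorem[q qE]; have [M M0 qM] := poly_bound q t0.
exists M => // t tt0.
have -> : p.[t] - p.[t0] = (p - p.[t0]%:P).[t] by rewrite !hornerE.
by rewrite qE !hornerE normrM ler_wpM2r// qM.
Qed.

Lemma poly_near_gt p (t0 a : R) : a < p.[t0] ->
  exists2 e, 0 < e & forall t, `|t - t0| <= e -> a < p.[t].
Proof.
move=> pt0; have [M M0 pM] := poly_lipschitz p t0.
have d0 : 0 < (p.[t0] - a) / (M + 1) by rewrite divr_gt0 ?subr_gt0// ltr_wpDl.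
exists (Num.min 1 ((p.[t0] - a) / (M + 1))); first by rewrite lt_min ltr01.
move=> t; rewrite le_min => /andP[h1 h2]; have := pM _ h1.
have : M * `|t - t0| < p.[t0] - a.
  apply: (@le_lt_trans _ _ (M * ((p.[t0] - a) / (M + 1)))); first by rewrite ler_wpM2l.
  by rewrite mulrCA gtr_pMr ?subr_gt0// ltr_pdivrMr ?ltr_wpDl// mul1r ltrDl.
by rewrite ler_distl => h3 /andP[h4 _]; lra.
Qed.

End polynomial_extrapolation.

Section rational_approximation.
Context {R : realType}.
Implicit Types (h : R -> R) (Q W : {poly R}) (t s : R).

(** [h] is approximated at [t0] by rational functions [Q / W ^ N] of degree
    [O(N)], with an error that is geometric in [N] with a ratio proportional to
    the distance to [t0]. Analytic functions of rational curves have this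
    property, and it suffices for unique continuation. *)
Definition rational_approx h t0 :=
  exists (d : nat) (W : {poly R}) (L r C : R), [/\ W.[t0] != 0, 0 <= L, 0 < r, 0 <= C &
    forall N, exists2 Q : {poly R}, (size Q <= (d * N).+1)%N &
      forall t s, 0 <= s <= r -> `|t - t0| <= s ->
        `|h t * W.[t] ^+ N - Q.[t]| <= C * (L * s) ^+ N].

Lemma size_polyM_le (p q : {poly R}) a b : (size p <= a.+1)%N -> (size q <= b.+1)%N ->
  (size (p * q)%R <= (a + b).+1)%N.
Proof.
move=> sp sq; rewrite (leq_trans (size_polyMleq _ _))//.
by rewrite -subn1 leq_subLR add1n -addnS -addSn leq_add.
Qed.

Lemma size_polyX_le (p : {poly R}) a N : (size p <= a.+1)%N -> (size (p ^+ N) <= (a * N).+1)%N.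
Proof.
move=> sp; elim: N => [|N IH]; first by rewrite expr0 size_poly1.
by rewrite exprS mulnS size_polyM_le.
Qed.

(** The common denominator is [W1 * W2]. *)
Lemma rational_approxB h1 h2 t0 : rational_approx h1 t0 -> rational_approx h2 t0 ->
  rational_approx (fun t => h1 t - h2 t) t0.
Proof.
move=> [d1 [W1 [L1 [r1 [C1 [W10 L10 r10 C10 H1]]]]]].
move=> [d2 [W2 [L2 [r2 [C2 [W20 L20 r20 C20 H2]]]]]].
have [M1 M10 W1M] := poly_bound W1 t0; have [M2 M20 W2M] := poly_bound W2 t0.
pose L := L1 * M2 + L2 * M1; have L0 : 0 <= L by rewrite addr_ge0 ?mulr_ge0.
exists (d1 + d2 + size W1 + size W2)%N, (W1 * W2), L, (Num.min 1 (Num.min r1 r2)), (C1 + C2).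
split=> //.
- by rewrite hornerM mulf_neq0.
- by rewrite !lt_min ltr01 r10.
- exact: addr_ge0.
move=> N; have [Q1 s1 Q1P] := H1 N; have [Q2 s2 Q2P] := H2 N.
exists (Q1 * W2 ^+ N - Q2 * W1 ^+ N).
  rewrite (leq_trans (size_polyD _ _))// size_polyN geq_max.
  have sW1 : (size (W1 ^+ N) <= (size W1 * N).+1)%N by exact: size_polyX_le.
  have sW2 : (size (W2 ^+ N) <= (size W2 * N).+1)%N by exact: size_polyX_le.
  rewrite (leq_trans (size_polyM_le s1 sW2)) ?(leq_trans (size_polyM_le s2 sW1))//.
    by rewrite ltnS -mulnDl leq_mul2r; apply/orP; right; clear; move: d1 d2 (size W1) (size W2) => a b c d; lia.
  by rewrite ltnS -mulnDl leq_mul2r; apply/orP; right; clear; move: d1 d2 (size W1) (size W2) => a b c d; lia.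
move=> t s /andP[s0]; rewrite !le_min => /and3P[s_1 sr1 sr2] ts.
have t1 : `|t - t0| <= 1 := le_trans ts s_1.
have := Q1P t s; rewrite s0 sr1 => /(_ erefl ts) E1.
have := Q2P t s; rewrite s0 sr2 => /(_ erefl ts) E2.
rewrite !(hornerM, hornerD, hornerN, horner_exp) exprMn.
set a := W1.[t] ^+ N in E1 *; set b := W2.[t] ^+ N in E2 *.
rewrite (_ : _ - _ = (h1 t * a - Q1.[t]) * b - (h2 t * b - Q2.[t]) * a); last by ring.
rewrite (le_trans (ler_normB _ _))// !normrM mulrDl lerD//.
  apply: (@le_trans _ _ (C1 * (L1 * s) ^+ N * M2 ^+ N)).
    by rewrite ler_pM// /b normrX lerXn2r ?nnegrE ?W2M.
  rewrite -mulrA -exprMn ler_wpM2l// lerXn2r ?nnegrE ?mulr_ge0//.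
  by rewrite mulrAC ler_wpM2r// lerDl mulr_ge0.
apply: (@le_trans _ _ (C2 * (L2 * s) ^+ N * M1 ^+ N)).
  by rewrite ler_pM// /a normrX lerXn2r ?nnegrE ?W1M.
rewrite -mulrA -exprMn ler_wpM2l// lerXn2r ?nnegrE ?mulr_ge0//.
by rewrite mulrAC ler_wpM2r// lerDr mulr_ge0.
Qed.

Lemma geometric_bound0 (x C : R) : (forall N, `|x| <= C * 2^-1 ^+ N) -> x = 0.
Proof.
move=> H; apply/eqP; rewrite -normr_le0 leNgt; apply/negP => x0.
have C0 : 0 < C by have := H 0%N; rewrite expr0 mulr1; exact: lt_le_trans.
have [k kP] : exists k : nat, C / `|x| < k%:R.
  exists (Num.bound (C / `|x|)); apply: archi_boundP; rewrite divr_ge0 ?(ltW C0)//.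
have := H k; apply/negP; rewrite -ltNge exprVn ltr_pdivrMr ?exprn_gt0//.
rewrite ltr_pdivrMr// in kP; rewrite mulrC; apply: (lt_le_trans kP).
by rewrite ler_wpM2r// -natrX ler_nat ltnW// ltn_expl.
Qed.

(** On an interval of length [e] to the left of [t0] the numerator [Q] is bounded by
    [C * (L * e) ^+ N], hence on the right by the same bound up to a factor
    [9 ^+ (d * N + 1)]. For small [e] the quotient by [W ^+ N] tends to 0. *)
Lemma rational_approx_continuation h t0 eta : rational_approx h t0 -> 0 < eta ->
  (forall t, t0 - eta <= t < t0 -> h t = 0) ->
  exists2 e, 0 < e & forall t, t0 <= t < t0 + e -> h t = 0.
Proof.
move=> [d [W [L [r [C [W0 L0 r0 C0 H]]]]]] eta0 h0.
pose w := `|W.[t0]| / 2; have w0 : 0 < w by rewrite divr_gt0// normr_gt0.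
have [M M0 WM] := poly_lipschitz W t0.
pose e1 := w / (2 * (9 ^+ d * L + 1)).
have A0 : 0 < 9 ^+ d * L + 1 by rewrite ltr_wpDl// mulr_ge0.
have e10 : 0 < e1 by rewrite divr_gt0// mulr_gt0.
pose e2 := w / (M + 1); have e20 : 0 < e2 by rewrite divr_gt0// ltr_wpDl.
pose e := Num.min (Num.min 1 e2) (Num.min e1 (Num.min r eta)).
have e0 : 0 < e by rewrite !lt_min ltr01 e20 e10 r0 eta0.
exists e => // t tt.
have [e_1 e_e2 e_e1 e_r e_eta] : [/\ e <= 1, e <= e2, e <= e1, e <= r & e <= eta].
  by split; rewrite /e !ge_min lexx ?orbT.
apply: (@geometric_bound0 _ (10 * C)) => N.
have [Q sQ QP] := H N.
have {}QP u : `|u - t0| <= e -> `|h u * W.[u] ^+ N - Q.[u]| <= C * (L * e) ^+ N.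
  by apply: QP; rewrite ltW.
have B0 : 0 <= C * (L * e) ^+ N by rewrite mulr_ge0// exprn_ge0// mulr_ge0// ltW.
have Qt : `|Q.[t]| <= 9 ^+ (d * N).+1 * (C * (L * e) ^+ N).
  apply: (poly_growth sQ B0 e0 _ tt) => u /andP[u1 u2].
  have := QP u; rewrite h0; last by rewrite u2 andbT (le_trans _ u1)// lerB.
  rewrite mul0r sub0r normrN; apply; rewrite ler_norml; apply/andP; split; lra.
have tte : `|t - t0| <= e by case/andP: tt => t1 t2; rewrite ler_norml; apply/andP; split; lra.
have Wt : w <= `|W.[t]|.
  have := WM t (le_trans tte e_1).
  have : M * `|t - t0| <= w.
    apply: (@le_trans _ _ (M * e2)); first by rewrite ler_wpM2l// (le_trans tte).
    by rewrite /e2 mulrCA ger_pMr// ler_pdivrMr ?ltr_wpDl// mul1r lerDl.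
  have := lerB_dist W.[t0] W.[t]; rewrite distrC (_ : `|W.[t0]| = 2 * w) /w; last by field.
  lra.
have hW : `|h t| * w ^+ N <= 10 * (C * (9 ^+ d * L * e) ^+ N).
  apply: (@le_trans _ _ (`|h t * W.[t] ^+ N|)).
    by rewrite normrM normrX ler_wpM2l// lerXn2r ?nnegrE// ltW.
  have := QP t tte; have := ler_normD (h t * W.[t] ^+ N - Q.[t]) Q.[t]; rewrite subrK.
  move=> h1 h2; apply: (le_trans h1).
  apply: (@le_trans _ _ (C * (L * e) ^+ N + 9 ^+ (d * N).+1 * (C * (L * e) ^+ N))).
    exact: lerD.
  rewrite exprS exprM -!mulrA [X in _ <= _ * (_ * X)]exprMn mulrCA.
  set X := C * (L * e) ^+ N in B0 *; set Y := (9 ^+ d) ^+ N.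
  have Y1 : 1 <= Y by rewrite /Y exprn_ege1// exprn_ege1// ler1n.
  rewrite (_ : C * (Y * _) = Y * X); last by rewrite /X; ring.
  by nra.
have e9 : 9 ^+ d * L * e <= w / 2.
  apply: (@le_trans _ _ (9 ^+ d * L * e1)); first by rewrite ler_wpM2l// mulr_ge0.
  have -> : e1 = (w / 2) / (9 ^+ d * L + 1) by rewrite /e1 invfM mulrA.
  have u0 : 0 < w / 2 by rewrite divr_gt0.
  clear - u0 A0; move: (w / 2) (9 ^+ d * L) u0 A0 => u A u0 A0.
  by rewrite mulrA ler_pdivrMr// mulrC ler_pM2l// lerDl.
have wN : 0 < w ^+ N by rewrite exprn_gt0.
rewrite -(ler_pM2r wN) (le_trans hW)// (_ : 10 * C * _ * _ = 10 * (C * (w / 2) ^+ N)).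
  rewrite ler_wpM2l// ler_wpM2l// lerXn2r// nnegrE ?divr_ge0 ?(ltW w0)//.
  by rewrite !mulr_ge0 ?exprn_ge0// ltW.
by rewrite [(w / 2) ^+ N]exprMn; ring.
Qed.

End rational_approximation.

(** * Polynomial approximation of analytic functions *)

Section box_approximation.
Context {R : realType} {m : nat}.
Implicit Types (a y : 'rV[R]_m) (g : 'rV[R]_m -> R).

Definition box_sum (t : {ffun 'I_m -> nat} -> R) N : R :=
  \sum_(k : {ffun 'I_m -> 'I_N}) t [ffun i => k i : nat].

Let index M (k : {ffun 'I_m -> 'I_M}) : {ffun 'I_m -> nat} := [ffun i => k i : nat].

Let index_inj M : injective (@index M).
Proof.
move=> k k' /ffunP kk'; apply/ffunP => i; apply: val_inj.
by have := kk' i; rewrite !ffunE.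
Qed.

Lemma box_sum_le_esum (t : {ffun 'I_m -> nat} -> R) M :
  ((box_sum (fun k => `|t k|) M)%:E <= \esum_(k in setT) `|(t k)%:E|)%E.
Proof.
pose s := [seq index k | k <- enum {ffun 'I_m -> 'I_M}].
have us : uniq s by rewrite map_inj_uniq ?enum_uniq//; exact: index_inj.
apply: esum_ge; exists [set` s]; first by split=> //; exact: finite_seq.
rewrite -fsbig_seq// /s big_map big_enum /= /box_sum sumEFin lee_fin.
by apply: ler_sum => k _; exact: lexx.
Qed.

(** The index boxes are nested, and the larger sum contains in addition the
    multi-indices with an entry at least [N]. *)
Lemma box_sumB (t : {ffun 'I_m -> nat} -> R) N M : (N <= M)%N ->
  box_sum t M - box_sum t N =
  \sum_(k : {ffun 'I_m -> 'I_M} | ~~ [forall i, k i < N]%N) t (index k).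
Proof.
move=> NM; apply/eqP; rewrite subr_eq addrC; apply/eqP.
rewrite /box_sum (bigID (fun k : {ffun 'I_m -> 'I_M} => [forall i, k i < N]%N))/=.
congr (_ + _).
pose h (k : {ffun 'I_m -> 'I_N}) : {ffun 'I_m -> 'I_M} := [ffun i => widen_ord NM (k i)].
have h_inj : injective h.
  move=> k k' /ffunP kk'; apply/ffunP => i; apply: val_inj.
  by have := kk' i; rewrite !ffunE => /(congr1 val).
transitivity (\sum_(k in [set h k | k in predT]%SET) t (index k)).
  apply: eq_bigl => k; apply/forallP/imsetP => [kN|[k' _ ->] i]; last by rewrite ffunE /= ltn_ord.
  exists [ffun i => Ordinal (kN i)] => //; apply/ffunP => i; rewrite !ffunE.
  exact: val_inj.
rewrite big_imset/=; last by move=> k k' _ _; exact: h_inj.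
by apply: eq_bigr => k _; congr t; apply/ffunP => i; rewrite !ffunE.
Qed.

(** A monomial with an exponent at least [N] gains a factor [s ^+ N] when the
    variables are scaled by [s]; the sum of the absolute values of the terms at the
    corner of a box inside the ball of convergence bounds the remainder. *)
Lemma analytic_box_approx g a : real_analytic_at g a ->
  exists (c : {ffun 'I_m -> nat} -> R) (r C : R), [/\ 0 < r, 0 <= C &
    forall N s y, 0 <= s <= 1 -> (forall i, `|y ord0 i - a ord0 i| <= s * r) ->
    `|g y - box_sum (fun k => c k * \prod_(i < m) (y ord0 i - a ord0 i) ^+ k i) N|
      <= C * s ^+ N].
Proof.
move=> [c [r' [r'0 H]]].
pose r := r' / (m%:R + 1); have r0 : 0 < r by rewrite divr_gt0// ltr_wpDl.
have close y : (forall i, `|y ord0 i - a ord0 i| <= r) -> enorm (y - a) < r'.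
  move=> ya; apply: (@le_lt_trans _ _ (m%:R * r)).
    by apply: enorm_le_sup => i; rewrite !mxE.
  by rewrite /r mulrCA gtr_pMr// ltr_pdivrMr ?ltr_wpDl// mul1r ltrDl.
pose y1 := a + const_mx r.
have [|sm _] := H y1.
  by apply: close => i; rewrite !mxE addrAC subrr add0r gtr0_norm.
pose T (k : {ffun 'I_m -> nat}) := c k * \prod_(i < m) r ^+ k i.
have smT : (\esum_(k in setT) `|(T k)%:E| < +oo)%E.
  move: sm; rewrite /summable; congr (_ < _)%E; apply: eq_esum => k _ /=.
  by congr (`|_%:E|)%E; congr (_ * _); apply: eq_bigr => i _; rewrite !mxE addrAC subrr add0r.
pose C := fine (\esum_(k in setT) `|(T k)%:E|)%E.
have C0 : 0 <= C by rewrite fine_ge0// esum_ge0.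
have boxC M : box_sum (fun k => `|T k|) M <= C.
  rewrite -lee_fin fineK; first exact: box_sum_le_esum.
  by rewrite ge0_fin_numE// esum_ge0.
exists c, r, C; split=> // N s y /andP[s0 s1] ya.
set t := fun k => _.
have ty (k : {ffun 'I_m -> nat}) i : (N <= k i)%N -> `|t k| <= `|T k| * s ^+ N.
  move=> Nk; rewrite /t /T !normrM -mulrA ler_wpM2l// !normr_prod.
  apply: (@le_trans _ _ (\prod_(i < m) (r ^+ k i * s ^+ k i))).
    apply: ler_prod => j _; rewrite normr_ge0 normrX -exprMn lerXn2r ?nnegrE//.
      by rewrite mulr_ge0// ltW.
    by rewrite mulrC ya.
  rewrite big_split/= ler_pM//.
  - by apply: prodr_ge0 => j _; rewrite exprn_ge0// ltW.
  - by apply: prodr_ge0 => j _; rewrite exprn_ge0.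
  - by apply: ler_prod => j _; rewrite exprn_ge0 ?(ltW r0)//= ger0_norm ?exprn_ge0// ltW.
  rewrite (bigD1 i)//= -[leRHS]mulr1 ler_pM ?exprn_ge0//.
  - by apply: prodr_ge0 => j _; rewrite exprn_ge0.
  - by rewrite ler_wiXn2l.
  - apply: (@le_trans _ _ (\prod_(j < m | j != i) 1)); last by rewrite big1.
    by apply: ler_prod => j _; rewrite exprn_ge0// exprn_ile1.
have tail M : (N <= M)%N -> `|box_sum t M - box_sum t N| <= C * s ^+ N.
  move=> NM; rewrite box_sumB// (le_trans (ler_norm_sum _ _ _))//.
  apply: (@le_trans _ _ (box_sum (fun k => `|T k|) M * s ^+ N)); last first.
    by rewrite ler_wpM2r ?exprn_ge0// boxC.
  rewrite /box_sum mulr_suml [leRHS](bigID (fun k : {ffun 'I_m -> 'I_M} => [forall i, k i < N]%N))/=.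
  rewrite ler_wpDl//; first by apply: sumr_ge0 => k _; rewrite mulr_ge0// exprn_ge0.
  apply: ler_sum => k; rewrite negb_forall => /existsP[i]; rewrite -leqNgt => Nk.
  by apply: (ty _ i); rewrite ffunE.
have [|_ lim] := H y.
  by apply: close => i; rewrite (le_trans (ya i))// ger_pMl.
rewrite leNgt; apply/negP => big.
have d0 : 0 < `|g y - box_sum t N| - C * s ^+ N by rewrite subr_gt0.
have /cvgrPdist_lt /(_ _ d0) near_lim := lim.
near \oo => M.
have NM : (N <= M)%N by near: M; exact: nbhs_infty_ge.
have h1 : `|g y - box_sum t M| < `|g y - box_sum t N| - C * s ^+ N by near: M.
have h2 := tail M NM.
have := ler_normD (g y - box_sum t M) (box_sum t M - box_sum t N).
by rewrite addrA subrK; lra.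
Unshelve. all: by end_near. Qed.

End box_approximation.

(** * Stereographic charts *)

Section stereographic_charts.
Context {R : realType} {n : nat}.
Local Notation S := (sphere R n).
Implicit Types (x y z : S) (f : S -> R).

(** The stereographic projection with inverse [stereo_inv b]. *)
Definition chart (b : bool) z : 'rV[R]_n :=
  \row_j (spval z ord0 (lift ord0 j) / (1 - (-1) ^+ b * spval z ord0 ord0)).

Lemma stereo_inv_chart (b : bool) z : 1 - (-1) ^+ b * spval z ord0 ord0 != 0 ->
  stereo_inv b (chart b z) = z.
Proof.
set z0 := spval z ord0 ord0; set sg := (-1) ^+ b => u0.
have sg2 : sg * sg = 1 by rewrite -expr2 sqrr_sign.
pose u := 1 - sg * z0.
have zz : z0 * z0 + \sum_(j < n) spval z ord0 (lift ord0 j) * spval z ord0 (lift ord0 j) = 1.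
  by rewrite -[RHS](dotv_sphere z) /dotv big_ord_recl.
have e2 : enorm (chart b z) ^+ 2 = (1 + sg * z0) / u.
  rewrite sqr_enorm /dotv.
  under eq_bigr do rewrite !mxE -/z0 -/sg -/u mulrACA -invfM.
  rewrite -mulr_suml (_ : \sum_(j < n) _ = 1 - z0 * z0); last by rewrite -zz addrC addKr.
  have -> : 1 - z0 * z0 = (1 + sg * z0) * u.
    rewrite (_ : (1 + _) * u = 1 - sg * sg * (z0 * z0)); last by rewrite /u; ring.
    by rewrite sg2 mul1r.
  by rewrite invfM mulrA mulfK.
have e21 : enorm (chart b z) ^+ 2 + 1 = 2 / u by rewrite e2 /u; field.
apply: sphere_inj; apply/rowP => i; rewrite /stereo_inv /= mxE e21.
case: unliftP => [j|] ->.
  by rewrite !mxE -/z0 -/sg -/u; field.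
rewrite e2 -/z0 (_ : (1 + sg * z0) / u - 1 = 2 * sg * z0 / u); last by rewrite /u; field.
rewrite -/sg (_ : sg * (2 * sg * z0 / u) / (2 / u) = sg * sg * z0); last by field.
by rewrite sg2 mul1r.
Qed.

Lemma exists_chart z : exists b : bool, 1 <= 1 - (-1) ^+ b * spval z ord0 ord0.
Proof.
have [z0|z0] := leP 0 (spval z ord0 ord0).
  by exists true; rewrite expr1 mulN1r opprK lerDl.
by exists false; rewrite expr0 mul1r lerDl oppr_ge0 ltW.
Qed.

Lemma box_sum1 m (c : {ffun 'I_m -> nat} -> R) (d : 'I_m -> R) :
  box_sum (fun k => c k * \prod_(i < m) d i ^+ k i) 1 = box_sum c 1.
Proof.
apply: eq_bigr => k _; rewrite big1 ?mulr1// => i _.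
by rewrite ffunE ord1 expr0.
Qed.

(** The estimate of [analytic_box_approx] for [N = 1], where the partial sum is a
    constant, bounds the oscillation of the function near the centre. *)
Lemma sphere_analytic_scont f : sphere_analytic f -> scont f.
Proof.
move=> af x e e0.
have [b ub] := exists_chart x; set u := 1 - _ in ub.
have [c [r [C [r0 C0 H]]]] := analytic_box_approx (af b (chart b x)).
have fE z : 1 - (-1) ^+ b * spval z ord0 ord0 != 0 ->
    (f \o stereo_inv b) (chart b z) = f z by move=> z0 /=; rewrite stereo_inv_chart.
pose d := Num.min (2^-1) (Num.min (r / 6) (e * r / (12 * (C + 1)))).
have d0 : 0 < d by rewrite !lt_min invr_gt0 ltr0n !divr_gt0 ?mulr_gt0// ltr_wpDl.
exists (1 - d ^+ 2 / 2); split; first by rewrite gtrBl divr_gt0// exprn_gt0.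
move=> z xz.
have xzd : enorm (spval x - spval z) <= d.
  by rewrite -(@ler_pXn2r _ 2)// ?nnegrE ?enorm_ge0 ?(ltW d0)// sqr_chord; lra.
have xzi i : `|spval x ord0 i - spval z ord0 i| <= d.
  by have := enorm_coord (spval x - spval z) i; rewrite !mxE => /le_trans; apply.
have [d_2 d_r d_e] : [/\ d <= 2^-1, d <= r / 6 & d <= e * r / (12 * (C + 1))].
  by split; rewrite /d !ge_min lexx ?orbT.
set sg := (-1) ^+ b in u ub fE *.
have sg1 : `|sg| = 1 by rewrite normr_sign.
pose w := 1 - sg * spval z ord0 ord0.
have uw : `|u - w| <= d.
  rewrite /u /w (_ : _ - _ = sg * (spval z ord0 ord0 - spval x ord0 ord0)); last by ring.
  by rewrite normrM sg1 mul1r distrC xzi.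
have w2 : 2^-1 <= w by move: uw; rewrite ler_distl; lra.
have w0 : 0 < w by rewrite (lt_le_trans _ w2)// invr_gt0.
have u0 : 0 < u by rewrite (lt_le_trans _ ub).
pose s := 6 * d / r.
have s0 : 0 <= s by rewrite divr_ge0 ?mulr_ge0 ?(ltW d0) ?(ltW r0).
have s1 : s <= 1 by rewrite ler_pdivrMr// mul1r; lra.
have close i : `|chart b z ord0 i - chart b x ord0 i| <= s * r.
  rewrite /s divfK ?gt_eqF// !mxE -/sg -/w -/u.
  set zi := spval z ord0 _; set xi := spval x ord0 _.
  have zxi : `|xi - zi| <= d by exact: xzi.
  have xi1 : `|xi| <= 1 by rewrite -(enorm_sphere x) enorm_coord.
  rewrite (_ : _ - _ = ((zi - xi) / w + xi * (u - w) / (w * u))); last first.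
    by field; rewrite !gt_eqF.
  rewrite (le_trans (ler_normD _ _))//.
  have h1 : `|(zi - xi) / w| <= 2 * d.
    rewrite normrM normfV (gtr0_norm w0) ler_pdivrMr// distrC (le_trans zxi)//.
    by nra.
  have h2 : `|xi * (u - w) / (w * u)| <= 2 * d.
    rewrite normrM normfV (gtr0_norm (mulr_gt0 w0 u0)) ler_pdivrMr ?mulr_gt0// normrM.
    apply: (@le_trans _ _ (1 * d)); first by rewrite ler_pM.
    have : 2^-1 <= w * u by rewrite -[leLHS]mulr1 ler_pM.
    by nra.
  by lra.
have := H 1%N s (chart b z); rewrite s0 s1 => /(_ erefl close).
have := H 1%N 0 (chart b x); rewrite lexx ler01 => /(_ erefl).
rewrite !box_sum1 !fE ?gt_eqF// !expr1 mulr0 mul0r => h1 h2.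
have {}h1 : f x = box_sum c 1.
  by apply/eqP; rewrite -subr_eq0 -normr_le0 h1// => i; rewrite subrr normr0.
rewrite -h1 distrC in h2; apply: (le_lt_trans h2).
apply: (@le_lt_trans _ _ (C * (6 * (e * r / (12 * (C + 1))) / r))).
  by rewrite ler_wpM2l// ler_pM2r ?invr_gt0// ler_pM2l.
rewrite (_ : C * _ = C / (C + 1) * (e / 2)); last by field; rewrite !gt_eqF// ltr_wpDl.
apply: (@le_lt_trans _ _ (1 * (e / 2))); last by rewrite mul1r; lra.
by rewrite ler_pM2r ?divr_gt0// ler_pdivrMr ?ltr_wpDl// mul1r lerDl.
Qed.

End stereographic_charts.

(** * Unique continuation on the sphere *)

Section unique_continuation.
Context {R : realType} {n : nat}.
Local Notation S := (sphere R n).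
Implicit Types (x y z : S) (f : S -> R).

Lemma size_prod_le (k D : nat) (F : 'I_k -> {poly R}) :
  (forall i, (size (F i) <= D.+1)%N) -> (size (\prod_i F i)%R <= (k * D).+1)%N.
Proof.
elim: k F => [|k IH] F sF; first by rewrite big_ord0 size_poly1.
by rewrite big_ord_recl mulSn size_polyM_le// IH.
Qed.

Lemma poly_lipschitz_all (k : nat) (B : 'I_k -> {poly R}) t0 :
  (forall j, (B j).[t0] = 0) -> exists2 M, 0 <= M &
  forall t, `|t - t0| <= 1 -> forall j, `|(B j).[t]| <= M * `|t - t0|.
Proof.
move=> B0.
have /boolp.choice[F FP] : forall j, exists M, 0 <= M /\
    forall t, `|t - t0| <= 1 -> `|(B j).[t]| <= M * `|t - t0|.
  move=> j; have [M M0 MP] := poly_lipschitz (B j) t0.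
  by exists M; split=> // t /MP; rewrite B0 subr0.
exists (\sum_j F j); first by apply: sumr_ge0 => j _; case: (FP j).
move=> t tt j; have [_ /(_ t tt) /le_trans] := FP j; apply.
rewrite ler_wpM2r// (bigD1 j)//= lerDl sumr_ge0// => i _; by case: (FP i).
Qed.

(** In the chart the curve has the coordinates [P j / V], with the denominator
    [V = q * (1 - c_0)] or [V = q * (1 + c_0)]. The partial sum over the box of
    size [N] has degree less than [N] in each of the [n] variables, so that
    [W = V ^+ n] to the power [N] clears its denominators. *)
Lemma analytic_on_rational_curve f (P : 'I_n.+1 -> {poly R}) (q : {poly R})
    (c : R -> S) (t0 e : R) : sphere_analytic f -> 0 < e -> 0 < q.[t0] ->
  (forall t, `|t - t0| <= e -> 0 < q.[t] /\ forall i, spval (c t) ord0 i = (P i).[t] / q.[t]) ->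
  rational_approx (f \o c) t0.
Proof.
move=> af e0 q0 cP.
have [b ub] := exists_chart (c t0); set sg := (-1) ^+ b in ub.
pose V := q - sg *: P ord0.
have VE t : `|t - t0| <= e -> V.[t] = q.[t] * (1 - sg * spval (c t) ord0 ord0).
  move=> /cP[qt ct]; rewrite /V !hornerE ct.
  by field; rewrite gt_eqF.
have tt0 : `|t0 - t0| <= e by rewrite subrr normr0 ltW.
have V0 : 0 < V.[t0] by rewrite VE// mulr_gt0// (lt_le_trans _ ub).
pose v0 := V.[t0] / 2; have v00 : 0 < v0 by rewrite divr_gt0.
have [|e1 e10 Ve1] := @poly_near_gt _ V t0 v0; first by rewrite /v0; lra.
pose a := chart b (c t0).
pose B j := P (lift ord0 j) - a ord0 j *: V.
have chE t j : `|t - t0| <= e -> V.[t] != 0 -> chart b (c t) ord0 j = (P (lift ord0 j)).[t] / V.[t].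
  move=> te Vt; have [qt ct] := cP t te; rewrite mxE -/sg ct VE//.
  by rewrite -mulrA -invfM.
have B0 j : (B j).[t0] = 0.
  by rewrite /B hornerD hornerN hornerZ /a chE ?gt_eqF// divfK ?subrr// gt_eqF.
have [M M0 BM] := poly_lipschitz_all B0.
have [c' [r [C [r0 C0 H]]]] := analytic_box_approx (af b a).
pose W := V ^+ n; have [MW MW0 WM] := poly_bound W t0.
pose K := M / (v0 * r); have K0 : 0 <= K by rewrite divr_ge0// mulr_ge0// ltW.
pose rho := Num.min (Num.min 1 e) (Num.min e1 (K + 1)^-1).
have rho0 : 0 < rho by rewrite !lt_min ltr01 e0 e10 invr_gt0 ltr_wpDl.
pose s0 := (\sum_j size (B j) + size V)%N.
have sB j : (size (B j) <= s0)%N by rewrite /s0 (bigD1 j)//= -addnA leq_addr.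
have sV : (size V <= s0)%N by rewrite leq_addl.
exists (n * s0)%N, W, (MW * K), rho, C; split=> //.
- by rewrite /W horner_exp expf_neq0// gt_eqF.
- exact: mulr_ge0.
move=> N.
pose Q := \sum_(k : {ffun 'I_n -> 'I_N}) c' [ffun i => k i : nat] *:
  \prod_(j < n) (B j ^+ k j * V ^+ (N - k j)).
exists Q.
  rewrite (leq_trans (size_sum _ _ _))//; apply/bigmax_leqP => k _.
  rewrite (leq_trans (size_scale_leq _ _))// -mulnA size_prod_le// => j.
  rewrite -[X in (s0 * X)%N](subnKC (ltnW (ltn_ord (k j)))) mulnDr.
  by apply: size_polyM_le; apply: size_polyX_le; rewrite (leq_trans _ (leqnSn _)).
move=> t s /andP[s00]; rewrite /rho !le_min => /andP[/andP[s_1 se] /andP[se1 sK]] ts.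
have t1 : `|t - t0| <= 1 := le_trans ts s_1.
have te : `|t - t0| <= e := le_trans ts se.
have Vt : v0 < V.[t] by apply: Ve1; exact: le_trans ts se1.
have Vt0 : 0 < V.[t] := lt_trans v00 Vt.
have c1 : 1 - sg * spval (c t) ord0 ord0 != 0.
  by have := Vt0; rewrite VE// => /gt_eqF/negbT; rewrite mulf_eq0 negb_or => /andP[].
have chB j : chart b (c t) ord0 j - a ord0 j = (B j).[t] / V.[t].
  rewrite chE// ?gt_eqF// /B hornerD hornerN hornerZ; field; by rewrite gt_eqF.
have sK1 : K * s <= 1.
  apply: (@le_trans _ _ (K * (K + 1)^-1)); first by rewrite ler_wpM2l.
  by rewrite ler_pdivrMr ?ltr_wpDl// mul1r lerDl.
have := H N (K * s) (chart b (c t)); rewrite sK1 mulr_ge0// => /(_ erefl).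
rewrite /= stereo_inv_chart// => Hb.
have {}Hb := Hb _.
have {}Hb : `|f (c t) - box_sum (fun k => c' k *
    \prod_(i < n) (chart b (c t) ord0 i - a ord0 i) ^+ k i) N| <= C * (K * s) ^+ N.
  apply: Hb => j; rewrite chB normrM normfV (gtr0_norm Vt0) ler_pdivrMr//.
  apply: (le_trans (BM t t1 j)).
  apply: (@le_trans _ _ (M * s)); first by rewrite ler_wpM2l.
  rewrite /K (_ : M / _ * s * r * _ = M * s * (V.[t] / v0)); last by field; rewrite !gt_eqF.
  by rewrite ler_peMr ?mulr_ge0// ler_pdivlMr// mul1r ltW.
set bx := box_sum _ _ in Hb.
have -> : Q.[t] = bx * W.[t] ^+ N.
  rewrite /Q horner_sum /bx /box_sum mulr_suml; apply: eq_bigr => k _.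
  rewrite hornerZ -mulrA; congr (_ * _).
  rewrite /W horner_exp -exprM mulnC exprM.
  rewrite horner_prod -[n in _ ^+ n]card_ord -prodr_const -big_split/=.
  apply: eq_bigr => j _; rewrite chB hornerM !horner_exp ffunE.
  have -> : V.[t] ^+ N = V.[t] ^+ k j * V.[t] ^+ (N - k j) by rewrite -exprD subnKC// ltnW.
  by rewrite mulrA -exprMn divfK// gt_eqF.
rewrite /= -mulrBl normrM (_ : C * _ = C * (K * s) ^+ N * MW ^+ N); last first.
  by rewrite -mulrA -exprMn; congr (_ * _ ^+ _); ring.
by rewrite ler_pM// normrX lerXn2r ?nnegrE// WM.
Qed.

Lemma exists_third_point x y : (1 <= n)%N -> exists z : S, z != x /\ z != y.
Proof.
case: n x y => // k x y _; pose N := @north R k.+1.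
pose N' := srefl (delta_mx ord0 ord0) N.
have e1 : enorm (delta_mx ord0 (lift ord0 ord0) : 'rV[R]_k.+2) == 1.
  by rewrite /enorm dotv_delta mxE !eqxx sqrtr1.
pose E := Sphere e1 : sphere R k.+1.
have N0 : spval N ord0 ord0 = 1 by rewrite mxE.
have N'0 : spval N' ord0 ord0 = -1.
  by rewrite -(dotv_delta (spval N')) dotv_srefl_dir dotv_delta N0.
have E0 : spval E ord0 ord0 = 0 by rewrite mxE.
have NN' : N != N'.
  by apply/eqP => /(congr1 (fun u => spval u ord0 ord0)) /eqP; rewrite N0 N'0; apply/negP; lra.
have NE : N != E by apply/eqP => /(congr1 (fun u => spval u ord0 ord0)) /eqP; rewrite N0 E0 oner_eq0.
have N'E : N' != E.
  by apply/eqP => /(congr1 (fun u => spval u ord0 ord0)) /eqP; rewrite N'0 E0 oppr_eq0 oner_eq0.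
have [Nx|Nx] := eqVneq N x; have [Ny|Ny] := eqVneq N y; last by exists N.
- by exists N'; rewrite -Nx -Ny eq_sym.
- have [N'y|N'y] := eqVneq N' y; last by exists N'; rewrite -Nx eq_sym.
  by exists E; rewrite -Nx -N'y eq_sym NE eq_sym.
- have [N'x|N'x] := eqVneq N' x; last by exists N'; split; rewrite // -Ny eq_sym.
  by exists E; split; rewrite -?Ny -?N'x eq_sym.
Qed.

(** The points [x] and [y] are joined by the curve of the images of a third point
    [z] under the reflections that exchange [z] with the points of the chord. Its
    coordinates are rational, and so are those of its mirror image in [v]. The
    difference of [f] along the two curves vanishes near the parameter 0, and the
    supremum of the parameters up to which it vanishes is 1. *)
Lemma analytic_reflection_continuation f v x (kappa : R) : (1 <= n)%N ->
  sphere_analytic f -> kappa < 1 ->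
  (forall z, kappa < dotv x z -> f z = f (srefl v z)) ->
  forall y, f y = f (srefl v y).
Proof.
move=> n1 af k1 Hx y.
have [z [zx zy]] := exists_third_point x y n1.
pose w t : 'rV[R]_n.+1 := (spval z - spval x) - t *: (spval y - spval x).
pose c t := srefl (w t) z.
have c0 : c 0 = x by rewrite /c /w scale0r subr0 srefl_swap.
have c1 : c 1 = y by rewrite /c /w scale1r opprB addrA subrK srefl_swap.
pose wp i : {poly R} := (spval z ord0 i - spval x ord0 i)%:P - (spval y ord0 i - spval x ord0 i) *: 'X.
have wpE i t : (wp i).[t] = w t ord0 i by rewrite /wp !hornerE /w !mxE mulrC.
have [q qE] : exists q : {poly R}, forall t, q.[t] = dotv (w t) (w t).
  exists (\sum_i wp i * wp i) => t.
  by rewrite horner_sum; apply: eq_bigr => i _; rewrite hornerM wpE.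
have [zw zwE] : exists zw : {poly R}, forall t, zw.[t] = dotv z (w t).
  exists (\sum_j spval z ord0 j *: wp j) => t.
  by rewrite horner_sum; apply: eq_bigr => j _; rewrite hornerZ wpE.
pose P i := spval z ord0 i *: q - (2 *: zw) * wp i.
have PE t i : 0 < q.[t] -> spval (c t) ord0 i = (P i).[t] / q.[t].
  move=> qt; have q0 : q.[t] != 0 by rewrite gt_eqF.
  rewrite /c val_srefl mul_reflmx /P hornerD hornerN hornerM !hornerZ wpE zwE.
  rewrite -qE mxE [X in _ + X]mxE mxE.
  by field.
have q_gt0 (t : R) : 0 <= t <= 1 -> 0 < q.[t].
  move=> /andP[t0 t1]; rewrite qE dotvv_gt0.
  have zwt : 0 < dotv z (w t).
    rewrite /w !dotvE dotv_sphere.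
    have h1 : dotv z x < 1.
      by rewrite lt_neqAle dotv_sphere_le1 andbT; apply: contraNneq zx => /dotv_sphere1 ->.
    have h2 : dotv z y < 1.
      by rewrite lt_neqAle dotv_sphere_le1 andbT; apply: contraNneq zy => /dotv_sphere1 ->.
    rewrite (_ : _ - _ = (1 - t) * (1 - dotv z x) + t * (1 - dotv z y)); last by ring.
    have [<-|t'0] := eqVneq 0 t; first by rewrite subr0 mul1r mul0r addr0 subr_gt0.
    rewrite ltr_wpDl// ?mulr_ge0 ?subr_ge0 ?(ltW h1)// mulr_gt0 ?subr_gt0//.
    by rewrite lt_neqAle t'0.
  by apply: contraTneq zwt => ->; rewrite dotv0 ltxx.
have q_near (t : R) : 0 <= t <= 1 -> exists2 e, 0 < e & forall u, `|u - t| <= e -> 0 < q.[u].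
  by move=> /q_gt0 /poly_near_gt.
pose h t := f (c t) - f (srefl v (c t)).
have hA (t : R) : 0 <= t <= 1 -> rational_approx h t.
  move=> t01; have [e e0 qe] := q_near t t01.
  apply: (@rational_approxB _ (f \o c) (f \o (srefl v \o c))).
    by apply: (analytic_on_rational_curve (P := P) (q := q) af e0) => [|u /qe qu]; [exact: q_gt0|split=> // i; exact: PE].
  apply: (analytic_on_rational_curve (P := fun i => \sum_j reflmx v j i *: P j) (q := q) af e0).
    exact: q_gt0.
  move=> u /qe qu; split=> // i.
  rewrite /= val_srefl mxE horner_sum mulr_suml; apply: eq_bigr => j _.
  by rewrite PE// hornerZ mulrC mulrA.
have t00 : 0 <= (0 : R) <= 1 by rewrite lexx ler01.
have [e e0 he] : exists2 e, 0 < e & forall t : R, 0 <= t <= e -> t <= 1 -> h t = 0.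
  (* The curve stays in the cap around [x] as long as this polynomial is positive. *)
  pose p := \sum_i spval x ord0 i *: P i - kappa *: q.
  have pE (t : R) : 0 <= t <= 1 -> p.[t] = q.[t] * (dotv x (c t) - kappa).
    move=> /q_gt0 qt; rewrite /p hornerD hornerN hornerZ horner_sum mulrBr.
    congr (_ - _); last by rewrite mulrC.
    rewrite /dotv mulr_sumr; apply: eq_bigr => i _; rewrite hornerZ PE//.
    by field; rewrite gt_eqF.
  have p0 : 0 < p.[0] by rewrite pE// c0 dotv_sphere mulr_gt0 ?q_gt0// subr_gt0.
  have [e e0 pe] := poly_near_gt p0; exists e => // t /andP[t0 te] t1.
  have t01 : 0 <= t <= 1 by rewrite t0.
  apply/eqP; rewrite subr_eq0; apply/eqP/Hx.
  have := pe t; rewrite subr0 ger0_norm// => /(_ te).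
  by rewrite pE// pmulr_rgt0 ?q_gt0// subr_gt0.
pose A := [set t | 0 <= t <= 1 /\ forall u, 0 <= u <= t -> h u = 0].
have A0 : A 0.
  split=> // u /andP[u0 u1]; apply: he; rewrite ?u0 ?(le_trans u1)// ltW//.
have supA : has_sup A by split; [exists 0|exists 1 => t [/andP[]]].
pose T := sup A.
have T1 : T <= 1 by apply: ge_sup; [exists 0|move=> t [/andP[]]].
have T0 : 0 < T.
  apply: (@lt_le_trans _ _ (Num.min e 1)); first by rewrite lt_min e0 ltr01.
  apply: (sup_upper_bound supA); split.
    by rewrite le_min (ltW e0) ler01 ge_min lexx orbT.
  by move=> u /andP[u0]; rewrite le_min => /andP[ue u1]; apply: he; rewrite ?u0.
have hT u : 0 <= u < T -> h u = 0.
  move=> /andP[u0 uT]; have d0 : 0 < T - u by rewrite subr_gt0.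
  have [t [_ tP]] := sup_adherent d0 supA; rewrite -/T subKr => /ltW ut.
  by apply: tP; rewrite u0.
have hAT : rational_approx h T by apply: hA; rewrite (ltW T0).
have [|d d0 hd] := rational_approx_continuation hAT T0.
  by move=> t; rewrite subrr; exact: hT.
pose T' := Num.min 1 (T + d / 2).
have AT' : A T'.
  split=> [|u /andP[u0 uT]].
    by rewrite le_min ler01 addr_ge0 ?divr_ge0 ?(ltW T0) ?(ltW d0)//= ge_min lexx.
  have [uT'|uT'] := ltP u T; first by apply: hT; rewrite u0.
  apply: hd; rewrite uT'/=; move: uT; rewrite le_min => /andP[_ ?]; lra.
have : T' <= T by exact: (sup_upper_bound supA).
rewrite /T' ge_min => /orP[T1'|]; last by lra.
have T1E : T = 1 by apply/eqP; rewrite eq_le T1.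
have : h 1 = 0 by apply: hd; rewrite T1E lexx ltrDl.
by rewrite /h c1 => /eqP; rewrite subr_eq0 => /eqP.
Qed.

End unique_continuation.

(** * Propagation of signs and the equality case *)

Section sign_propagation.
Context {R : realType} {n : nat}.
Local Notation S := (sphere R n).
Implicit Types (x y z : S) (f : S -> R) (v : 'rV[R]_n.+1).

Lemma exists_midpoint x y v : 0 < dotv x v -> 0 < dotv y v -> exists m : S,
  [/\ 0 < dotv m v, (1 + dotv x y) / 2 <= dotv m x & (1 + dotv x y) / 2 <= dotv m y].
Proof.
move=> xv yv; pose u := spval x + spval y.
have uv : 0 < dotv u v by rewrite dotvDl addr_gt0.
have u0 : u != 0 by apply: contraTneq uv => ->; rewrite dotvC dotv0 ltxx.
have eu : 0 < enorm u by rewrite enorm_gt0.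
have m1 : enorm ((enorm u)^-1 *: u) == 1.
  by rewrite enormZ gtr0_norm ?invr_gt0// mulVf ?eqxx// gt_eqF.
have uu : enorm u ^+ 2 = 2 * (1 + dotv x y).
  by rewrite sqr_enorm /u !dotvDl !dotvDr !dotv_sphere (dotvC y x); ring.
pose m : S := Sphere m1; set a := dotv x y in uu *.
have ux : dotv u x = 1 + a by rewrite /u dotvDl dotv_sphere (dotvC y).
have uy : dotv u y = 1 + a by rewrite /u dotvDl dotv_sphere addrC.
have e2 : enorm u <= 2.
  by rewrite (le_trans (ler_enormD _ _))// !enorm_sphere.
have low : (1 + a) / 2 <= (enorm u)^-1 * (1 + a).
  rewrite mulrC ler_wpM2r ?lef_pV2 ?posrE//.
  have := sqr_ge0 (enorm u); rewrite uu; lra.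
by exists m; rewrite /m /= !dotvZl ux uy mulr_gt0 ?invr_gt0.
Qed.

(** A pair with different signs could be subdivided at a point where the
    function does not vanish, near the middle of the arc: one of the two halves
    again has different signs and at most half of the value of [1 - x . y], so
    that the local condition applies after finitely many steps. *)
Lemma sign_propagation (D : S -> R) v (c : R) : c < 1 ->
  (forall x y, 0 < dotv x v -> 0 < dotv y v -> c < dotv x y -> 0 <= D x * D y) ->
  (forall z (k : R), k < 1 -> exists2 w : S, k < dotv z w & D w != 0) ->
  forall x y, 0 < dotv x v -> 0 < dotv y v -> 0 <= D x * D y.
Proof.
move=> c1 Hloc Hnz.
have H (k : nat) : forall x y, 0 < dotv x v -> 0 < dotv y v ->
    1 - dotv x y < 2 ^+ k * (1 - c) -> 0 < D x -> 0 <= D y.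
  elim: k => [|k IH] x y xv yv xy Dx.
    rewrite -(pmulr_rge0 _ Dx) Hloc//; move: xy; rewrite expr0 mul1r; lra.
  have [m [mv mx my]] := exists_midpoint xv yv.
  have hx : 1 - 2 ^+ k * (1 - c) < dotv m x by move: xy; rewrite exprS; lra.
  have hy : 1 - 2 ^+ k * (1 - c) < dotv m y by move: xy; rewrite exprS; lra.
  have [a [a1 aP]] := scont_near_gt (scont_dotv v) mv.
  have [b [b1 bP]] := scont_near_gt (scont_dotv x) hx.
  have [d [d1 dP]] := scont_near_gt (scont_dotv y) hy.
  have [|w] := Hnz m (Num.max a (Num.max b d)); first by rewrite !gt_max a1 b1.
  rewrite !gt_max => /and3P[/aP wv /bP wx /dP wy] Dw.
  have [Dw0|Dw0] := ltP 0 (D w); first by apply: (IH w); rewrite //; lra.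
  have : 0 <= D w by apply: (IH x) => //; rewrite dotvC; lra.
  by move=> Dw1; move: Dw; rewrite eq_le Dw0 Dw1.
have c0 : 0 < 1 - c by rewrite subr_gt0.
have [k kP] : exists k : nat, 2 < 2 ^+ k * (1 - c).
  exists (Num.bound (2 / (1 - c))); rewrite -ltr_pdivrMr//.
  rewrite (lt_trans (archi_boundP _)) ?divr_ge0 ?(ltW c0)//.
  by rewrite -natrX ltr_nat ltn_expl.
have {}H x y : 0 < dotv x v -> 0 < dotv y v -> 0 < D x -> 0 <= D y.
  move=> xv yv; apply: (H k) => //; apply: le_lt_trans kP.
  have := dotv_sphere_geN1 x y; lra.
move=> x y xv yv.
have [Dx|Dx|<-] := ltgtP 0 (D x); last by rewrite mul0r.
- by rewrite mulr_ge0 ?(ltW Dx)// (H x).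
- rewrite mulr_le0 ?(ltW Dx)// leNgt; apply/negP => Dy.
  by have := H y x yv xv Dy; rewrite leNgt Dx.
Qed.

End sign_propagation.

Section dot_kernel.
Context {R : realType}.
Variable K : R -> R.

(** The kernel as a function of the inner product, extended by constants. *)
Definition dot_kernel (s : R) := K (acos (Num.max (-1) (Num.min 1 s))).

Let clip_itv (s : R) : -1 <= Num.max (-1) (Num.min 1 s) <= 1.
Proof. by rewrite le_max lexx /= ge_max ge_min lexx /= andbT; lra. Qed.

Lemma dot_kernelE (s : R) : -1 <= s <= 1 -> dot_kernel s = K (acos s).
Proof. by move=> /andP[s1 s2]; rewrite /dot_kernel min_r ?max_r. Qed.

Lemma dot_kernel_ge0 : (forall x, 0 <= x <= pi -> 0 <= K x) ->
  forall s, 0 <= dot_kernel s.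
Proof. by move=> K0 s; apply: K0; rewrite acos_ge0 ?acos_lepi. Qed.

Lemma dot_kernel_homo :
  (forall x y, 0 <= x -> x <= y -> y <= pi -> K y <= K x) -> {homo dot_kernel : s t / s <= t}.
Proof.
move=> Kdecr s t st; have /andP[s1 s2] := clip_itv s; have /andP[t1 t2] := clip_itv t.
apply: Kdecr; rewrite ?acos_ge0 ?acos_lepi ?s1 ?t1//; apply: le_acos => //.
by rewrite ge_max !le_max !le_min !ge_min !lexx st !orbT.
Qed.

Lemma dot_kernel_strict (delta : R) : 0 < delta <= pi ->
  (forall x y, 0 <= x -> x < y -> y <= delta -> K y < K x) ->
  forall s t, cos delta <= s -> s < t -> t <= 1 -> dot_kernel s < dot_kernel t.
Proof.
move=> /andP[d0 dpi] Ks s t ds st t1.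
have s1 : -1 <= s by rewrite (le_trans _ ds)// cos_geN1.
have sI : -1 <= s <= 1 by rewrite s1 (le_trans (ltW st)).
have tI : -1 <= t <= 1 by rewrite t1 (le_trans s1 (ltW st)).
have dd : delta = acos (cos delta) by rewrite cosK// in_itv/= (ltW d0).
rewrite !dot_kernelE//; apply: Ks; first exact: acos_ge0.
  rewrite lt_neqAle (le_acos s1 t1 (ltW st)) andbT.
  apply: contraTneq st => /(congr1 cos); rewrite !acosK ?in_itv// => ->.
  by rewrite ltxx.
by rewrite dd; apply: le_acos; rewrite ?cos_geN1 ?(le_trans (ltW st)).
Qed.

Lemma energy_dot_kernel n (f : sphere R n -> R) : energy dot_kernel f =
  (\int[@surface_measure R n \x @surface_measure R n]_z
     (f z.1 * f z.2 * K (gdist z.1 z.2))%:E)%E.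
Proof.
apply: eq_integral => z _; rewrite /interaction dot_kernelE//.
by rewrite dotv_sphere_le1 dotv_sphere_geN1.
Qed.

End dot_kernel.

Theorem lemma3p7 (R : realType) (n : nat) (n1 : (1 <= n)%N)
  (K : R -> R)
  (K0 : forall x, 0 <= x <= pi -> 0 <= K x)
  (Kdecr : forall x y, 0 <= x -> x <= y -> y <= pi -> K y <= K x)
  (Kstrict : exists delta : R, 0 < delta <= pi /\
    forall x y, 0 <= x -> x < y -> y <= delta -> K y < K x)
  (rho rhostar : sphere R n -> R)
  (rho0 : forall x, 0 <= rho x)
  (rho_an : sphere_analytic rho)
  (rhostarP : symm_decr_rearrangement rho rhostar)
  (equality :
    (\int[@surface_measure R n \x @surface_measure R n]_z
       (rho z.1 * rho z.2 * K (gdist z.1 z.2))%:E =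
     \int[@surface_measure R n \x @surface_measure R n]_z
       (rhostar z.1 * rhostar z.2 * K (gdist z.1 z.2))%:E)%E) :
  exists T : sphere R n -> sphere R n,
    rotation T /\ {ae @surface_measure R n, forall x, rho x = rhostar (T x)}.
Proof.
have [delta [dI Kd]] := Kstrict; have /andP[d0 dpi] := dI.
have crho := sphere_analytic_scont rho_an.
have mrho := scont_measurable crho.
have [M rhoM] := scont_bounded crho.
have {}rhoM x : rho x <= M by rewrite (le_trans (ler_norm _)).
have kh := dot_kernel_homo Kdecr; have k0 := dot_kernel_ge0 K0.
have ks := dot_kernel_strict dI Kd.
have cd1 : cos delta < 1.
  by rewrite -cos0 ltr_cos ?in_itv/= ?lexx ?pi_ge0 ?dpi ?(ltW d0).
(* A polarization of [rho] has the rearrangement [rhostar], so by [equality] its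
   energy is at most that of [rho]. *)
have sign (v : 'rV[R]_n.+1) (x y : sphere R n) : 0 < dotv x v -> 0 < dotv y v ->
    0 <= (rho x - rho (srefl v x)) * (rho y - rho (srefl v y)).
  have [sym|nsym] := pselect (forall z, rho z = rho (srefl v z)).
    by rewrite -sym subrr mul0r.
  apply: (sign_propagation (D := fun z => rho z - rho (srefl v z)) cd1).
    move=> {}x {}y; apply: (energy_polar_eq kh k0 crho rho0 rhoM) => //.
      exact: cos_geN1.
    rewrite (energy_dot_kernel K rho) equality -energy_dot_kernel.
    apply: energy_le_rearrangement => //; first exact: scont_polar.
      exact: polar_ge0.
    case: rhostarP => mr r0 rd re; split=> // t t0.
    by rewrite polar_equimeasurable// re.
  move=> z k kl1; apply: contrapT => nz; apply: nsym.
  apply: (analytic_reflection_continuation n1 rho_an kl1 (x := z)) => w zw.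
  apply/eqP; rewrite -subr_eq0; apply/negPn/negP => Dw.
  by apply: nz; exists w.
have ax : axial (centre_of_mass rho) rho.
  apply: symmetric_about_centre_of_mass => // v.
  by apply: one_sided_of_sign => x y; exact: sign.
have [A [hA dA rA]] := axial_rearrangement n1 mrho rho0 ax rhostarP.
exists (mact A); split=> //; exists A; split=> // x; exact: val_mact.
Qed.
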